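(* Let $d\in\{2,3\}$ and let $D\subset\mathbb{R}^d$ be a bounded domain with boundary $\partial D\in C^2$ and unit normal field $n$ on $\partial D$. Let $0<\alpha<1$. Then the operator $$L:\begin{bmatrix}\sigma_1\\ \sigma_2\end{bmatrix}\mapsto\begin{bmatrix}\partial_nS_{1T} & \partial_nS_{2T}\\ \partial_nS_{1P} & \partial_nS_{2P}\end{bmatrix}\begin{bmatrix}\sigma_1\\ \sigma_2\end{bmatrix}$$ is a compact operator from $C^{0,\alpha}(\partial D)\times C^{0,\alpha}(\partial D)$ into itself.
   Context: Let $\Omega,\Lambda,\gamma$ be positive real parameters with $\gamma\neq 1$. Let $Q$ be a complex constant with $Q^2=4(i\Omega+\gamma\Omega\Lambda)+(1-i\gamma\Omega-i\Lambda)^2$, and assume $Q\ne0$. Let $k_t,k_p\in\mathbb{C}$ be the wave numbers with $$k_t^2=\frac{i}{2\Omega}\,\frac{1-i\gamma\Omega-i\Lambda+Q}{1-i\gamma\Lambda},\qquad k_p^2=\frac{i}{2\Omega}\,\frac{1-i\gamma\Omega-i\Lambda-Q}{1-i\gamma\Lambda},$$ both chosen with (assumed) positive imaginary part, so that $k_t^2\neq k_p^2$. Set $m_t=\frac{\gamma}{\gamma-1}(1+i\Omega k_t^2)$ and $m_p=\frac{\gamma}{\gamma-1}(1+i\Omega k_p^2)$. Let $H_0^{(1)}$ be the Hankel function of the first kind of order zero and $h_0^{(1)}(z)=\frac{-i}{z}e^{iz}$ the spherical Hankel function of the first kind of order zero. For $r>0$ define the $\mathbb{C}^2$-valued kernels,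 whose first component is labelled $T$ and second component $P$: if $d=2$, $$G_1(r)=-\frac{1}{4i}\begin{bmatrix}H_0^{(1)}(k_tr)\\ m_tH_0^{(1)}(k_tr)\end{bmatrix},\qquad G_2(r)=-\frac{1}{4i}\begin{bmatrix}H_0^{(1)}(k_pr)\\ m_pH_0^{(1)}(k_pr)\end{bmatrix},$$ and if $d=3$, $$G_1(r)=-\frac{k_t}{4\pi i}\begin{bmatrix}h_0^{(1)}(k_tr)\\ m_th_0^{(1)}(k_tr)\end{bmatrix},\qquad G_2(r)=-\frac{k_p}{4\pi i}\begin{bmatrix}h_0^{(1)}(k_pr)\\ m_ph_0^{(1)}(k_pr)\end{bmatrix}.$$ For a scalar density $\rho$ on $\partial D$ and $i=1,2$, the vector-valued single-layer potential is $S_i[\rho](x)=\int_{\partial D}G_i(|x-y|)\rho(y)\,ds_y$, with components $S_{iT}[\rho]$ and $S_{iP}[\rho]$. On $\partial D$, $\partial_nS_{i*}$ (with $*\in\{T,P\}$) denotes the boundary integral operator $$\partial_nS_{i*}[\rho](x)=\int_{\partial D}\frac{\partial G_{i*}(|x-y|)}{\partial n_x}\rho(y)\,ds_y,\qquad x\in\partial D,$$ where $G_{i*}$ is the corresponding component of $G_i$ and the integral is understood in the principal-value sense. $C^{0,\alpha}(\partial D)$ is the space of complex-valued Hölder continuous functions on $\partial D$ with exponent $\alpha$. *)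

(* Defs.v *)
From HB Require Import structures.
From mathcomp Require Import all_boot all_order all_algebra.
From mathcomp Require Import all_classical all_reals all_analysis.
From mathcomp Require Import complex.
Set Implicit Arguments. Unset Strict Implicit. Unset Printing Implicit Defensive.
Import Order.TTheory GRing.Theory Num.Theory.
Import numFieldNormedType.Exports.
Local Open Scope classical_set_scope.
Local Open Scope ring_scope.
Local Open Scope complex_scope.

Section complex_functions.
Context {R : realType}.
Implicit Types (z : R[i]) (u : nat -> R[i]).

Definition cmod z : R := Normc.normc z.
Arguments cmod : simpl never.

Definition cexp z : R[i] :=
  (expR (complex.Re z))%:C * (cos (complex.Im z) +i* sin (complex.Im z)).

(* principal argument, in ]-pi, pi] for z != 0 *)
Definition carg z : R :=
  if 0 <= complex.Im z then acos (complex.Re z / cmod z)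
  else - acos (complex.Re z / cmod z).

Definition clog z : R[i] := ln (cmod z) +i* carg z.

Definition cseries u : R[i] :=
  limn (series (fun k => complex.Re (u k))) +i*
  limn (series (fun k => complex.Im (u k))).

Definition euler_gamma : R := limn (fun n => series harmonic n - ln n%:R).

Definition bessel_J0 z : R[i] :=
  cseries (fun k => (-1) ^+ k / (k`!%:R ^+ 2) * (z / 2) ^+ (2 * k)).

(* the classical expansion
   Y_0(z) = (2/pi) (log(z/2) + gamma) J_0(z)
            - (2/pi) \sum_k (-1)^k (1 + 1/2 + ... + 1/k) (z/2)^(2k) / (k!)^2,
   with the principal branch of the logarithm; note that
   series harmonic k = 1 + 1/2 + ... + 1/k. *)
Definition bessel_Y0 z : R[i] :=
  (2 / pi)%:C * (clog (z / 2) + euler_gamma%:C) * bessel_J0 z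
  - (2 / pi)%:C *
    cseries (fun k => (-1) ^+ k * (series harmonic k)%:C / (k`!%:R ^+ 2)
                      * (z / 2) ^+ (2 * k)).

Definition hankel0 z : R[i] := bessel_J0 z + 'i%C * bessel_Y0 z.

Definition spherical_hankel0 z : R[i] := - 'i%C / z * cexp ('i%C * z).

End complex_functions.

(* The norm `|x| of 'rV[R]_d is the sup norm, hence the separate Euclidean norm
   enorm; both define the same topology and the same bounded sets. *)

Section euclidean.
Context {R : realType} {d : nat}.
Implicit Types (x y : 'rV[R]_d) (A : set 'rV[R]_d).

Definition dotp x y : R := \sum_(i < d) x ord0 i * y ord0 i.
Definition enorm x : R := Num.sqrt (dotp x x).
Definition eball x (r : R) : set 'rV[R]_d := [set y | enorm (y - x) < r].

Definition boundary A : set 'rV[R]_d := closure A `\` A°.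

Definition is_domain A := [/\ A !=set0, open A & connected A].

End euclidean.

Section C2_boundary.
Context {R : realType}.

Definition partial m (f : 'rV[R]_m -> R) (i : 'I_m) : 'rV[R]_m -> R :=
  fun x => 'D_(delta_mx ord0 i) f x.

Definition C1_fun m (f : 'rV[R]_m -> R) :=
  forall i, (forall x, derivable f x (delta_mx ord0 i)) /\
            continuous (partial f i).

Definition C2_fun m (f : 'rV[R]_m -> R) :=
  C1_fun f /\ forall i, C1_fun (partial f i).

(* Near each boundary point, D is the part of space lying strictly on one side
   (given by the sign (-1) ^+ s) of the graph, over the hyperplane of the
   coordinates other than the j-th, of a C^2 function phi;
   col' j x is x with its j-th coordinate deleted. *)
Definition C2_boundary d (D : set 'rV[R]_d) :=
  forall x0, boundary D x0 ->
    exists (r : R) (j : 'I_d) (s : bool) (phi : 'rV[R]_(d.-1) -> R),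
      [/\ 0 < r, C2_fun phi &
          D `&` eball x0 r =
          [set x | eball x0 r x /\ phi (col' j x) < (-1) ^+ s * x ord0 j]].

Definition tangent_vector d (S : set 'rV[R]_d) (x v : 'rV[R]_d) :=
  exists c : R -> 'rV[R]_d,
    [/\ c 0 = x, \forall t \near (0 : R), S (c t) & is_derive (0 : R) 1 c v].

(* Continuity rules out arbitrary pointwise sign changes; the inward and the
   outward unit normals are both covered. The values of n off S are
   irrelevant. *)
Definition unit_normal_field d (S : set 'rV[R]_d) (n : 'rV[R]_d -> 'rV[R]_d) :=
  {within S, continuous n} /\
  forall x, S x -> enorm (n x) = 1 /\
    forall v, tangent_vector S x v -> dotp (n x) v = 0.

End C2_boundary.

(* T with the sigma-algebra of all its subsets, so that mu_ext allows arbitrary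
   countable covers *)
Definition discrete_type (T : Type) : Type := T.
HB.instance Definition _ (T : pointedType) := Pointed.on (discrete_type T).
HB.instance Definition _ (T : pointedType) :=
  @isMeasurable.Build default_measure_display (discrete_type T)
    (@discrete_measurable T) (@discrete_measurable0 T)
    (@discrete_measurableC T) (@discrete_measurableU T).

Section hausdorff.
Context {R : realType} {d : nat}.
Local Open Scope ereal_scope.

(* by omega_s = (2 pi / s) omega_(s-2) *)
Fixpoint unit_ball_volume (s : nat) : R :=
  match s with
  | 0%N => 1%R
  | 1%N => 2%R
  | s'.+2 => (2 * pi / s'.+2%:R * unit_ball_volume s')%R
  end.

Definition ediam (A : set 'rV[R]_d) : \bar R :=
  ereal_sup [set (enorm (x - y))%:E | x in A & y in A].

Definition hausdorff_size (s : nat) (delta : R) (A : set 'rV[R]_d) : \bar R :=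
  if A == set0 then 0
  else if ediam A <= delta%:E
  then (unit_ball_volume s / 2 ^+ s)%:E * ediam A ^+ s else +oo.

Definition hausdorff_pre (s : nat) (delta : R) (A : set 'rV[R]_d) : \bar R :=
  @mu_ext _ (discrete_type 'rV[R]_d) R (hausdorff_size s delta) A.

Definition hausdorff (s : nat) (A : set 'rV[R]_d) : \bar R :=
  ereal_sup [set hausdorff_pre s delta A | delta in [set e : R | (0 < e)%R]].

Lemma unit_ball_volume_ge0 s : (0 <= unit_ball_volume s)%R.
Proof.
have [n] := ubnP s; elim: n s => // n IH [|[|s]] //= sn.
by rewrite mulr_ge0 ?divr_ge0 ?mulr_ge0 ?pi_ge0 // IH // ltnW.
Qed.

Lemma hausdorff_size0 s delta : hausdorff_size s delta set0 = 0.
Proof. by rewrite /hausdorff_size eqxx. Qed.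

Lemma hausdorff_size_ge0 s delta A : 0 <= hausdorff_size s delta A.
Proof.
rewrite /hausdorff_size; case: eqVneq => // /set0P[x Ax].
case: ifPn => // _; rewrite mule_ge0 //.
  by rewrite lee_fin divr_ge0 ?unit_ball_volume_ge0 ?exprn_ge0.
rewrite expe_ge0 //; apply: le_ereal_sup_tmp; exists (enorm (x - x))%:E.
  by exists x => //; exists x.
by rewrite lee_fin sqrtr_ge0.
Qed.

Lemma hausdorff_pre_le s delta A : (0 < delta)%R ->
  hausdorff_pre s delta A <= hausdorff s A.
Proof. by move=> d0; apply: ereal_sup_ubound; exists delta. Qed.

Lemma hausdorff0 s : hausdorff s set0 = 0.
Proof.
have H e : hausdorff_pre s e set0 = 0.
  by apply: mu_ext0; [exact: hausdorff_size0|exact: hausdorff_size_ge0].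
apply/eqP; rewrite eq_le; apply/andP; split.
  by apply: ge_ereal_sup => _ [e _ <-]; rewrite H.
by rewrite -{1}(H 1%R); exact: hausdorff_pre_le.
Qed.

Lemma hausdorff_ge0 s A : 0 <= hausdorff s A.
Proof.
apply: le_trans (hausdorff_pre_le s A ltr01).
by apply: mu_ext_ge0; exact: hausdorff_size_ge0.
Qed.

Lemma le_hausdorff s : {homo hausdorff s : A B / A `<=` B >-> A <= B}.
Proof.
move=> A B AB; apply: ge_ereal_sup => _ [e e0 <-].
by apply: le_trans (hausdorff_pre_le s B e0); exact: le_mu_ext.
Qed.

Lemma hausdorff_sigma_subadditive s : sigma_subadditive (hausdorff s).
Proof.
move=> F; apply: ge_ereal_sup => _ [e e0 <-].
apply: (@le_trans _ _ (\sum_(i <oo) hausdorff_pre s e (F i))).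
  by apply: mu_ext_sigma_subadditive; exact: hausdorff_size_ge0.
apply: lee_nneseries => i _; last exact: hausdorff_pre_le.
by move=> _; apply: mu_ext_ge0; exact: hausdorff_size_ge0.
Qed.

HB.instance Definition _ (s : nat) := isOuterMeasure.Build R 'rV[R]_d
  (hausdorff s) (hausdorff0 s) (hausdorff_ge0 s) (@le_hausdorff s)
  (@hausdorff_sigma_subadditive s).

End hausdorff.

(* The (d-1)-dimensional Hausdorff measure on its Caratheodory sigma-algebra:
   the surface measure of hypersurfaces of 'rV[R]_d *)
Definition surface_outer_measure (R : realType) (d : nat) :
  {outer_measure set 'rV[R]_d -> \bar R} := @hausdorff R d d.-1.

Definition surface_space (R : realType) (d : nat) :=
  caratheodory_type (surface_outer_measure R d).

Definition surface_measure (R : realType) (d : nat) :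
    {measure set (surface_space R d) -> \bar R} :=
  OuterMeasure.sort (surface_outer_measure R d).

Section principal_value.
Context {R : realType} {d : nat}.
Implicit Types (S : set 'rV[R]_d) (f : 'rV[R]_d -> R[i]).
Let mu := surface_measure R d.

Definition truncation S (x : 'rV[R]_d) (e : R) : set (surface_space R d) :=
  [set y : 'rV[R]_d | S y /\ e < enorm (y - x)].

Definition truncated_Re S f x (e : R) : R :=
  Rintegral mu (truncation S x e) (fun y => complex.Re (f y)).
Definition truncated_Im S f x (e : R) : R :=
  Rintegral mu (truncation S x e) (fun y => complex.Im (f y)).

(* limit as e -> 0+ of the integrals over S minus the closed Euclidean e-ball
   around x *)
Definition pv_integral S f x : R[i] :=
  lim (truncated_Re S f x e @[e --> 0^'+]) +i*
  lim (truncated_Im S f x e @[e --> 0^'+]).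

Definition pv_exists S f x :=
  [/\ forall e : R, 0 < e ->
        mu.-integrable (truncation S x e) (fun y => (complex.Re (f y))%:E) /\
        mu.-integrable (truncation S x e) (fun y => (complex.Im (f y))%:E),
      cvg (truncated_Re S f x e @[e --> 0^'+]) &
      cvg (truncated_Im S f x e @[e --> 0^'+])].

End principal_value.

Section holder.
Context {R : realType} {d : nat} (A : set 'rV[R]_d) (alpha : R).
Implicit Types (f : A -> R[i]).

Definition is_holder f :=
  (exists C, forall x, cmod (f x) <= C) /\
  (exists C, forall x y,
     cmod (f x - f y) <= C * enorm (\val x - \val y) `^ alpha).

Definition holder_pred : {pred A -> R[i]} := fun f => `[< is_holder f >].

Record holder := Holder { holder_fun :> A -> R[i];
                          holder_funP : holder_fun \in holder_pred }.

Definition sup_norm f : R := sup (range (fun x => cmod (f x))).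

(* the term x = y of the supremum is 0 / 0 ^ alpha = 0 *)
Definition holder_seminorm f : R :=
  sup (range (fun p : A * A => cmod (f p.1 - f p.2)
                               / enorm (\val p.1 - \val p.2) `^ alpha)).

Definition holder_norm f : R := sup_norm f + holder_seminorm f.

Let cmodE z : (cmod z)%:C = `|z| :> R[i].
Proof. by case: z. Qed.

Let cmod_ge0 (z : R[i]) : 0 <= cmod z.
Proof. by case: z => a b; exact: sqrtr_ge0. Qed.

Let cmod0 : cmod (0 : R[i]) = 0.
Proof. exact: Normc.normc0. Qed.

Let cmodD (z w : R[i]) : cmod (z + w) <= cmod z + cmod w.
Proof. by rewrite -lecR rmorphD /= !cmodE ler_normD. Qed.

Let cmodM (z w : R[i]) : cmod (z * w) = cmod z * cmod w.
Proof. exact: Normc.normcM. Qed.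

Let sup_le (I : Type) (g : I -> R) M : 0 <= M -> (forall i, g i <= M) ->
  sup (range g) <= M.
Proof.
move=> M0 gM; have [->|/set0P ne] := eqVneq (range g) set0.
  by rewrite sup0.
by apply: ge_sup => // _ [i _ <-].
Qed.

Let le_sup (I : Type) (g : I -> R) M i : (forall i, g i <= M) ->
  g i <= sup (range g).
Proof.
by move=> gM; apply: ub_le_sup; [exists M => _ [j _ <-]|exists i].
Qed.

Let sup_ge0 (I : Type) (g : I -> R) : (forall i, 0 <= g i) ->
  0 <= sup (range g).
Proof.
move=> g0; have [->|/set0P[_ [i _ _]]] := eqVneq (range g) set0.
  by rewrite sup0.
have [ub|nub] := pselect (has_ubound (range g)).
  by apply: le_trans (g0 i) _; apply: ub_le_sup => //; exists i.
by rewrite sup_out // => -[].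
Qed.

Let quot_bound f : is_holder f -> exists C, forall p : A * A,
  cmod (f p.1 - f p.2) / enorm (\val p.1 - \val p.2) `^ alpha <= C.
Proof.
move=> [_ [C hC]]; exists `|C| => p.
have := hC p.1 p.2; set e := _ `^ _ => h.
have : 0 <= e by exact: powR_ge0.
rewrite le_eqVlt => /orP[/eqP <-|e0]; first by rewrite invr0 mulr0.
by rewrite ler_pdivrMr // (le_trans h) // ler_wpM2r ?ler_norm // ltW.
Qed.

Let quot_ge0 f (p : A * A) :
  0 <= cmod (f p.1 - f p.2) / enorm (\val p.1 - \val p.2) `^ alpha.
Proof. by rewrite divr_ge0 ?powR_ge0. Qed.

Let le_sup_norm f x : is_holder f -> cmod (f x) <= sup_norm f.
Proof. by case=> -[C hC] _; exact: (@le_sup _ (fun x => cmod (f x)) C). Qed.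

Let le_holder_seminorm f p : is_holder f ->
  cmod (f p.1 - f p.2) / enorm (\val p.1 - \val p.2) `^ alpha
  <= holder_seminorm f.
Proof.
move=> /quot_bound[C hC].
exact: (@le_sup _ (fun p : A * A => cmod (f p.1 - f p.2)
                               / enorm (\val p.1 - \val p.2) `^ alpha) C p).
Qed.

Lemma sup_norm_ge0 f : 0 <= sup_norm f.
Proof. by apply: sup_ge0 => x; exact: cmod_ge0. Qed.

Lemma holder_seminorm_ge0 f : 0 <= holder_seminorm f.
Proof. by apply: sup_ge0 => p; exact: quot_ge0. Qed.

Lemma holder_submod_closed : submod_closed holder_pred.
Proof.
split=> [|a f g /asboolP[[C1 f1] [K1 f2]] /asboolP[[C2 g1] [K2 g2]]].
  apply/asboolP; split; first by exists 0 => x; have -> : cmod ((0 : A -> R[i]) x) = 0 by exact: cmod0.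
  by exists 0 => x y; rewrite mul0r (_ : _ - _ = 0) ?cmod0 //; exact: subrr.
apply/asboolP; split.
  exists (cmod a * C1 + C2) => x; apply: le_trans (cmodD _ _) _.
  by rewrite lerD // cmodM ler_wpM2l.
exists (cmod a * K1 + K2) => x y.
rewrite [_ - _](_ : _ = a * (f x - f y) + (g x - g y)); last first.
  by rewrite /= mulrBr opprD addrACA.
rewrite (le_trans (cmodD _ _)) // mulrDl lerD // cmodM -mulrA ler_wpM2l //.
Qed.

HB.instance Definition _ :=
  GRing.isSubmodClosed.Build R[i] (A -> R[i]) holder_pred holder_submod_closed.

HB.instance Definition _ := [isSub for holder_fun].
HB.instance Definition _ := [Choice of holder by <:].
HB.instance Definition _ := [SubChoice_isSubLmodule of holder by <:].

Let holderP (f : holder) : is_holder f.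
Proof. by case: f => f /= /asboolP. Qed.

Lemma holder_normD (f g : holder) :
  (holder_norm (f + g))%:C <= (holder_norm f)%:C + (holder_norm g)%:C.
Proof.
rewrite -rmorphD lecR /holder_norm addrACA lerD //.
  apply: sup_le => [|x]; first by rewrite addr_ge0 // sup_norm_ge0.
  by rewrite /= (le_trans (cmodD _ _)) // lerD // le_sup_norm.
apply: sup_le => [|p]; first by rewrite addr_ge0 // holder_seminorm_ge0.
apply: le_trans (lerD (le_holder_seminorm p (holderP f))
                      (le_holder_seminorm p (holderP g))).
rewrite -mulrDl ler_wpM2r ?invr_ge0 ?powR_ge0 //= opprD addrACA.
exact: cmodD.
Qed.

Let holder_normZ_le (a : R[i]) (f : holder) :
  holder_norm (a *: f) <= cmod a * holder_norm f.
Proof.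
rewrite /holder_norm mulrDr lerD //.
  apply: sup_le => [|x]; first by rewrite mulr_ge0 // sup_norm_ge0.
  by rewrite /= cmodM ler_wpM2l // le_sup_norm.
apply: sup_le => [|p]; first by rewrite mulr_ge0 // holder_seminorm_ge0.
rewrite /= -mulrBr cmodM -mulrA ler_wpM2l //.
exact: le_holder_seminorm.
Qed.

Lemma holder_normZ (a : R[i]) (f : holder) :
  (holder_norm (a *: f))%:C = `|a| * (holder_norm f)%:C.
Proof.
rewrite -cmodE -rmorphM; congr (_%:C); apply/eqP; rewrite eq_le.
rewrite holder_normZ_le /=.
have [->|a0] := eqVneq a 0.
  by rewrite cmod0 mul0r addr_ge0 ?sup_norm_ge0 ?holder_seminorm_ge0.
rewrite -{1}(scalerK a0 f) (le_trans (ler_wpM2l _ (holder_normZ_le _ _))) //.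
by rewrite mulrA -cmodM mulfV // /cmod Normc.normc1 mul1r.
Qed.

Lemma holder_norm0_eq0 (f : holder) : (holder_norm f)%:C = 0 -> f = 0.
Proof.
move=> /(congr1 (@complex.Re R)) /= /eqP.
rewrite paddr_eq0 ?sup_norm_ge0 ?holder_seminorm_ge0 // => /andP[/eqP f0 _].
apply/val_inj/funext => x /=; apply: Normc.eq0_normc.
apply/eqP; rewrite eq_le cmod_ge0 andbT -f0.
exact: le_sup_norm.
Qed.

HB.instance Definition _ := Lmodule_isNormed.Build R[i] holder
  holder_normD holder_normZ holder_norm0_eq0.

End holder.

(* For linear L this is the standard notion; precompact means relatively
   compact (contained in a closed compact set). *)
Definition compact_operator (K : numFieldType) (U V : normedModType K)
    (L : U -> V) :=
  forall B : set U, bounded_set B -> precompact (L @` B).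

Section layer_potentials.
Context {R : realType}.

(* The T component of the kernels; the P component is m times it. The second
   branch is only meant for d = 3. *)
Definition green (d : nat) (k : R[i]) (r : R) : R[i] :=
  if d == 2%N then - (1 / (4 * 'i%C)) * hankel0 (k * r%:C)
  else - (k / (4 * pi%:C * 'i%C)) * spherical_hankel0 (k * r%:C).

Definition m_factor (Om ga : R) (k : R[i]) : R[i] :=
  (ga / (ga - 1))%:C * (1 + 'i%C * Om%:C * k ^+ 2).

Definition kernelT (d : nat) (k : R[i]) (r : R) : R[i] := green d k r.
Definition kernelP (d : nat) (Om ga : R) (k : R[i]) (r : R) : R[i] :=
  m_factor Om ga k * green d k r.

(* 'D_v is only available for real-valued maps of a real vector, hence the
   splitting into real and imaginary parts. *)
Definition dn_kernel d (G : R -> R[i]) (n : 'rV[R]_d -> 'rV[R]_d)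
    (x y : 'rV[R]_d) : R[i] :=
  'D_(n x) (fun z => complex.Re (G (enorm (z - y)))) x +i*
  'D_(n x) (fun z => complex.Im (G (enorm (z - y)))) x.

Definition dnS_integrand d (S : set 'rV[R]_d) n (G : R -> R[i])
    (rho : S -> R[i]) (x : 'rV[R]_d) (y : 'rV[R]_d) : R[i] :=
  dn_kernel G n x y * 'valL_ 0 rho y.

Definition dnS d (S : set 'rV[R]_d) n (G : R -> R[i]) (rho : S -> R[i])
    : S -> R[i] :=
  fun x => pv_integral S (dnS_integrand n G rho (\val x)) (\val x).

Definition dnS_exists d (S : set 'rV[R]_d) n (G : R -> R[i])
    (rho : S -> R[i]) :=
  forall x : S, pv_exists S (dnS_integrand n G rho (\val x)) (\val x).

End layer_potentials.

(* Main.v *)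
(* The kernel is K(x, y) = u(r) r^-d n(x).(x - y) with r = |x - y|, where the
   radial derivative of the fundamental solution is u(r) / r^(d-1) and u is
   bounded and Lipschitz near 0. On a compact C^2 hypersurface
   |n(x).(x - y)| <= C r^2 and n is Lipschitz, hence K = O(r^(2-d)), and for
   every beta < 1 one has
     |K(x, y) - K(x', y)| <= A |x - x'|^beta (w(x, y) + w(x', y)),
   with w(x, y) = |x - y|^(1 - beta - (d - 1)).
   Covering pieces of graphs by small cubes shows that the Hausdorff measure of
   a ball of radius t in the hypersurface is O(t^(d-1)), so that the integral of
   w(x, .) is bounded uniformly in x. The principal value is therefore an
   absolutely convergent integral, and the operator maps bounded densities
   boundedly into C^(0,beta). For alpha < beta < 1, bounded sets of C^(0,beta)
   are relatively compact in C^(0,alpha). *)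
Require Import Defs.
From HB Require Import structures.
From mathcomp Require Import all_boot all_order all_algebra.
From mathcomp Require Import all_classical all_reals all_analysis.
From mathcomp Require Import measurable_realfun complex.
From mathcomp Require Import ring lra.
Set Implicit Arguments.
Unset Strict Implicit.
Unset Printing Implicit Defensive.
Import Order.TTheory GRing.Theory Num.Theory.
Import numFieldNormedType.Exports.
Local Open Scope classical_set_scope.
Local Open Scope ring_scope.

(** * Euclidean geometry and Hausdorff measure *)

(** Why [beta < 1]: when [|x - x'|] is small against [r = |x - y|], the difference of the kernels
    gains a factor [|x - x'| / r], and only [|x - x'|^beta] of the gain is kept, the rest being
    traded for [r^(1 - beta)]. With [beta = 1] the weight would be [r^-(d-1)], which diverges
    logarithmically on a surface of dimension [d - 1]. The pointwise bound on [K] is better than the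
    weight by the factor [r^beta]; this factor makes the truncated integrals converge, with an error
    of order [e^beta]. Two facts about the Hausdorff measure carry the integration: open sets are
    Carathéodory measurable, and balls centred on the boundary have measure of order at most
    [t^(d-1)]. Why [u] is bounded and Lipschitz: for [d = 2] the logarithm in [Y_0] reaches
    [r f'(r)] only as [r^2 ln r]; for [d = 3] the kernel is [g / r] with [g] smooth, and
    [r^2 f'(r) = r g' - g]. Derivatives and integrals are those of real functions, so every complex
    kernel is treated through its real and imaginary parts. *)

Section euclidean_norm.
Context {R : realType} {d : nat}.
Implicit Types (x y z : 'rV[R]_d) (a : R).

Lemma dotpC x y : dotp x y = dotp y x.
Proof. by apply: eq_bigr => i _; rewrite mulrC. Qed.

Lemma dotpDl x y z : dotp (x + y) z = dotp x z + dotp y z.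
Proof. by rewrite /dotp -big_split; apply: eq_bigr => i _; rewrite mxE mulrDl. Qed.

Lemma dotpZl a x y : dotp (a *: x) y = a * dotp x y.
Proof. by rewrite /dotp mulr_sumr; apply: eq_bigr => i _; rewrite mxE mulrA. Qed.

Lemma dotpNl x y : dotp (- x) y = - dotp x y.
Proof. by rewrite -scaleN1r dotpZl mulN1r. Qed.

Lemma dotpBl x y z : dotp (x - y) z = dotp x z - dotp y z.
Proof. by rewrite dotpDl dotpNl. Qed.

Lemma dotpDr x y z : dotp x (y + z) = dotp x y + dotp x z.
Proof. by rewrite dotpC dotpDl !(dotpC x). Qed.

Lemma dotpZr a x y : dotp x (a *: y) = a * dotp x y.
Proof. by rewrite dotpC dotpZl dotpC. Qed.

Lemma dotpNr x y : dotp x (- y) = - dotp x y.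
Proof. by rewrite dotpC dotpNl dotpC. Qed.

Lemma dotpBr x y z : dotp x (y - z) = dotp x y - dotp x z.
Proof. by rewrite dotpDr dotpNr. Qed.

Lemma dotp0r x : dotp x 0 = 0.
Proof. by rewrite -(scale0r x) dotpZr mul0r. Qed.

Lemma dotp_ge0 x : 0 <= dotp x x.
Proof. by apply: sumr_ge0 => i _; rewrite -expr2 sqr_ge0. Qed.

Lemma enorm_ge0 x : 0 <= enorm x.
Proof. exact: sqrtr_ge0. Qed.

Lemma sqr_enorm x : enorm x ^+ 2 = dotp x x.
Proof. exact/sqr_sqrtr/dotp_ge0. Qed.

Lemma coord_le_enorm x i : `|x ord0 i| <= enorm x.
Proof.
rewrite -sqrtr_sqr ler_wsqrtr // /dotp (bigD1 i) //= -expr2 lerDl.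
by apply: sumr_ge0 => j _; rewrite -expr2 sqr_ge0.
Qed.

Lemma coord_le_norm x i : `|x ord0 i| <= `|x|.
Proof.
rewrite {2}/Num.norm /= mx_normrE.
exact: (le_bigmax _ (fun ij => `|x ij.1 ij.2|) (ord0, i)).
Qed.

Lemma norm_le_enorm x : `|x| <= enorm x.
Proof.
rewrite /Num.norm /= mx_normrE; apply: bigmax_le; first exact: enorm_ge0.
by move=> [i j] _; rewrite ord1; exact: coord_le_enorm.
Qed.

Lemma enorm_eq0 x : enorm x = 0 -> x = 0.
Proof.
by move=> x0; apply/normr0_eq0/eqP; rewrite eq_le normr_ge0 -{1}x0 norm_le_enorm.
Qed.

Lemma enorm0 : enorm (0 : 'rV[R]_d) = 0.
Proof. by rewrite /enorm dotp0r sqrtr0. Qed.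

Lemma enormZ a x : enorm (a *: x) = `|a| * enorm x.
Proof.
by rewrite /enorm dotpZl dotpZr mulrA -expr2 sqrtrM ?sqr_ge0 // sqrtr_sqr.
Qed.

Lemma enormN x : enorm (- x) = enorm x.
Proof. by rewrite /enorm dotpNl dotpNr opprK. Qed.

Lemma enorm_distC x y : enorm (x - y) = enorm (y - x).
Proof. by rewrite -enormN opprB. Qed.

Lemma dotp_le_enorm x y : `|dotp x y| <= enorm x * enorm y.
Proof.
wlog xy0 : x / 0 <= dotp x y => [H|].
  have [/H //|xy0] := leP 0 (dotp x y).
  by rewrite -normrN -dotpNl -(enormN x); apply: H; rewrite dotpNl oppr_ge0 ltW.
rewrite ger0_norm //.
have [x0|x0] := eqVneq (enorm x) 0; first by rewrite x0 (enorm_eq0 x0) dotpC dotp0r mul0r.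
have [y0|y0] := eqVneq (enorm y) 0; first by rewrite y0 (enorm_eq0 y0) dotp0r mulr0.
(* With [a], [b] the two norms and [c] the product, this square expands to [2 a b (a b - c)]. *)
have := dotp_ge0 (enorm y *: x - enorm x *: y).
rewrite !(dotpBl, dotpBr, dotpZl, dotpZr) -!sqr_enorm (dotpC y x).
have xp : 0 < enorm x by rewrite lt0r x0 enorm_ge0.
have yp : 0 < enorm y by rewrite lt0r y0 enorm_ge0.
set a := enorm x in xp *; set b := enorm y in yp *; set c := dotp x y.
move=> h; rewrite -subr_ge0 -(pmulr_rge0 _ (mulr_gt0 xp yp)).
by nra.
Qed.

Lemma enormD x y : enorm (x + y) <= enorm x + enorm y.
Proof.
rewrite -(ler_pXn2r (n := 2)) ?nnegrE ?addr_ge0 ?enorm_ge0 //.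
rewrite sqr_enorm sqrrD !sqr_enorm !(dotpDl, dotpDr) (dotpC y x).
have := le_trans (ler_norm _) (dotp_le_enorm x y); set p := dotp x y; set q := _ * _.
by rewrite mulr2n; lra.
Qed.

Lemma enorm_triangle z x y : enorm (x - y) <= enorm (x - z) + enorm (z - y).
Proof. by rewrite -{1}(subrK z x) -addrA enormD. Qed.

Lemma ler_dist_enorm x y : `|enorm x - enorm y| <= enorm (x - y).
Proof.
rewrite ler_norml; apply/andP; split.
  by rewrite lerNl opprB lerBlDr enorm_distC -{1}(subrK x y) enormD.
by rewrite lerBlDr -{1}(subrK y x) enormD.
Qed.

Lemma enorm_le_norm x : enorm x <= d%:R * `|x|.
Proof.
rewrite -(ler_pXn2r (n := 2)) ?nnegrE ?mulr_ge0 ?enorm_ge0 // sqr_enorm.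
apply: (@le_trans _ _ (\sum_(i < d) `|x| ^+ 2)).
  apply: ler_sum => i _; rewrite -expr2 -real_normK ?num_real //.
  by rewrite ler_pXn2r ?nnegrE // coord_le_norm.
rewrite sumr_const card_ord -[leLHS]mulr_natl exprMn ler_wpM2r ?sqr_ge0 //.
by rewrite expr2 -natrM ler_nat; case: (d) => // k; rewrite leq_pmulr.
Qed.

Lemma eball_nbhs x (r : R) : 0 < r -> nbhs x (eball x r).
Proof.
(* [d.+1] instead of [d] keeps the radius positive when [d] is 0. *)
move=> r0; apply/nbhs_ballP; exists (r / d.+1%:R); first by rewrite /= divr_gt0.
move=> y; rewrite mx_norm_ball /ball_ /= distrC => xy.
apply: le_lt_trans (enorm_le_norm _) _.
rewrite mulrC (@le_lt_trans _ _ (`|y - x| * d.+1%:R)) ?ler_wpM2l ?ler_nat //.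
by rewrite -ltr_pdivlMr.
Qed.

Lemma nbhs_eball x (A : set 'rV[R]_d) :
  nbhs x A -> exists2 r : R, 0 < r & eball x r `<=` A.
Proof.
move=> /nbhs_ballP[r r0 rA]; exists r => // y; rewrite /eball /= => yx.
apply: rA; rewrite mx_norm_ball /ball_ /= distrC.
exact: le_lt_trans (norm_le_enorm _) yx.
Qed.

Lemma enorm_continuous : continuous (@enorm R d).
Proof.
move=> x; apply/(cvgrPdist_lt (FF := nbhs_filter x)) => e e0.
apply: filterS (eball_nbhs x e0) => y; rewrite distrC.
exact: le_lt_trans (ler_dist_enorm _ _).
Qed.

End euclidean_norm.

(** * Measurability from additivity on separated sets *)

Section caratheodory_criterion.
Context {R : realType} {T : Type} (mu : {outer_measure set T -> \bar R}).
Local Open Scope ereal_scope.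

(* The shells Q k on which g lies in ]1/(k+3), 1/(k+2)] are separated from each
   other when their indices have the same parity, so the sum of their measures
   is at most 2 mu X and its tails vanish. *)
Lemma caratheodory_separated (g : T -> R) :
    (forall (a b : R) A B, (a < b)%R -> (forall x, A x -> g x <= a)%R ->
      (forall x, B x -> b < g x)%R -> mu A + mu B <= mu (A `|` B)) ->
  mu.-caratheodory [set x | 0 < g x]%R.
Proof.
move=> sep; apply: le_caratheodory_measurable => X.
have [->|Xfin] := eqVneq (mu X) +oo; first by rewrite leey.
pose c (k : nat) : R := k.+1%:R^-1%R.
have c0 k : (0 < c k)%R by rewrite /c invr_gt0.
have clt k : (c k.+1 < c k)%R by rewrite /c ltf_pV2 ?posrE // ltr_nat.
pose Q k : set T := X `&` [set x | c k.+2 < g x <= c k.+1]%R.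
(* Used with [i] equal to 0 and 1. On the new shell [g] is at most [c (N.*2 + i).+1], while the part
   already counted lies above [c (N.*2 + i)]; this gap lets [sep] add the two measures. *)
have half i N : \sum_(k < N) mu (Q (k.*2 + i)%N) <= mu X.
  apply: (@le_trans _ _ (mu (X `&` [set x | c (N.*2 + i)%N < g x]%R)));
    last by apply: le_outer_measure => x [].
  elim: N => [|N IH]; first by rewrite big_ord0 outer_measure_ge0.
  rewrite big_ord_recr /= addeC.
  apply: le_trans (leeD2l _ IH) _; apply: le_trans (sep _ _ _ _ (clt _) _ _) _.
  - by move=> x [_ /= /andP[_]]; exact.
  - by move=> x [].
  apply: le_outer_measure => x [[Xx /= /andP[gx _]]|[Xx /= gx]]; split => //=.
  by apply: lt_trans gx; rewrite doubleS addSn addSn (lt_trans (clt _)).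
have tot : \sum_(0 <= k <oo) mu (Q k) < +oo.
  apply: (@le_lt_trans _ _ (mu X + mu X)); last first.
    by rewrite lte_add_pinfty // ltey.
  apply: lime_le; first by apply: is_cvg_nneseries => k _ _; exact: outer_measure_ge0.
  apply: nearW => N; rewrite big_mkord.
  apply: (@le_trans _ _ (\sum_(k < N) (mu (Q (k.*2 + 0)%N) + mu (Q (k.*2 + 1)%N)))).
    apply: (@le_trans _ _ (\sum_(k < N.*2) mu (Q k))).
      rewrite -!(big_mkord xpredT (fun k => mu (Q k))).
      apply: lee_sum_nneg_natr => // [k _ _|]; first exact: outer_measure_ge0.
      by rewrite -addnn leq_addr.
    elim: N => [|N IH]; first by rewrite !big_ord0.
    rewrite doubleS !big_ord_recr /= addn0 addn1 -addeA leeD2r //.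
  by rewrite big_split /=; apply: leeD; exact: half.
have tail : \sum_(n <= k <oo) mu (Q k) @[n --> \oo] --> 0.
  by apply: nneseries_tail_cvg => // k _; exact: outer_measure_ge0.
(* The inequality is proved for each [n] with the tail of the shells added to [mu X], and the tail
   tends to 0. *)
have cv : mu X + \sum_(n <= k <oo) mu (Q k) @[n --> \oo] --> mu X + 0.
  by apply: cvgeD => //; [rewrite fin_num_adde_defl|exact: (cvg_cst (mu X))].
rewrite -[leRHS]adde0 -(cvg_lim _ cv) //; apply: lime_ge; first exact: cvgP cv.
apply: nearW => n; pose A := X `&` [set x | c n.+1 < g x]%R.
have UA : X `&` [set x | 0 < g x]%R `<=` A `|` \bigcup_(k in ~` `I_n) Q k.
  move=> x [Xx /= gx]; have [Agx|gxn] := ltP (c n.+1) (g x); first by left.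
  right.
  have exk : exists k, (n <= k)%N && (c k.+2 < g x)%R.
    have [m gm] : exists m, (c m < g x)%R.
      exists (Num.truncn (g x)^-1); rewrite /c invf_plt ?posrE // truncnS_gt //.
    exists (maxn m n); rewrite leq_maxr (le_lt_trans _ gm) // /c lef_pV2 ?posrE //.
    by rewrite ler_nat ltnS (leq_trans (leq_maxl m n)) // leqW.
  case: (ex_minnP exk) => k /andP[nk gk] mink; exists k; first by rewrite /= ltnNge nk.
  split=> //=; rewrite gk /=; move: nk; rewrite leq_eqVlt => /orP[/eqP <- //|].
  case: k gk mink => // k gk mink nk.
  by rewrite leNgt; apply/negP => h; have := mink k; rewrite -ltnS nk h ltnn; move=> /(_ isT).
have := sep 0%R (c n.+1) (X `&` ~` [set x | 0 < g x]%R) A (c0 _) _ _.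
move=> /(_ _ _)/le_trans H.
apply: (@le_trans _ _ (mu A + mu (X `&` ~` [set x | 0 < g x]%R) + \sum_(n <= k <oo) mu (Q k))).
  rewrite addeAC leeD2r // (le_trans (le_outer_measure mu _ _ UA)) //.
  rewrite (le_trans (outer_measureU2 _ _ _)) // leeD2l //.
  exact: outer_measure_sigma_subadditive_tail.
rewrite leeD2r // addeC; apply: H.
- by move=> x [_ /= /negP]; rewrite -leNgt.
- by move=> x [].
- by apply: le_outer_measure => x [] [].
Qed.
End caratheodory_criterion.

(** * The Hausdorff measure is a metric outer measure *)

Section hausdorff_metric.
Context {R : realType} {d : nat}.
Implicit Types (A B : set 'rV[R]_d) (s : nat).
Local Open Scope ereal_scope.

Lemma hausdorff_pre_cover s (delta : R) A (F : nat -> set 'rV[R]_d) :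
  A `<=` \bigcup_k F k ->
  hausdorff_pre s delta A <= \sum_(k <oo) hausdorff_size s delta (F k).
Proof. by move=> AF; apply: ereal_inf_lbound; exists F. Qed.

Lemma le_hausdorff_pre s (delta : R) A x :
  (forall F, A `<=` \bigcup_k F k ->
     x <= \sum_(k <oo) hausdorff_size s delta (F k)) ->
  x <= hausdorff_pre s delta A.
Proof. by move=> H; apply: le_ereal_inf_tmp => _ [F [_ AF] <-]; exact: H. Qed.

Lemma hausdorff_pre_anti s (delta delta' : R) A : (delta <= delta')%R ->
  hausdorff_pre s delta' A <= hausdorff_pre s delta A.
Proof.
move=> dd; apply: le_hausdorff_pre => F AF.
apply: le_trans (hausdorff_pre_cover _ _ AF) _; apply: lee_nneseries.
  by move=> k _ _; exact: hausdorff_size_ge0.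
move=> k _; rewrite /hausdorff_size; case: ifPn => // _.
case: (leP _ delta%:E) => h; last by rewrite leey.
by rewrite (le_trans h) // lee_fin.
Qed.

(** A covering set of finite size has diameter at most [delta], so it meets at most one of [A] and
    [B]: every cover of the union splits into a cover [G A] of [A] and a cover [G B] of [B]. *)
Lemma hausdorff_pre_separated s (delta : R) A B :
  (forall a b, A a -> B b -> delta < enorm (a - b))%R ->
  hausdorff_pre s delta A + hausdorff_pre s delta B
  <= hausdorff_pre s delta (A `|` B).
Proof.
move=> sep; apply: le_hausdorff_pre => // F ABF.
pose G (C : set 'rV[R]_d) k := if F k `&` C == set0 then set0 else F k.
have GC C : C `<=` A `|` B -> C `<=` \bigcup_k G C k.
  move=> CAB x Cx; have [k _ Fkx] := ABF x (CAB _ Cx); exists k => //.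
  by rewrite /G; case: eqVneq => // /seteqP[/(_ x)]; case.
apply: (@le_trans _ _ (\sum_(k <oo) hausdorff_size s delta (G A k) +
                       \sum_(k <oo) hausdorff_size s delta (G B k))).
  apply: leeD; apply: hausdorff_pre_cover; apply: GC.
    exact: subsetUl.
  exact: subsetUr.
rewrite -nneseriesD; last 2 first.
  - by move=> *; exact: hausdorff_size_ge0.
  - by move=> *; exact: hausdorff_size_ge0.
apply: lee_nneseries => [k _ _|k _]; first by rewrite adde_ge0 // hausdorff_size_ge0.
rewrite /G; case: eqVneq => [_|/set0P[a [Fa Aa]]].
  by rewrite hausdorff_size0 add0e; case: eqVneq => // _; rewrite hausdorff_size0 hausdorff_size_ge0.
case: eqVneq => [_|/set0P[b [Fb Bb]]]; first by rewrite hausdorff_size0 adde0.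
rewrite [leRHS]/hausdorff_size; case: eqVneq => [F0|_]; first by rewrite F0 in Fa.
case: ifPn => [h|_]; last by rewrite leey.
have := sep a b Aa Bb; rewrite ltNge -lee_fin (le_trans _ h) //.
by apply: ereal_sup_ubound; exists a => //; exists b.
Qed.

(** The two suprema on the left are taken one after the other, so [key] has a mesh size for each set
    and passes to the minimum of both and [eta]. Finiteness of the right side makes the subtractions
    in between legitimate. *)
Lemma hausdorff_separated s (eta : R) A B : (0 < eta)%R ->
  (forall a b, A a -> B b -> eta < enorm (a - b))%R ->
  hausdorff s A + hausdorff s B <= hausdorff s (A `|` B).
Proof.
move=> eta0 sep.
have key (e e' : R) : (0 < e)%R -> (0 < e')%R ->
    hausdorff_pre s e A + hausdorff_pre s e' B <= hausdorff s (A `|` B).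
  move=> e0 e'0; pose m : R := Num.min eta (Num.min e e').
  have m0 : (0 < m)%R by rewrite /m !lt_min eta0 e0.
  apply: le_trans (hausdorff_pre_le s (A `|` B) m0).
  apply: le_trans (leeD (hausdorff_pre_anti s (delta := m) A _)
                        (hausdorff_pre_anti s (delta := m) B _)) _.
  - by rewrite /m !ge_min lexx orbT.
  - by rewrite /m !ge_min lexx !orbT.
  apply: hausdorff_pre_separated => a b Aa Bb.
  by rewrite (le_lt_trans _ (sep a b Aa Bb)) // /m ge_min lexx.
have [->|Hfin] := eqVneq (hausdorff s (A `|` B)) +oo; first by rewrite leey.
have fin C : C `<=` A `|` B -> hausdorff s C \is a fin_num.
  move=> CAB; rewrite ge0_fin_numE ?hausdorff_ge0 //.
  by apply: le_lt_trans (le_hausdorff s CAB) _; rewrite ltey.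
rewrite -leeBrDr ?fin //; apply: ge_ereal_sup => _ [e e0 <-].
rewrite leeBrDr ?fin // addeC.
have efin : hausdorff_pre s e A \is a fin_num.
  rewrite ge0_fin_numE; last by apply: mu_ext_ge0; exact: hausdorff_size_ge0.
  apply: le_lt_trans (hausdorff_pre_le s A e0) _.
  by rewrite -ge0_fin_numE ?fin ?hausdorff_ge0.
rewrite -leeBrDr //; apply: ge_ereal_sup => _ [e' e'0 <-].
by rewrite leeBrDr // addeC; exact: key.
Qed.

Lemma caratheodory_lipschitz_gt0 (g : 'rV[R]_d -> R) :
  (forall x y, `|g x - g y| <= enorm (x - y))%R ->
  (surface_outer_measure R d).-caratheodory [set x | 0 < g x]%R.
Proof.
move=> gL; apply: caratheodory_separated => a b A B ab Aa Bb.
apply: (@hausdorff_separated _ ((b - a) / 2)); first by rewrite divr_gt0 // subr_gt0.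
move=> x y /Aa gx /Bb gy; rewrite (lt_le_trans _ (gL x y)) // distrC.
by rewrite (lt_le_trans _ (ler_norm _)) //; lra.
Qed.

(** The distance to the complement is 1-Lipschitz and [U] is the set where it is positive. The full
    space is treated apart, since there the infimum would run over an empty set. *)
Lemma open_surface_measurable (U : set 'rV[R]_d) : open U ->
  measurable (U : set (surface_space R d)).
Proof.
move=> oU; have [CU0|/set0P[z0 Uz0]] := eqVneq (~` U) set0.
  by rewrite -(setCK U) CU0 setC0; exact: measurableT.
pose E x := [set enorm (x - y) | y in ~` U].
have E0 x : E x !=set0 by exists (enorm (x - z0)); exists z0.
have Elb x : has_lbound (E x) by exists 0%R => _ [y _ <-]; exact: enorm_ge0.
have glb x y : ~ U y -> (inf (E x) <= enorm (x - y))%R.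
  by move=> Uy; apply: ge_inf => //; exists y.
have gle x y : (inf (E x) <= inf (E y) + enorm (x - y))%R.
  rewrite -lerBlDr; apply: lb_le_inf => // _ [z Uz <-].
  by rewrite lerBlDr (le_trans (glb x z Uz)) // [leRHS]addrC enorm_triangle.
rewrite (_ : U = [set x | 0 < inf (E x)]%R).
  apply: caratheodory_lipschitz_gt0 => x y; rewrite ler_norml.
  by rewrite lerBlDl gle andbT lerNl opprB lerBlDl enorm_distC gle.
apply/seteqP; split => x /=.
  move=> Ux; have [r r0 rU] := nbhs_eball (open_nbhs_nbhs (conj oU Ux)).
  apply: lt_le_trans r0 _; apply: lb_le_inf => // _ [z Uz <-].
  by rewrite leNgt; apply/negP => h; apply: Uz; apply: rU; rewrite /eball /= enorm_distC.
move=> g0; apply: contrapT => Ux; have := glb x x Ux.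
by rewrite subrr enorm0 leNgt g0.
Qed.

Lemma continuous_surface_measurable (D : set 'rV[R]_d) (f : 'rV[R]_d -> R) :
  measurable (D : set (surface_space R d)) -> {within D, continuous f} ->
  measurable_fun (D : set (surface_space R d)) f.
Proof.
move=> mD cf; apply: (measurability _ (@RGenOInfty.measurableE R)).
move=> _ [_ [a ->] <-].
have : @open (subspace D) (f @^-1` `]a, +oo[%classic).
  by apply: (proj1 (continuousP _) cf); exact: interval_open.
move=> /open_subspaceP[V oV VD]; rewrite setIC -VD.
by apply: measurableI => //; exact: open_surface_measurable.
Qed.

End hausdorff_metric.

(** * C^2 hypersurfaces *)

Section mean_value.
Context {R : realType}.

Lemma is_derive_continuous (f : R -> R) (x df : R) : is_derive x 1 f df -> {for x, continuous f}.
Proof. by move=> fx; apply/differentiable_continuous/derivable1_diffP; exact: ex_derive. Qed.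

(** The two inequalities in the first hypothesis say that [x] lies between [a] and [b], whatever
    their order. [P] allows [f] to be differentiable only on a part of the line, such as the
    positive reals. *)
Lemma mvt_abs (f df : R -> R) (P : R -> Prop) (a b : R) :
  (forall x, `|x - a| <= `|b - a| -> `|x - b| <= `|b - a| -> P x) ->
  (forall x, P x -> is_derive x 1 f (df x)) ->
  exists c, [/\ P c, `|c - a| <= `|b - a| & f b - f a = df c * (b - a)].
Proof.
move=> abP fdf.
have key u v : u <= v -> (forall x, u <= x <= v -> P x) ->
    exists2 c, u <= c <= v & f v - f u = df c * (v - u).
  move=> uv uvP; have [||c] := @MVT_segment R f df u v uv.
  - by move=> x; rewrite in_itv /= => /andP[/ltW ux /ltW xv]; apply/fdf/uvP/andP.
  - apply: derivable_within_continuous => x; rewrite in_itv /= => uxv.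
    by case: (fdf _ (uvP _ uxv)).
  by rewrite in_itv /= => ? ?; exists c.
have [ab|/ltW ba] := leP a b.
  have abx x : a <= x <= b -> P x.
    move=> /andP[ax xb]; apply: abP; rewrite [leRHS]ger0_norm ?subr_ge0 // ler_norml; lra.
  have [c /[dup] /abx Pc /andP[ac cb] fe] := key _ _ ab abx; exists c; split=> //.
  by rewrite !ger0_norm ?subr_ge0 // lerB.
have abx x : b <= x <= a -> P x.
  move=> /andP[ax xb]; apply: abP; rewrite [leRHS]ler0_norm ?subr_le0 // ler_norml; lra.
have [c /[dup] /abx Pc /andP[ac cb] fe] := key _ _ ba abx; exists c; split=> //.
  by rewrite !ler0_norm ?subr_le0 //; lra.
by rewrite -(opprB a b) mulrN -fe opprB.
Qed.

Lemma is_derive_line (V : normedModType R) (f : V -> R) (z v : V) (t : R) :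
  derivable f (z + t *: v) v ->
  is_derive t 1 (fun t => f (z + t *: v)) ('D_v f (z + t *: v)).
Proof.
have e : (fun h => h^-1 *: (((fun t => f (z + t *: v)) \o shift t) (h *: 1)
             - f (z + t *: v))) =
         (fun h => h^-1 *: ((f \o shift (z + t *: v)) (h *: v) - f (z + t *: v))).
  apply/funext => h /=; congr (_ *: (f _ - _)).
  by rewrite /shift /= [h *: 1]mulr1 scalerDl addrCA.
by move=> df; split; rewrite /derivable /derive e.
Qed.

(* The path from x to y changes one coordinate at a time. *)
Lemma C1_mvt m (f : 'rV[R]_m -> R) : C1_fun f -> forall x y,
  exists xi : 'I_m -> 'rV[R]_m, (forall i, `|xi i - x| <= `|y - x|) /\
    f y - f x = \sum_(i < m) partial f i (xi i) * (y ord0 i - x ord0 i).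
Proof.
move=> C1f x y.
pose z (k : nat) : 'rV[R]_m := \row_i (if (i < k)%N then y ord0 i else x ord0 i).
have step (k : 'I_m) : exists xi : 'rV[R]_m, `|xi - x| <= `|y - x| /\
    f (z k.+1) - f (z k) = partial f k xi * (y ord0 k - x ord0 k).
  pose a := y ord0 k - x ord0 k; pose e : 'rV[R]_m := delta_mx ord0 k.
  have zS : z k.+1 = z k + a *: e.
    apply/rowP => i; rewrite !mxE eqxx /= ltnS leq_eqVlt.
    have [/val_inj ->|ik] := eqVneq (val i) (val k).
      by rewrite eqxx ltnn mulr1 addrCA subrr addr0.
    by rewrite (_ : (i == k) = false) ?mulr0 ?addr0 //; apply/negbTE.
  have [t [_ ta fe]] := @mvt_abs (fun t => f (z k + t *: e))
    (fun t => partial f k (z k + t *: e)) setT 0 a (fun _ _ _ => I)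
    (fun t _ => is_derive_line (proj1 (C1f k) _)).
  rewrite /= scale0r addr0 subr0 in fe; exists (z k + t *: e).
  split; last by rewrite zS fe.
  rewrite {1}/Num.norm /= mx_normrE; apply: bigmax_le => // -[i0 i] _ /=.
  rewrite (ord1 i0) !mxE eqxx /=; have [->|ik] := eqVneq i k.
    rewrite ltnn mulr1 addrAC subrr add0r -[t]subr0 (le_trans ta) // subr0.
    by have := coord_le_norm (y - x) k; rewrite !mxE.
  rewrite mulr0 addr0; case: ifP => _; last by rewrite subrr normr0.
  by have := coord_le_norm (y - x) i; rewrite !mxE.
have [xi xiP] := choice step.
exists xi; split=> [i|]; first by have [] := xiP i.
rewrite -(eq_bigr _ (fun i _ => proj2 (xiP i))).
rewrite -(big_mkord xpredT (fun k => f (z k.+1) - f (z k))) telescope_sumr //.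
congr (f _ - f _); apply/rowP => i; rewrite mxE ?ltn_ord //.
Qed.

(** [L] is both the Lipschitz constant and the inverse of the radius. Enlarging it weakens the claim
    in both respects, so that finitely many such claims hold with a common [L]. *)
Lemma C1_lipschitz_near m (f : 'rV[R]_m -> R) (x0 : 'rV[R]_m) : C1_fun f ->
  \forall L \near +oo, forall a b : 'rV[R]_m,
    `|a - x0| < L^-1 -> `|b - x0| < L^-1 -> `|f a - f b| <= L * `|a - b|.
Proof.
move=> C1f.
have [r r0 hr] : exists2 r : R, 0 < r & forall x, `|x - x0| < r -> forall i,
    `|partial f i x| <= `|partial f i x0| + 1.
  have : \forall x \near x0, forall i, `|partial f i x| <= `|partial f i x0| + 1.
    apply: (filter_forall (F := nbhs x0)) => i.
    have := (C1f i).2 x0 => /(@cvgr_dist_lt _ _ _ _ (nbhs_filter x0))/(_ 1 ltr01).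
    apply: filterS => x h; rewrite -lerBlDl (le_trans (lerB_dist _ _)) //.
    by rewrite distrC ltW.
  move=> /nbhs_ballP[r r0 hr]; exists r => // x xr; apply: hr.
  by rewrite mx_norm_ball /ball_ /= distrC.
near=> L => a b ax bx.
have [xi [xia ->]] := C1_mvt C1f b a.
have L0 : 0 < L by near: L; exact: nbhs_pinfty_gt.
(* [xi i] is within [2 / L] of [b], hence within [3 / L] of [x0]. *)
have L1 : L^-1 <= r / 3.
  rewrite -[leRHS]invrK lef_pV2 ?posrE ?invr_gt0 ?divr_gt0 //.
apply: le_trans (ler_norm_sum _ _ _) _.
apply: (@le_trans _ _ (\sum_(i < m) (`|partial f i x0| + 1) * `|a - b|)).
  apply: ler_sum => i _; rewrite normrM ler_pM //; last first.
    by have := coord_le_norm (a - b) i; rewrite !mxE.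
  apply: hr; rewrite -(subrK b (xi i)) -addrA (le_lt_trans (ler_normD _ _)) //.
  have := xia i; rewrite -{1}(subrK x0 a) -addrA -{1}(opprB b x0).
  have := ler_normB (a - x0) (b - x0).
  move=> h1 h2; have := le_trans h2 h1; lra.
rewrite -mulr_suml ler_wpM2r //.
Unshelve. all: by end_near. Qed.

End mean_value.

(** * The boundary is locally a graph *)

Section boundary_graph.
Context {R : realType} {d : nat}.
Implicit Types (D S : set 'rV[R]_d) (x y : 'rV[R]_d).

Lemma boundary_compact D : bounded_set D -> compact (boundary D).
Proof.
move=> [M [Mr MD]]; apply: bounded_closed_compact; last first.
  apply: closedI; first exact: closed_closure.
  by apply: open_closedC; exact: open_interior.
exists (M + 1); split=> [|N MN x [Dx _] /=]; first exact: num_real.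
have [z [Dz xz]] := Dx _ (eball_nbhs x ltr01).
rewrite -(subrK z x) (le_trans (ler_normD _ _)) //.
rewrite -(subrK 1 N) addrC lerD //; first by apply: MD => //; rewrite ltrBrDr.
by rewrite distrC (le_trans (norm_le_enorm _)) // ltW.
Qed.

Lemma dotp_delta x j : dotp x (delta_mx ord0 j) = x ord0 j.
Proof.
rewrite /dotp (bigD1 j) //= big1 ?mxE ?eqxx ?mulr1 ?addr0 // => i ij.
by rewrite mxE eqxx /= (negPf ij) mulr0.
Qed.

Lemma enorm_delta j : enorm (delta_mx ord0 j : 'rV[R]_d) = 1.
Proof. by rewrite /enorm dotp_delta mxE !eqxx sqrtr1. Qed.

Lemma dotp_lift (j : 'I_d) x y : dotp x y =
  x ord0 j * y ord0 j + \sum_(k < d.-1) x ord0 (lift j k) * y ord0 (lift j k).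
Proof. by rewrite /dotp (bigD1_ord j). Qed.

Lemma norm_col' (j : 'I_d) x : `|col' j x| <= `|x|.
Proof.
rewrite {1}/Num.norm /= mx_normrE; apply: bigmax_le => // -[i0 i] _ /=.
by rewrite (ord1 i0) mxE coord_le_norm.
Qed.

(** Inside the ball [D] is the set [F > 0] of a continuous function. Where [F < 0] there are no
    points of [D] nearby, where [F > 0] the point is interior, and a zero of [F] becomes positive
    after an arbitrarily small move in the [j]-th direction. *)
Lemma boundary_graph D (x0 : 'rV[R]_d) r (j : 'I_d) (s : bool) (phi : 'rV[R]_d.-1 -> R) :
  open D -> continuous phi ->
  D `&` eball x0 r =
    [set x | eball x0 r x /\ phi (col' j x) < (-1) ^+ s * x ord0 j] ->
  forall x, eball x0 r x -> boundary D x <-> phi (col' j x) = (-1) ^+ s * x ord0 j.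
Proof.
move=> oD cphi DE x Bx.
pose F (z : 'rV[R]_d) : R := (-1) ^+ s * z ord0 j - phi (col' j z).
have DF z : eball x0 r z -> D z <-> 0 < F z.
  move=> Bz; rewrite /F subr_gt0; split=> [Dz|Fz].
    by have : (D `&` eball x0 r) z by []; rewrite DE => -[].
  by have : (D `&` eball x0 r) z; [rewrite DE|case].
have nB : \forall z \near x, eball x0 r z.
  have r0 : 0 < r - enorm (x - x0) by rewrite subr_gt0.
  apply: filterS (eball_nbhs x r0) => z; rewrite /eball /= => zx.
  by rewrite (le_lt_trans (enorm_triangle x _ _)) // -ltrBrDr.
have ccol : continuous (fun z : 'rV[R]_d => col' j z).
  move=> z; apply/(cvgrPdist_lt (FF := nbhs_filter z)) => e e0.
  apply/nbhs_ballP; exists e => // w; rewrite mx_norm_ball /ball_ /=.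
  apply: le_lt_trans; rewrite (_ : _ - _ = col' j (z - w)) ?norm_col' //.
  by apply/rowP => k; rewrite !mxE.
have cF : continuous F.
  move=> z; apply: (cvgB (FF := nbhs_filter z)); last first.
    exact: (continuous_comp (ccol z) (cphi _)).
  by apply: (cvgMl_tmp (FF := nbhs_filter z)); exact: coord_continuous.
have -> : phi (col' j x) = (-1) ^+ s * x ord0 j <-> F x = 0.
  by split=> [h|/eqP]; rewrite /F; [rewrite h subrr|rewrite subr_eq0 => /eqP].
rewrite /boundary; split=> [[clx nix]|F0].
  apply/eqP; rewrite eq_le; apply/andP; split; rewrite leNgt; apply/negP => h.
    by apply: nix; apply: open_nbhs_nbhs; split=> //; apply/(DF _ Bx).
  have nF : \forall z \near x, F z < 0 /\ eball x0 r z.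
    by apply: filterI => //; exact: (cvgr_lt _ (cF x)).
  have [z [Dz [Fz Bz]]] := clx _ nF.
  by have := (DF z Bz).1 Dz; rewrite ltNge ltW.
split; last first.
  by move=> /interior_subset /(DF _ Bx); rewrite F0 ltxx.
move=> A /(filterI nB) /nbhs_eball[e e0 eA].
(* This move leaves [col' j] unchanged and raises [F] from 0 to [e / 2]. *)
pose z := x + (e / 2 * (-1) ^+ s) *: delta_mx ord0 j.
have zx : enorm (z - x) < e.
  rewrite /z addrC addKr enormZ enorm_delta mulr1 normrM normrX normrN1 expr1n.
  by rewrite mulr1 ger0_norm ?divr_ge0 ?ltW //; lra.
have [Bz Az] := eA z zx; exists z; split=> //; apply/(DF _ Bz).
have zl : col' j z = col' j x.
  by apply/rowP => k; rewrite !mxE eqxx /= eq_sym (negPf (neq_lift _ _)) mulr0 addr0.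
rewrite /F zl !mxE !eqxx mulr1 mulrDr addrAC -/(F x) F0 add0r mulrCA -expr2 sqrr_sign.
by rewrite mulr1 divr_gt0.
Qed.
End boundary_graph.

(** * The unit normal along a graph *)

Section boundary_normal.
Context {R : realType} {d : nat}.
Implicit Types (S : set 'rV[R]_d) (x y : 'rV[R]_d).

Lemma is_derive_scalev (f : R -> R) (v : 'rV[R]_d) (t df : R) :
  is_derive t 1 f df -> is_derive t 1 (fun u => f u *: v) (df *: v).
Proof.
move=> [fd fe].
have e : (fun h => h^-1 *: (((fun u => f u *: v) \o shift t) (h *: 1) - f t *: v)) =
         (fun h => (h^-1 *: ((f \o shift t) (h *: 1) - f t)) *: v).
  by apply/funext => h /=; rewrite -scalerBl scalerA.
have cv : (fun h => (h^-1 *: ((f \o shift t) (h *: 1) - f t)) *: v) @ 0^' --> df *: v.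
  by apply: cvgZr_tmp; rewrite -fe; exact: fd.
by split; [rewrite /derivable e; exact: cvgP cv|rewrite /derive e; exact: cvg_lim cv].
Qed.

(** The curve [c] runs along the [k]-th coordinate of the hyperplane, and its [j]-th coordinate is
    adjusted to stay on the graph; the sign [(-1) ^+ s] is its own inverse. *)
Lemma tangent_vector_graph S (x0 : 'rV[R]_d) r (j : 'I_d) (s : bool)
    (phi : 'rV[R]_d.-1 -> R) x k :
  C1_fun phi ->
  (forall y, eball x0 r y -> S y <-> phi (col' j y) = (-1) ^+ s * y ord0 j) ->
  eball x0 r x -> S x ->
  tangent_vector S x (delta_mx ord0 (lift j k) +
    ((-1) ^+ s * partial phi k (col' j x)) *: delta_mx ord0 j).
Proof.
move=> C1 SE Bx Sx.
pose g (t : R) := phi (col' j x + t *: delta_mx ord0 k).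
pose c (t : R) := x + (t *: delta_mx ord0 (lift j k) +
   ((-1) ^+ s * g t - x ord0 j) *: delta_mx ord0 j : 'rV[R]_d).
have g0 : (-1) ^+ s * g 0 = x ord0 j.
  rewrite /g scale0r addr0 (SE x Bx).1 // mulrA -expr2 sqrr_sign mul1r //.
have dg : is_derive (0 : R) 1 g (partial phi k (col' j x)).
  have := is_derive_line (proj1 (C1 k) (col' j x + 0 *: delta_mx ord0 k)).
  by rewrite /partial scale0r addr0.
have c0 : c 0 = x by rewrite /c scale0r add0r g0 subrr scale0r addr0.
have dc : is_derive (0 : R) 1 c (delta_mx ord0 (lift j k) +
    ((-1) ^+ s * partial phi k (col' j x)) *: delta_mx ord0 j).
  have d1 := is_derive_scalev (delta_mx ord0 (lift j k)) (@is_derive_id R R 0 1).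
  have d2 := is_derive_scalev (delta_mx ord0 j)
     (is_deriveB (is_deriveZ ((-1) ^+ s) dg) (is_derive_cst (x ord0 j) (0 : R) (1 : R))).
  have := is_deriveD (is_derive_cst x (0 : R) (1 : R)) (is_deriveD d1 d2).
  by rewrite add0r scale1r subr0.
exists c; split=> //.
have cc : {for 0, continuous c}.
  apply/differentiable_continuous/derivable1_diffP; by case: dc.
have Bc : \forall t \near (0 : R), eball x0 r (c t).
  have r0 : 0 < r - enorm (x - x0) by rewrite subr_gt0.
  have := eball_nbhs (c 0) r0; rewrite c0 -{1}c0 => /cc; apply: filterS => t.
  rewrite /eball /= => zx.
  by rewrite (le_lt_trans (enorm_triangle x _ _)) // -ltrBrDr.
apply: filterS Bc => t Bt; apply/(SE _ Bt).
have -> : col' j (c t) = col' j x + t *: delta_mx ord0 k.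
  apply/rowP => i; rewrite !mxE eqxx /= (inj_eq lift_inj) [lift j i == j]eq_sym.
  by rewrite (negPf (neq_lift _ _)) mulr0 addr0.
rewrite -/(g t) !mxE !eqxx /= (negPf (neq_lift _ _)) mulr0 add0r mulr1 addrC subrK.
by rewrite mulrA -expr2 sqrr_sign mul1r.
Qed.


(** Orthogonality to the tangent vectors of the graph: all components of the normal are determined
    by the [j]-th one. *)
Lemma unit_normal_graph S (x0 : 'rV[R]_d) r (j : 'I_d) (s : bool)
    (phi : 'rV[R]_d.-1 -> R) n x k :
  C1_fun phi ->
  (forall y, eball x0 r y -> S y <-> phi (col' j y) = (-1) ^+ s * y ord0 j) ->
  unit_normal_field S n -> eball x0 r x -> S x ->
  n x ord0 (lift j k) = - ((-1) ^+ s * partial phi k (col' j x)) * n x ord0 j.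
Proof.
move=> C1 SE [_ nS] Bx Sx; have [_ /(_ _ (tangent_vector_graph k C1 SE Bx Sx))] := nS x Sx.
by rewrite dotpDr dotpZr !dotp_delta mulNr => /eqP; rewrite addr_eq0 => /eqP.
Qed.

Lemma C2_bounds_near m (phi : 'rV[R]_m -> R) (a0 : 'rV[R]_m) : C2_fun phi ->
  exists2 L : R, 0 < L & forall a b, `|a - a0| < L^-1 -> `|b - a0| < L^-1 ->
    [/\ `|phi a - phi b| <= L * `|a - b|,
        forall k, `|partial phi k a - partial phi k b| <= L * `|a - b| &
        forall k, `|partial phi k a| <= L].
Proof.
move=> [C1 C2]; near (pinfty_nbhs R) => L.
have L0 : 0 < L by near: L; exact: nbhs_pinfty_gt.
have H k : forall a b, `|a - a0| < L^-1 -> `|b - a0| < L^-1 ->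
    `|partial phi k a - partial phi k b| <= L * `|a - b|.
  have : (forall k, forall a b, `|a - a0| < L^-1 -> `|b - a0| < L^-1 ->
    `|partial phi k a - partial phi k b| <= L * `|a - b|).
    near: L; apply: filter_forall => i; exact: C1_lipschitz_near.
  exact.
have H0 : forall a b, `|a - a0| < L^-1 -> `|b - a0| < L^-1 ->
    `|phi a - phi b| <= L * `|a - b|.
  by near: L; exact: C1_lipschitz_near.
have H1 k : `|partial phi k a0| + 1 <= L.
  have : forall k, `|partial phi k a0| + 1 <= L.
    by near: L; apply: filter_forall => i; apply: nbhs_pinfty_ge; exact: num_real.
  exact.
exists L => // a b aa ba; split; [exact: H0|by move=> k; exact: H|move=> k].
have a0L : `|a0 - a0| < L^-1 by rewrite subrr normr0 invr_gt0.
have := H k a a0 aa a0L; have := lerB_dist (partial phi k a) (partial phi k a0).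
have : L * `|a - a0| <= 1 by rewrite -ler_pdivlMl // mulr1 ltW.
have := H1 k; lra.
Unshelve. all: by end_near. Qed.

(** First bound: by the mean value theorem the [j]-th coordinate of [x - y] is a combination of the
    others with the slopes at [xi], while the normal has the slopes at [x]. Only differences of
    slopes remain, which makes the product quadratic. Second bound: [|n| = 1] reads
    [p^2 (1 + q) = 1] for the [j]-th component [p] of the normal and the squared gradient [q]. This
    makes [p^2] Lipschitz, and [p] too as soon as its sign is constant. *)
Lemma unit_normal_local S (x0 : 'rV[R]_d) r (j : 'I_d) (s : bool)
    (phi : 'rV[R]_d.-1 -> R) n :
  0 < r -> C2_fun phi ->
  (forall y, eball x0 r y -> S y <-> phi (col' j y) = (-1) ^+ s * y ord0 j) ->
  unit_normal_field S n -> S x0 ->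
  exists2 rho : R, 0 < rho & exists C : R, forall x y, S x -> S y ->
    eball x0 rho x -> eball x0 rho y ->
    `|dotp (n x) (x - y)| <= C * enorm (x - y) ^+ 2 /\
    enorm (n x - n y) <= C * enorm (x - y).
Proof.
move=> r0 C2 SE nf Sx0; have [L L0 HL] := C2_bounds_near (col' j x0) C2.
pose sg : R := (-1) ^+ s; have sg2 a : sg * (sg * a) = a.
  by rewrite mulrA -expr2 sqrr_sign mul1r.
have sgn : `|sg| = 1 by rewrite normrX normrN1 expr1n.
have n1 x : S x -> enorm (n x) = 1 by move=> /(proj2 nf) [].
pose m : R := d.-1%:R; pose M : R := 1 + m * L ^+ 2.
have m0 : 0 <= m by rewrite ler0n.
have M1 : 1 <= M by rewrite lerDl mulr_ge0 ?sqr_ge0.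
pose p x := n x ord0 j; pose q x := \sum_(k < d.-1) (partial phi k (col' j x)) ^+ 2.
have pq x : eball x0 r x -> S x -> p x ^+ 2 * (1 + q x) = 1.
  move=> Bx Sx; transitivity (enorm (n x) ^+ 2); last by rewrite n1 ?expr1n.
  rewrite sqr_enorm (dotp_lift j) -expr2 mulrDr mulr1; congr (_ + _).
  rewrite mulr_sumr; apply: eq_bigr => k _.
  rewrite (unit_normal_graph k C2.1 SE nf Bx Sx) -expr2 mulNr sqrrN !exprMn sqrr_sign.
  by rewrite mul1r mulrC.
have p1 x : S x -> `|p x| <= 1 by move=> Sx; rewrite -(n1 x Sx) coord_le_enorm.
have p0 : 0 < `|p x0|.
  have B0 : eball x0 r x0 by rewrite /eball /= subrr enorm0.
  rewrite normr_gt0; apply/eqP => p0; have /eqP := pq x0 B0 Sx0.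
  by rewrite p0 expr0n /= mul0r eq_sym oner_eq0.
(* Continuity of the normal enters here: near [x0] the component [p] keeps the sign of [p x0]. *)
have [r1 r10 Hr1] : exists2 r1, 0 < r1 & forall x, eball x0 r1 x -> S x ->
    `|p x - p x0| < `|p x0|.
  have /subspace_continuousP/(_ x0 Sx0) := proj1 nf.
  move=> /(_ _ (eball_nbhs (n x0) p0)) /nbhs_eball[e e0 eS]; exists e => // x ex Sx.
  have := eS x ex Sx; rewrite /eball /=; apply: le_lt_trans.
  by have := coord_le_enorm (n x - n x0) j; rewrite !mxE.
(* A third of [L^-1], because the intermediate points [xi] may be three times as far from the centre
   as [x] and [y]. *)
pose rho := Num.min r (Num.min r1 (L^-1 / 3)).
have rho0 : 0 < rho by rewrite /rho !lt_min r0 r10 divr_gt0 ?invr_gt0.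
exists rho => //.
have near_r x : eball x0 rho x -> [/\ eball x0 r x, eball x0 r1 x &
    `|col' j x - col' j x0| < L^-1 / 3].
  rewrite /eball /= /rho !lt_min => /and3P[h1 h2 h3]; split=> //.
  apply: le_lt_trans h3; rewrite (_ : _ - _ = col' j (x - x0)).
    by rewrite (le_trans (norm_col' _ _)) // norm_le_enorm.
  by apply/rowP => i; rewrite !mxE.
have colB x y : `|col' j x - col' j y| <= enorm (x - y).
  rewrite (_ : _ - _ = col' j (x - y)).
    by rewrite (le_trans (norm_col' _ _)) // norm_le_enorm.
  by apply/rowP => i; rewrite !mxE.
have L3 : L^-1 / 3 < L^-1.
  have : 0 < L^-1 by rewrite invr_gt0.
  lra.
(* [m * (L * (2 * L))] is a Lipschitz constant of [q]; the factor [M] comes from dividing by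
   [p x + p y], whose modulus is at least [M^-1]. So [C2'] is a Lipschitz constant of [p]. *)
pose C2' := M * (m * (L * (2 * L))).
pose C := Num.max (m * L) (d%:R * (L + L * C2' + C2')).
exists C => x y Sx Sy /near_r[Bx B1x Lx] /near_r[By B1y Ly].
split.
  apply: (@le_trans _ _ (m * L * enorm (x - y) ^+ 2)); last first.
    by rewrite ler_wpM2r ?sqr_ge0 // /C le_max lexx.
  have [xi [xix fe]] := C1_mvt C2.1 (col' j x) (col' j y).
  have -> : dotp (n x) (x - y) = sg * p x * \sum_(k < d.-1)
     (partial phi k (xi k) - partial phi k (col' j x)) * (x - y) ord0 (lift j k).
    rewrite (dotp_lift j) -/(p x).
    have -> : (x - y) ord0 j = sg * \sum_(k < d.-1) partial phi k (xi k) * (x - y) ord0 (lift j k).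
      rewrite !mxE -(sg2 (x ord0 j)) -(sg2 (y ord0 j)) -mulrBr -!(SE _ _).1 //.
      rewrite -opprB fe -sumrN; congr (_ * _); apply: eq_bigr => k _.
      by rewrite !mxE -mulrN opprB.
    have -> : \sum_(k < d.-1) n x ord0 (lift j k) * (x - y) ord0 (lift j k) =
       - (sg * p x) * \sum_(k < d.-1) partial phi k (col' j x) * (x - y) ord0 (lift j k).
      rewrite mulr_sumr; apply: eq_bigr => k _.
      rewrite (unit_normal_graph k C2.1 SE nf Bx Sx) -/sg -/(p x); ring.
    rewrite mulrCA mulrA mulNr -mulrBr -sumrB; congr (_ * _).
    by apply: eq_bigr => k _; rewrite mulrBl.
  rewrite normrM normrM sgn mul1r -[leRHS]mul1r ler_pM ?p1 //.
  apply: le_trans (ler_norm_sum _ _ _) _.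
  rewrite /m -mulrA mulr_natl -[X in _ *+ X]card_ord -sumr_const ler_sum // => k _.
  rewrite normrM expr2 mulrA ler_pM //; last by rewrite (le_trans (coord_le_enorm _ _)).
  have xL : `|xi k - col' j x0| < L^-1.
    have := ler_distD (col' j x) (xi k) (col' j x0).
    have := ler_distD (col' j x0) (col' j y) (col' j x).
    rewrite (distrC (col' j x0)); have := xix k; lra.
  have [_ /(_ k) h _] := HL _ _ xL (lt_trans Lx L3).
  by rewrite (le_trans h) // (ler_wpM2l (ltW L0)) // (le_trans (xix k)) // distrC.
apply: (@le_trans _ _ (d%:R * (L + L * C2' + C2') * enorm (x - y))); last first.
  by rewrite ler_wpM2r ?enorm_ge0 // /C le_max lexx orbT.
have [_ dL _] := HL _ _ (lt_trans Lx L3) (lt_trans Ly L3).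
have [_ _ dx] := HL _ _ (lt_trans Lx L3) (lt_trans Ly L3).
have [_ _ dy] := HL _ _ (lt_trans Ly L3) (lt_trans Lx L3).
set e := enorm (x - y); have e0 : 0 <= e by exact: enorm_ge0.
have dLe k : `|partial phi k (col' j x) - partial phi k (col' j y)| <= L * e.
  by rewrite (le_trans (dL k)) // (ler_wpM2l (ltW L0)) ?colB.
have qe : `|q x - q y| <= m * (L * (2 * L)) * e.
  rewrite /q -sumrB (le_trans (ler_norm_sum _ _ _)) //.
  rewrite /m -mulrA mulr_natl -[X in _ *+ X]card_ord -sumr_const ler_sum // => k _.
  rewrite subr_sqr normrM -mulrA [2 * L * e]mulrC mulrA ler_pM //.
  by rewrite (le_trans (ler_normD _ _)) // mulr2n mulrDl mul1r lerD // (dx, dy).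
have q0 z : 0 <= q z by apply: sumr_ge0 => k _; rewrite sqr_ge0.
have pM z : eball x0 r z -> S z -> q z <= m * L ^+ 2 -> M^-1 <= `|p z|.
  move=> Bz Sz qz; have M0 : 0 < M by lra.
  have : M^-1 <= `|p z| ^+ 2.
    rewrite real_normK ?num_real // -(ler_pM2r M0) mulVf ?gt_eqF // -(pq z Bz Sz).
    by rewrite ler_wpM2l ?sqr_ge0 // /M lerD2l.
  move=> h; apply: le_trans h _; rewrite expr2 -[leRHS]mulr1 ler_wpM2l // p1 //.
have qL z : (forall k, `|partial phi k (col' j z)| <= L) -> q z <= m * L ^+ 2.
  move=> h; rewrite /q /m mulr_natl -[X in _ *+ X]card_ord -sumr_const ler_sum // => k _.
  by rewrite -real_normK ?num_real // lerXn2r ?nnegrE // ltW.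
have px := pM x Bx Sx (qL x dx); have py := pM y By Sy (qL y dy).
have pe : `|p x - p y| <= C2' * e.
  have M0 : 0 < M by lra.
  have same : `|p x + p y| = `|p x| + `|p y|.
    have hx := Hr1 x B1x Sx; have hy := Hr1 y B1y Sy.
    move: hx hy; have [h|h] := leP 0 (p x0).
      rewrite !(ger0_norm h) !ltr_norml => hx hy; rewrite !ger0_norm //; lra.
    rewrite !(ltr0_norm h) !ltr_norml => hx hy; rewrite !ler0_norm //; lra.
  have eq2 : p x ^+ 2 - p y ^+ 2 = p x ^+ 2 * p y ^+ 2 * (q y - q x).
    have := pq x Bx Sx; have := pq y By Sy; move: (q x) (q y) => a b h1 h2.
    have -> : p x ^+ 2 * p y ^+ 2 * (b - a) =
      p x ^+ 2 * (p y ^+ 2 * (1 + b)) - p y ^+ 2 * (p x ^+ 2 * (1 + a)) by ring.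
    by rewrite h1 h2 !mulr1.
  have : `|p x - p y| * M^-1 <= m * (L * (2 * L)) * e.
    apply: (@le_trans _ _ (`|p x ^+ 2 - p y ^+ 2|)).
      by rewrite subr_sqr normrM ler_wpM2l // same (le_trans px) // lerDl.
    rewrite eq2 normrM distrC -[leRHS]mul1r ler_pM // normrM !normrX.
    by rewrite -[leRHS]mulr1 ler_pM ?exprn_ge0 // exprn_ile1 // p1.
  by rewrite ler_pdivrMr // /C2' => /le_trans; apply; rewrite le_eqVlt; apply/orP; left; apply/eqP; ring.
apply: le_trans (enorm_le_norm _) _; rewrite -mulrA ler_wpM2l ?ler0n //.
have C20 : 0 <= C2' by rewrite /C2' !mulr_ge0 //; lra.
have K0 : 0 <= L + L * C2' by apply: addr_ge0; [exact: ltW|apply: mulr_ge0 => //; exact: ltW].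
rewrite {1}/Num.norm /= mx_normrE; apply: bigmax_le.
  by rewrite mulr_ge0 // addr_ge0.
move=> [i0 i] _ /=; rewrite (ord1 i0) !mxE; case: (unliftP j i) => [k ->|->]; last first.
  by rewrite (le_trans pe) // ler_wpM2r // lerDr.
rewrite (unit_normal_graph k C2.1 SE nf Bx Sx) (unit_normal_graph k C2.1 SE nf By Sy).
rewrite -/sg -/(p x) -/(p y).
have -> : - (sg * partial phi k (col' j x)) * p x - - (sg * partial phi k (col' j y)) * p y =
  - sg * ((partial phi k (col' j x) - partial phi k (col' j y)) * p x +
          partial phi k (col' j y) * (p x - p y)) by ring.
rewrite normrM normrN sgn mul1r (le_trans (ler_normD _ _)) // !normrM !mulrDl.
rewrite -addrA lerD // ?(le_trans (ler_pM _ _ (dLe k) (p1 x Sx))) ?mulr1 //.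
by rewrite (le_trans (ler_pM _ _ (dy k) pe)) // -mulrA lerDl mulr_ge0.
Qed.

End boundary_normal.

(** * Upper bound for the Hausdorff measure of a graph *)

Section hausdorff_upper_bound.
Context {R : realType} {d : nat}.
Implicit Types (A S : set 'rV[R]_d) (x y : 'rV[R]_d).

Lemma hausdorff_pre_finite_cover s (delta b : R) A (I : finType)
    (P : I -> set 'rV[R]_d) :
  0 <= b <= delta -> A `<=` \bigcup_i P i ->
  (forall i x y, P i x -> P i y -> enorm (x - y) <= b) ->
  (hausdorff_pre s delta A <=
   (#|I|%:R * (unit_ball_volume s / 2 ^+ s * b ^+ s))%:E)%E.
Proof.
move=> /andP[b0 bd] AP Pb; set M := unit_ball_volume s / 2 ^+ s * b ^+ s.
have M0 : 0 <= M by rewrite mulr_ge0 ?exprn_ge0 // divr_ge0 ?unit_ball_volume_ge0 ?exprn_ge0.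
pose F k := if insub k : option 'I_#|I| is Some i then P (enum_val i) else set0.
have FA : A `<=` \bigcup_k F k.
  move=> x /AP[i _ Pix]; exists (enum_rank i) => //.
  by rewrite /F valK enum_rankK.
apply: le_trans (hausdorff_pre_cover _ _ FA) _.
have size_ge0 k : (0 <= hausdorff_size s delta (F k))%E by exact: hausdorff_size_ge0.
rewrite (nneseries_split _ #|I|) // [X in (_ + X)%E]eseries0; last first.
  move=> k; rewrite add0n => Ik _; rewrite /F insubN ?hausdorff_size0 //.
  by rewrite -leqNgt.
rewrite adde0 add0n big_mkord mulr_natl -[X in _ *+ X]card_ord -sumr_const -sumEFin.
apply: lee_sum => k _; rewrite /hausdorff_size.
have [_|/set0P[z Fz]] := eqVneq (F k) set0; first by rewrite lee_fin.
have Fb : (ediam (F k) <= b%:E)%E.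
  apply: ge_ereal_sup => _ [x Fx [y Fy <-]]; rewrite lee_fin.
  by move: Fx Fy; rewrite /F valK => Px Py; exact: Pb Px Py.
have F0 : (0 <= ediam (F k))%E.
  rewrite -[0%E]/((0 : R)%:E) -(enorm0 (d := d)) -(subrr z).
  by apply: ereal_sup_ubound; exists z => //; exists z.
rewrite (le_trans Fb) ?lee_fin //; move: Fb F0; case: (ediam _) => // a.
rewrite !lee_fin => ab a0; rewrite -EFin_expe -EFinM lee_fin /M ler_wpM2l //.
  by rewrite divr_ge0 ?unit_ball_volume_ge0 ?exprn_ge0.
by rewrite lerXn2r ?nnegrE.
Qed.

Lemma grid_approx (N : nat) (u : R) : 0 <= u <= 1 ->
  exists i : 'I_N.+1, `|u - i%:R / N.+1%:R| <= N.+1%:R^-1.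
Proof.
move=> /andP[u0 u1]; have N0 : (0 : R) < N.+1%:R by [].
have uN0 : 0 <= u * N.+1%:R by rewrite mulr_ge0.
have /andP[i1 i2] := truncn_itv uN0; set i0 := Num.truncn _ in i1 i2.
have e (i : nat) : i%:R <= u * N.+1%:R <= i.+1%:R -> `|u - i%:R / N.+1%:R| <= N.+1%:R^-1.
  have -> : u - i%:R / N.+1%:R = (u * N.+1%:R - i%:R) / N.+1%:R.
    by rewrite mulrBl mulfK // gt_eqF.
  move=> /andP[h1 h2]; rewrite normrM normfV [`|N.+1%:R|]ger0_norm ?ler0n //.
  rewrite -[i.+1%:R]natr1 in h2; rewrite -[leRHS]mul1r ler_wpM2r ?invr_ge0 ?ler0n //.
  by rewrite ger0_norm ?subr_ge0 // lerBlDl.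
have [iN|Ni] := ltnP i0 N.+1; first by exists (Ordinal iN); apply: e; rewrite i1 ltW.
(* Here [u = 1], which is no left end of a cell but is within one step of the last grid point. *)
exists ord_max; apply: e; rewrite /= -[X in _ && (_ <= X)]mul1r ler_wpM2r ?ler0n // andbT.
by rewrite (le_trans _ i1) // ler_nat ltnW.
Qed.

(* The projection of the ball on the hyperplane is cut into N^(d-1) cubes; each
   piece of the graph has diameter at most K t / N, and N cancels. *)
Lemma hausdorff_graph_le S x0 r (j : 'I_d) (s : bool) (phi : 'rV[R]_d.-1 -> R) :
  0 < r -> C2_fun phi ->
  (forall y, eball x0 r y -> S y <-> phi (col' j y) = (-1) ^+ s * y ord0 j) ->
  exists2 rho : R, 0 < rho & exists2 C : R, 0 <= C & forall x t,
    eball x0 rho x -> 0 < t <= rho ->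
    (hausdorff d.-1 (S `&` [set y | (enorm (y - x) <= t)%R]) <= (C * t ^+ d.-1)%:E)%E.
Proof.
move=> r0 C2 SE; have [L L0 HL] := C2_bounds_near (col' j x0) C2.
(* Halves, since the ball of radius [t <= rho] around [x] is contained in the ball of radius
   [2 * rho] around [x0]. *)
pose rho := Num.min (r / 2) (L^-1 / 2).
have rho0 : 0 < rho by rewrite /rho !lt_min !divr_gt0 ?invr_gt0.
(* Two points of a piece are within [2 t / N] of the same grid point in every coordinate of the
   hyperplane, hence within [4 t / N] of each other; the graph multiplies this by at most [L], and
   [d] converts the sup norm into the Euclidean one. *)
pose K := 4 * d%:R * (1 + L).
have K0 : 0 <= K by rewrite /K !mulr_ge0 // addr_ge0 // ltW.
have c0 : 0 <= unit_ball_volume d.-1 / 2 ^+ d.-1 :> R.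
  by rewrite divr_ge0 ?unit_ball_volume_ge0 ?exprn_ge0.
exists rho => //; exists (unit_ball_volume d.-1 / 2 ^+ d.-1 * K ^+ d.-1).
  by rewrite mulr_ge0 ?exprn_ge0.
move=> x t xrho /andP[t0 trho].
have colB y z : `|col' j y - col' j z| <= enorm (y - z).
  rewrite (_ : _ - _ = col' j (y - z)).
    by rewrite (le_trans (norm_col' _ _)) // norm_le_enorm.
  by apply/rowP => i; rewrite !mxE.
have yrho y : enorm (y - x) <= t -> eball x0 r y /\ `|col' j y - col' j x0| < L^-1.
  move=> yx; have : enorm (y - x0) < 2 * rho.
    by rewrite (le_lt_trans (enorm_triangle x _ _)) // mulr2n mulrDl mul1r ler_ltD // (le_trans yx).
  rewrite /eball /= [2 * rho]mulrC -ltr_pdivrMr // /rho lt_min => /andP[h1 h2].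
  split; first by rewrite -(ltr_pM2r (x := 2^-1)) ?invr_gt0.
  by apply: le_lt_trans (colB _ _) _; rewrite -(ltr_pM2r (x := 2^-1)) ?invr_gt0.
apply: ge_ereal_sup => _ [delta /= delta0 <-].
have [N KN] : exists N : nat, K * t / N.+1%:R <= delta.
  exists (Num.truncn (delta^-1 * (K * t))); rewrite ler_pdivrMr // -ler_pdivrMl //.
  by rewrite ltW // truncnS_gt.
pose P (g : {ffun 'I_d.-1 -> 'I_N.+1}) := [set y | [/\ S y, enorm (y - x) <= t &
  forall k, `|(y - x) ord0 (lift j k) + t - 2 * t * ((g k)%:R / N.+1%:R)| <= 2 * t / N.+1%:R]].
have KtN0 : 0 <= K * t / N.+1%:R by rewrite divr_ge0 // mulr_ge0 // ltW.
have bd : 0 <= K * t / N.+1%:R <= delta by rewrite KtN0.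
have := @hausdorff_pre_finite_cover d.-1 delta _ (S `&` [set y | (enorm (y - x) <= t)%R]) _ P bd.
have -> : #|{: {ffun 'I_d.-1 -> 'I_N.+1}}|%:R *
   (unit_ball_volume d.-1 / 2 ^+ d.-1 * (K * t / N.+1%:R) ^+ d.-1) =
   unit_ball_volume d.-1 / 2 ^+ d.-1 * K ^+ d.-1 * t ^+ d.-1 :> R.
  rewrite card_ffun !card_ord natrX !exprMn exprVn mulrC -!mulrA mulVf ?mulr1 //.
apply.
- move=> y [Sy /= yx].
  have key (k : 'I_d.-1) : exists i : 'I_N.+1,
      `|(y - x) ord0 (lift j k) + t - 2 * t * (i%:R / N.+1%:R)| <= 2 * t / N.+1%:R.
    have t20 : 0 < 2 * t by rewrite mulr_gt0.
    have [|i hi] := @grid_approx N (((y - x) ord0 (lift j k) + t) / (2 * t)).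
      have := le_trans (coord_le_enorm (y - x) (lift j k)) yx; rewrite ler_norml => /andP[h1 h2].
      apply/andP; split; first by rewrite divr_ge0 ?(ltW t20) //; lra.
      by rewrite ler_pdivrMr // mul1r; lra.
    exists i; have := ler_wpM2l (ltW t20) hi.
    rewrite -{1}(ger0_norm (ltW t20)) -normrM mulrBr mulrC divfK // gt_eqF //.
  have [g gP] := choice key; exists [ffun k => g k] => //; split=> // k.
  by rewrite ffunE.
- move=> g y z [Sy yx gy] [Sz zx gz].
  have [By Ly] := yrho y yx; have [Bz Lz] := yrho z zx.
  have cyz : `|col' j y - col' j z| <= 4 * t / N.+1%:R.
    rewrite {1}/Num.norm /= mx_normrE; apply: bigmax_le.
      by rewrite divr_ge0 // mulr_ge0 // ltW.
    move=> [i0 k] _ /=; rewrite (ord1 i0) !mxE.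
    have := gy k; have := gz k; rewrite !mxE.
    set a := y _ _; set b := z _ _; set c := x _ _; set w := 2 * t * (_ / _) => h1 h2.
    rewrite (_ : a - b = (a - c + t - w) - (b - c + t - w)); last by ring.
    have -> : 4 * t / N.+1%:R = 2 * t / N.+1%:R + 2 * t / N.+1%:R by ring.
    by rewrite (le_trans (ler_normB _ _)) // lerD.
  apply: le_trans (enorm_le_norm _) _.
  have -> : K * t / N.+1%:R = d%:R * ((1 + L) * (4 * t / N.+1%:R)) by rewrite /K; ring.
  rewrite ler_wpM2l ?ler0n // {1}/Num.norm /= mx_normrE; apply: bigmax_le.
    by rewrite mulr_ge0 //; [lra|rewrite (le_trans _ cyz)].
  have q0 : 0 <= 4 * t / N.+1%:R by rewrite (le_trans _ cyz).
  move=> [i0 i] _ /=; rewrite (ord1 i0); case: (unliftP j i) => [k ->|->].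
    have := coord_le_norm (col' j y - col' j z) k; rewrite !mxE => h.
    by rewrite (le_trans h) // (le_trans cyz) // ler_peMl // lerDl ltW.
  have [h _ _] := HL _ _ Ly Lz; rewrite !mxE.
  have sg a : `|a| = `|(-1) ^+ s * a : R| by rewrite normrM normrX normrN1 expr1n mul1r.
  rewrite sg mulrBr -(SE _ By).1 // -(SE _ Bz).1 // (le_trans h) //.
  by rewrite mulrDl mul1r (le_trans (ler_wpM2l (ltW L0) cyz)) // lerDr.
Qed.

End hausdorff_upper_bound.

(** * From local to uniform bounds on the boundary *)

Section uniform_bounds.
Context {R : realType} {d : nat}.
Implicit Types (S D : set 'rV[R]_d) (x y : 'rV[R]_d).

(* The constant C is itself the parameter of the near-covering property. *)
Lemma compact_locally_uniform S (Q : R -> 'rV[R]_d -> Prop) :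
  compact S ->
  (forall x0, S x0 -> \forall x \near x0 & C \near +oo, S x -> Q C x) ->
  exists2 C : R, 0 < C & forall x, S x -> Q C x.
Proof.
move=> /compact_near_coveringP/near_covering_withinP cS locS.
have : \forall C \near +oo, S `<=` Q C by apply: cS.
move=> H; near (pinfty_nbhs R) => C; exists C; last by near: C.
by near: C; exact: nbhs_pinfty_gt.
Unshelve. all: by end_near. Qed.

(* Near-covering is applied to the filter generated by the sets of finite measure. *)
Lemma compact_locally_finite S (mu : {outer_measure set 'rV[R]_d -> \bar R}) :
  compact S ->
  (forall x0, S x0 -> exists2 r : R, 0 < r & (mu (S `&` eball x0 r) < +oo)%E) ->
  (mu S < +oo)%E.
Proof.
move=> /compact_near_coveringP/near_covering_withinP cS locS.
pose F := filter_from [set A | mu A < +oo]%E (fun A : set 'rV[R]_d => [set B | A `<=` B]).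
have FF : Filter F.
  apply: filter_from_filter; first by exists set0; rewrite /= outer_measure0.
  move=> A B mA mB; exists (A `|` B); first by rewrite /= (le_lt_trans (outer_measureU2 _ _ _)) // lte_add_pinfty.
  by move=> E /= ABE; split => x Ax; apply: ABE; [left|right].
have : \near F, S `<=` id F.
  apply: cS => x0 /locS[r r0 mur].
  exists (eball x0 r, [set B | S `&` eball x0 r `<=` B]).
    by split; [exact: eball_nbhs|exists (S `&` eball x0 r)].
  by move=> [x B] /= [Bx SB] Sx; apply: SB.
move=> [A mA /(_ A)] SA; rewrite (le_lt_trans _ mA) // le_outer_measure //.
by apply: SA; exact: subset_refl.
Qed.

Lemma bounded_enorm S : bounded_set S ->
  exists2 M : R, 0 < M & forall x y, S x -> S y -> enorm (x - y) <= M.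
Proof.
move=> [N [_ SN]]; pose N1 := `|N| + 1.
have NN1 : N < N1 by rewrite (le_lt_trans (ler_norm N)) // ltrDl.
exists (d%:R * (N1 + N1) + 1).
  by rewrite addrC ltr_wpDr // mulr_ge0 // addr_ge0 // addr_ge0.
move=> x y Sx Sy; rewrite (le_trans (enorm_le_norm _)) // ler_wpDr //.
rewrite ler_wpM2l // (le_trans (ler_normB _ _)) // lerD //; exact: SN NN1 _ _.
Qed.

(** [C2_fun] speaks of partial derivatives, so the continuity of [phi] required by [boundary_graph]
    is drawn from its local Lipschitz bound. *)
Lemma boundary_graph_at D x0 : open D -> C2_boundary D -> boundary D x0 ->
  exists (r : R) (j : 'I_d) (s : bool) (phi : 'rV[R]_(d.-1) -> R),
    [/\ 0 < r, C2_fun phi & forall y, eball x0 r y ->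
       boundary D y <-> phi (col' j y) = (-1) ^+ s * y ord0 j].
Proof.
move=> oD C2D /C2D[r [j [s [phi [r0 C2 DE]]]]]; exists r, j, s, phi; split=> //.
apply: boundary_graph => // a0; apply/(cvgrPdist_lt (FF := nbhs_filter a0)) => e e0.
have [L L0 HL] := C2_bounds_near a0 C2.
apply/nbhs_ballP; exists (Num.min L^-1 (e / L)).
  by rewrite /= lt_min invr_gt0 L0 divr_gt0.
move=> a; rewrite mx_norm_ball /ball_ /= distrC lt_min => /andP[h1 h2].
have a0L : `|a0 - a0| < L^-1 by rewrite subrr normr0 invr_gt0.
have [h _ _] := HL a0 a a0L h1; rewrite (le_lt_trans h) //.
by rewrite mulrC -ltr_pdivlMr // distrC.
Qed.

(** Points at distance less than [1 / C] lie in a common chart. For all other pairs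
    [C |x - y| >= 1], so the trivial bounds [|x - y|] and 2, coming from [|n| = 1], suffice; the
    latter is the origin of the factor 2. *)
Lemma unit_normal_bounds D n : open D -> bounded_set D -> C2_boundary D ->
  unit_normal_field (boundary D) n ->
  exists2 C : R, 0 < C & forall x y, boundary D x -> boundary D y ->
    `|dotp (n x) (x - y)| <= C * enorm (x - y) ^+ 2 /\
    enorm (n x - n y) <= C * enorm (x - y).
Proof.
move=> oD bD C2D nf; set S := boundary D.
have [C C0 H] : exists2 C : R, 0 < C & forall x, S x -> forall y, S y ->
    enorm (x - y) < C^-1 -> `|dotp (n x) (x - y)| <= C * enorm (x - y) ^+ 2 /\
    enorm (n x - n y) <= C * enorm (x - y).
  apply: compact_locally_uniform; first exact: boundary_compact.
  move=> x0 Sx0; have [r [j [s [phi [r0 C2 SE]]]]] := boundary_graph_at oD C2D Sx0.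
  have [rho rho0 [C1 H]] := unit_normal_local r0 C2 SE nf Sx0.
  near=> x C => Sx y Sy xy.
  have Bx : eball x0 (rho / 2) x.
    by near: x; apply: eball_nbhs; rewrite divr_gt0.
  have C0 : 0 < C by near: C; exact: nbhs_pinfty_gt.
  have Crho : C^-1 <= rho / 2.
    rewrite -[leRHS]invrK lef_pV2 ?posrE ?invr_gt0 ?divr_gt0 //.
  have C1C : C1 <= C by [].
  have By : eball x0 rho y.
    rewrite /eball /= (le_lt_trans (enorm_triangle x _ _)) // [ltRHS]splitr ltrD //.
    by rewrite enorm_distC (lt_le_trans xy).
  have [|h1 h2] := H x y Sx Sy _ By.
    by rewrite /eball /= (lt_trans Bx) // ltr_pdivrMr // ltr_pMr // ltr1n.
  split; first by rewrite (le_trans h1) // ler_wpM2r ?sqr_ge0.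
  by rewrite (le_trans h2) // ler_wpM2r ?enorm_ge0.
exists (C * 2); first by rewrite mulr_gt0.
move=> x y Sx Sy; have n1 z : S z -> enorm (n z) = 1 by move=> /(proj2 nf) [].
have [xy|yx] := ltP (enorm (x - y)) C^-1.
  have [h1 h2] := H x Sx y Sy xy; split.
    by rewrite (le_trans h1) // ler_wpM2r ?sqr_ge0 // ler_peMr ?ltW // ltr1n.
  by rewrite (le_trans h2) // ler_wpM2r ?enorm_ge0 // ler_peMr ?ltW // ltr1n.
have Ce : 1 <= C * enorm (x - y) by rewrite -ler_pdivrMl // mulr1.
split.
  rewrite (le_trans (dotp_le_enorm _ _)) // n1 // mul1r expr2 mulrA ler_peMl ?enorm_ge0 //.
  by rewrite mulrAC (le_trans Ce) // ler_peMr ?ler1n // (le_trans _ Ce).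
rewrite (le_trans (enormD _ _)) // enormN !n1 // mulrAC -[leLHS]mul1r mulrDr mulr1 -mulr2n.
by rewrite -[leLHS]mulr_natr mul1r ler_peMl.
Unshelve. all: by end_near. Qed.

(** The charts give the bound for [t < 1 / C] and, by compactness, the finiteness of the total
    measure [V]. For larger [t] one has [V <= V (C t)^(d-1)], which explains the second summand of
    the constant. *)
Lemma surface_measure_ball_le D : open D -> bounded_set D -> C2_boundary D ->
  exists2 C : R, 0 <= C & forall x t, boundary D x -> 0 < t ->
    (surface_measure R d (boundary D `&` [set y | (enorm (y - x) <= t)%R])
     <= (C * t ^+ d.-1)%:E)%E.
Proof.
move=> oD bD C2D; set S := boundary D.
pose mu := surface_outer_measure R d.
have cS : compact S by exact: boundary_compact.
have [C C0 H] : exists2 C : R, 0 < C & forall x, S x -> forall t, 0 < t < C^-1 ->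
    (mu (S `&` [set y | (enorm (y - x) <= t)%R]) <= (C * t ^+ d.-1)%:E)%E.
  apply: compact_locally_uniform => // x0 Sx0.
  have [r [j [s [phi [r0 C2 SE]]]]] := boundary_graph_at oD C2D Sx0.
  have [rho rho0 [C1 C10 H]] := hausdorff_graph_le r0 C2 SE.
  near=> x C => Sx t /andP[t0 tC].
  have Bx : eball x0 rho x by near: x; exact: eball_nbhs.
  have C0 : 0 < C by near: C; exact: nbhs_pinfty_gt.
  have Crho : C^-1 <= rho by rewrite -[leRHS]invrK lef_pV2 ?posrE ?invr_gt0 //.
  have C1C : C1 <= C by [].
  have trho : 0 < t <= rho by rewrite t0 (le_trans (ltW tC)).
  apply: le_trans (H x t Bx trho) _; rewrite lee_fin ler_wpM2r //.
  by apply: exprn_ge0; exact: ltW.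
have Sfin : (mu S < +oo)%E.
  apply: compact_locally_finite => // x0 Sx0; exists (C^-1 / 2).
    by rewrite divr_gt0 // invr_gt0.
  apply: (@le_lt_trans _ _ (mu (S `&` [set y | (enorm (y - x0) <= C^-1 / 2)%R]))).
    by apply: le_outer_measure => y [Sy /ltW].
  apply: le_lt_trans (H x0 Sx0 (C^-1 / 2) _) _; last exact: ltey.
  by rewrite divr_gt0 ?invr_gt0 //= ltr_pdivrMr // ltr_pMr ?invr_gt0 // ltr1n.
pose V := fine (mu S); have V0 : 0 <= V by rewrite fine_ge0 // outer_measure_ge0.
have VE : mu S = V%:E by rewrite fineK // ge0_fin_numE // outer_measure_ge0.
exists (C + V * C ^+ d.-1); first by rewrite addr_ge0 ?mulr_ge0 ?exprn_ge0 // ltW.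
move=> x t Sx t0; have t0' := ltW t0; have C0' := ltW C0.
have [tC|Ct] := ltP t C^-1.
  apply: le_trans (H x Sx t _) _; first by rewrite t0.
  by rewrite lee_fin ler_wpM2r ?exprn_ge0 // lerDl mulr_ge0 ?exprn_ge0.
apply: (@le_trans _ _ (mu S)); first by apply: le_outer_measure => y [].
rewrite VE lee_fin mulrDl ler_wpDl ?mulr_ge0 ?exprn_ge0 // -mulrA -exprMn.
by rewrite ler_peMr // exprn_ege1 // -ler_pdivrMl // mulr1.
Unshelve. all: by end_near. Qed.

Lemma surface_measurable_boundary D :
  measurable (boundary D : set (surface_space R d)).
Proof.
rewrite -[boundary D]setCK; apply: measurableC; apply: open_surface_measurable.
apply: closed_openC; apply: closedI; first exact: closed_closure.
by apply: open_closedC; exact: open_interior.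
Qed.

End uniform_bounds.

(** * Weakly singular integral operators *)

Section weakly_singular.
Context {R : realType} {d : nat} (S : set 'rV[R]_d) (M C0 : R) (m : nat).
Let mu := surface_measure R d.
Context (mS : measurable (S : set (surface_space R d))).
Context (M0 : 0 < M).
Context (SM : forall x y, S x -> S y -> enorm (x - y) <= M).
Context (C00 : 0 <= C0).
Context (ball_le : forall x t, S x -> 0 < t ->
  (mu (S `&` [set y | (enorm (y - x) <= t)%R]) <= (C0 * t ^+ m)%:E)%E).

(* At y = x the weight is 0, since 0 `^ p = 0 for p != 0. *)
Definition weight (eps : R) (x y : 'rV[R]_d) : R :=
  enorm (y - x) `^ (eps - m%:R).

Lemma weight_ge0 eps x y : 0 <= weight eps x y.
Proof. exact: powR_ge0. Qed.

Lemma continuous_enormB x : continuous (fun y : 'rV[R]_d => enorm (y - x)).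
Proof.
move=> y; apply: (@continuous_comp _ _ _ (fun y : 'rV[R]_d => y - x) (@enorm R d)).
  by apply: (cvgB (FF := nbhs_filter y)) => //; exact: cvg_cst.
exact: enorm_continuous.
Qed.

Lemma measurable_continuous (f : 'rV[R]_d -> R) (D : set (surface_space R d)) :
  measurable D -> continuous f -> measurable_fun D f.
Proof.
move=> mD cf; apply: continuous_surface_measurable => //.
exact: continuous_subspaceT.
Qed.

Lemma measurable_weight eps x (D : set (surface_space R d)) :
  measurable D -> measurable_fun D (weight eps x).
Proof.
move=> mD; apply: (measurableT_comp (measurable_powR _)).
by apply: measurable_continuous => //; exact: continuous_enormB.
Qed.

Lemma measurable_annulus x (P : set R) (D : set (surface_space R d)) :
  measurable D -> measurable P -> measurable (D `&` [set y | P (enorm (y - x))]).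
Proof.
move=> mD mP.
exact: (measurable_continuous mD (continuous_enormB (x := x)) mD mP).
Qed.

Lemma weight_integral eps : 0 < eps -> eps < m%:R ->
  exists2 I : R, 0 <= I & forall x, S x ->
    (\int[mu]_(y in S) (weight eps x y)%:E <= I%:E)%E.
Proof.
move=> eps0 epsm.
pose t (k : nat) := M * 2^-1 ^+ k; have t0 k : 0 < t k by rewrite mulr_gt0 ?exprn_gt0 ?invr_gt0.
have tS k : t k.+1 < t k.
  by rewrite /t exprS mulrCA gtr_pMl ?t0 // invf_lt1 // ltr1n.
have tle j k : (j <= k)%N -> t k <= t j.
  by move=> jk; rewrite /t ler_wpM2l ?(ltW M0) // ler_wiXn2l // invf_le1 // ler1n.
pose q : R := 2^-1 `^ eps.
have q0 : 0 <= q by exact: powR_ge0.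
have q1 : q < 1.
  rewrite /q /powR invr_eq0 pnatr_eq0 /= expR_lt1 pmulr_rlt0 //.
  by rewrite ln_lt0 // invr_gt0 ltr0n /= invf_lt1 // ltr1n.
pose B := t 1%N `^ (eps - m%:R) * (C0 * t 0%N ^+ m).
have term k : t k.+1 `^ (eps - m%:R) * (C0 * t k ^+ m) = B * q ^+ k.
  have h0 j : 0 <= (2^-1 : R) ^+ j by rewrite exprn_ge0 // invr_ge0.
  have -> : t k.+1 = t 1%N * 2^-1 ^+ k by rewrite /t -mulrA -exprS expr1.
  have -> : t k = t 0%N * 2^-1 ^+ k by rewrite /t expr0 mulr1.
  have h1 : 0 <= (2^-1 : R) by rewrite invr_ge0.
  have hp p : ((2^-1 : R) ^+ k) `^ p = 2^-1 `^ (k%:R * p) by rewrite -powR_mulrn // -powRrM.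
  rewrite powRM ?(ltW (t0 _)) // exprMn /B hp.
  have -> : q ^+ k = (2^-1 `^ (k%:R * (eps - m%:R))) * (2^-1 ^+ k) ^+ m.
    rewrite -exprM -[X in _ * X]powR_mulrn // -powRD ?invr_eq0 ?pnatr_eq0 ?implybT //.
    rewrite -powR_mulrn ?powR_ge0 // -powRrM; congr (_ `^ _).
    by rewrite natrM; ring.
  by ring.
have B0 : 0 <= B by rewrite mulr_ge0 ?powR_ge0 // mulr_ge0 // exprn_ge0 // ltW.
exists (B / (1 - q)); first by rewrite divr_ge0 // subr_ge0 ltW.
move=> x Sx.
pose A k := S `&` [set y | `]t k.+1, t k]%classic (enorm (y - x))].
have mA k : measurable (A k : set (surface_space R d)) by apply: measurable_annulus.
have SA : S = (S `&` [set x]) `|` \bigcup_k A k.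
  apply/seteqP; split => [y Sy|y [[]|[k _ []]] //].
  have [->|yx] := eqVneq y x; first by left.
  have r0 : 0 < enorm (y - x).
    rewrite lt0r enorm_ge0 andbT; apply: contra yx => /eqP/enorm_eq0/eqP.
    by rewrite subr_eq0.
  have exk : exists k, t k.+1 < enorm (y - x).
    exists (Num.truncn (M / enorm (y - x))); rewrite /t exprVn ltr_pdivrMr ?exprn_gt0 //.
    rewrite -ltr_pdivrMl // mulrC (lt_trans (truncnS_gt _)) //.
    by rewrite -natrX ltr_nat ltn_expl.
  right; case: (ex_minnP exk) => k tk mink; exists k => //; split=> //=.
  rewrite in_itv /= tk /=; case: k tk mink => [|k] tk mink.
    by rewrite /t expr0 mulr1 SM.
  by rewrite leNgt; apply/negP => /mink; rewrite ltnn.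
have mx : measurable (S `&` [set x] : set (surface_space R d)).
  rewrite (_ : _ `&` _ = S `&` [set y | [set 0] (enorm (y - x))]).
    exact: measurable_annulus.
  apply/seteqP; split => y /= [Sy].
    by move=> ->; split => //; rewrite subrr enorm0.
  by move=> /enorm_eq0/eqP; rewrite subr_eq0 => /eqP ->.
have mU : measurable (\bigcup_k A k : set (surface_space R d)) by exact: bigcup_measurable.
have mw (D : set (surface_space R d)) : measurable D ->
    measurable_fun D (fun y => (weight eps x y)%:E).
  by move=> mD; apply/measurable_EFinP/measurable_weight.
have E : (\int[mu]_(y in S) (weight eps x y)%:E =
    \int[mu]_(y in S `&` [set x]) (weight eps x y)%:E +
    \int[mu]_(y in \bigcup_k A k) (weight eps x y)%:E)%E.
  rewrite {1}SA; apply: ge0_integral_setU.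
  - exact: mx.
  - exact: mU.
  - by apply: mw; exact: measurableU.
  - by move=> y _; rewrite lee_fin weight_ge0.
  - apply/disj_set2P; rewrite -subset0 => y [[_ /= ->] [k _ [_ /=]]].
    by rewrite subrr enorm0 in_itv /= ltNge (ltW (t0 _)).
rewrite E.
rewrite [X in (X + _)%E]integral0_eq ?add0e; last first.
  move=> y [_ /= ->]; rewrite /weight subrr enorm0 powR0 //.
  by rewrite subr_eq0 lt_eqF.
rewrite ge0_integral_bigcup; last 4 first.
- exact: mA.
- exact: mw.
- by move=> y _; rewrite lee_fin weight_ge0.
- apply/trivIsetP => i j _ _; wlog ij : i j / (i < j)%N => [H|_].
    by rewrite neq_ltn => /orP[ij|ij]; [|rewrite setIC]; apply: H => //; rewrite neq_ltn ij // orbT.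
  rewrite -subset0 => y [[_ /=]]; rewrite in_itv /= => /andP[h1 _] [_ /=].
  by rewrite in_itv /= => /andP[_ h2]; have := lt_le_trans h1 h2; rewrite ltNge tle.
apply: lime_le; first by apply: is_cvg_nneseries => k _ _; apply: integral_ge0 => y _; rewrite lee_fin weight_ge0.
apply: nearW => n; rewrite big_mkord.
apply: (@le_trans _ _ (\sum_(k < n) (B * q ^+ k)%:E)%E).
  apply: lee_sum => k _.
  apply: (@le_trans _ _ (\int[mu]_(y in A k) (cst (t k.+1 `^ (eps - m%:R))%:E y))%E).
    apply: ge0_le_integral.
    - exact: mA.
    - by move=> y _; rewrite lee_fin weight_ge0.
    - exact: mw.
    - exact: measurable_cst.
    move=> y [_ /=]; rewrite in_itv /= => /andP[ty _]; rewrite lee_fin /weight.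
    rewrite -(opprB m%:R) !powRN lef_pV2 ?posrE ?powR_gt0 ?(lt_trans _ ty) //.
    by apply: ge0_ler_powR; rewrite ?nnegrE ?subr_ge0 ?enorm_ge0 // ltW.
  rewrite (integral_cst _ (mA k)) -term EFinM; apply: lee_wpmul2l; first by rewrite lee_fin powR_ge0.
  apply: le_trans (ball_le Sx (t0 k)); apply: le_measure; rewrite ?inE; [exact: mA| |].
    rewrite (_ : [set y | _] = [set y | `]-oo, t k]%classic (enorm (y - x))]).
      exact: measurable_annulus.
    by apply/seteqP; split => y; rewrite /= in_itv.
  by move=> y [Sy /=]; rewrite in_itv /= => /andP[].
rewrite sumEFin lee_fin -mulr_sumr ler_wpM2l //.
have p0 : 0 < 1 - q by rewrite subr_gt0.
rewrite -[leRHS]mul1r ler_pdivlMr // mulrC.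
have := subrX1 q n; have := exprn_ge0 n q0; set Sq := \sum_(_ < _) _ => h1 h2.
rewrite -(opprB q) mulNr -h2; lra.
Qed.

End weakly_singular.

(** * Integral operators with weakly singular kernels *)

Section integral_operator.
Context {R : realType} {d : nat} (S : set 'rV[R]_d) (m : nat) (beta eps I : R).
Let mu := surface_measure R d.
Context (mS : measurable (S : set (surface_space R d))).
Context (beta0 : 0 < beta).
Context (I0 : 0 <= I).
Local Notation w := (weight m eps).
Context (weight_le : forall x, S x -> (\int[mu]_(y in S) (w x y)%:E <= I%:E)%E).

Lemma integrable_weight x (D : set (surface_space R d)) :
  S x -> measurable D -> D `<=` S ->
  mu.-integrable D (EFin \o w x) /\ \int[mu]_(y in D) (w x y) <= I.
Proof.
move=> Sx mD DS.
have mw E : measurable E -> measurable_fun (E : set (surface_space R d)) (EFin \o w x).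
  by move=> mE; apply/measurable_EFinP/measurable_weight.
have h : (\int[mu]_(y in D) (w x y)%:E <= I%:E)%E.
  apply: le_trans (weight_le Sx); apply: ge0_subset_integral.
  - exact: mD.
  - exact: mS.
  - exact: mw.
  - by move=> y _; rewrite lee_fin weight_ge0.
  - exact: DS.
have i : mu.-integrable D (EFin \o w x).
  apply/integrableP; split; first exact: mw.
  rewrite (eq_integral (fun y : surface_space R d => (w x y)%:E)); first exact: le_lt_trans h (ltry I).
  by move=> y _ /=; rewrite ger0_norm ?weight_ge0.
split; first exact: i.
rewrite -lee_fin /Rintegral fineK; first exact: h.
exact: (integrable_fin_num mD i).
Qed.

Lemma Rintegral_dominated (f g : 'rV[R]_d -> R) (J : R) (D : set (surface_space R d)) :
  measurable D -> measurable_fun D f -> mu.-integrable D (EFin \o g) ->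
  \int[mu]_(y in D) g y <= J -> (forall y, D y -> `|f y| <= g y) ->
  mu.-integrable D (EFin \o f) /\ `|\int[mu]_(y in D) f y| <= J.
Proof.
move=> mD mf ig gJ fg.
have i : mu.-integrable D (EFin \o f).
  apply: (le_integrable mD _ _ ig); first exact/measurable_EFinP.
  by move=> y Dy /=; rewrite lee_fin (le_trans (fg y Dy)) // ler_norm.
split; first exact: i.
apply: le_trans (le_normr_Rintegral mD i) _.
apply: le_trans gJ; apply: le_Rintegral; [exact: mD| |exact: ig|exact: fg].
exact: (integrable_norm i).
Qed.

Lemma weakly_singular_integrable x (f : 'rV[R]_d -> R) A (D : set (surface_space R d)) :
  S x -> 0 <= A -> measurable D -> D `<=` S -> measurable_fun D f ->
  (forall y, D y -> `|f y| <= A * w x y) ->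
  mu.-integrable D (EFin \o f) /\ `|\int[mu]_(y in D) f y| <= A * I.
Proof.
move=> Sx A0 mD DS mf fA; have [iw wI] := integrable_weight Sx mD DS.
apply: Rintegral_dominated fA; [exact: mD|exact: mf|exact: (integrableZl mD A iw)|].
by rewrite RintegralZl; [rewrite ler_wpM2l|exact: mD|exact: iw].
Qed.

Lemma truncation_measurable x e : measurable (truncation S x e).
Proof.
rewrite (_ : truncation _ _ _ = S `&` [set y | `]e, +oo[%classic (enorm (y - x))]).
  by apply: measurable_annulus; [exact: mS|exact: measurable_itv].
by apply/seteqP; split => y; rewrite /truncation /= in_itv /= andbT.
Qed.

(** On the removed part the factor [enorm (y - x)]^ beta[is at most]e [^ beta], and the remaining
    weight has integral at most [I]. *)
Lemma truncated_Rintegral_cvg x (f : 'rV[R]_d -> R) A :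
  S x -> 0 <= A -> measurable_fun (S : set (surface_space R d)) f ->
  (forall y, S y -> `|f y| <= A * (enorm (y - x) `^ beta * w x y)) ->
  mu.-integrable (S : set (surface_space R d)) (EFin \o f) ->
  Rintegral mu (truncation S x e) f @[e --> 0^'+] --> \int[mu]_(y in S) f y.
Proof.
move=> Sx A0 mf fA fi.
have key e : 0 < e ->
    `|\int[mu]_(y in S) f y - Rintegral mu (truncation S x e) f| <= A * e `^ beta * I.
  move=> e0; pose N := S `&` [set y | `]-oo, e]%classic (enorm (y - x))].
  have mN : measurable (N : set (surface_space R d)).
    by apply: measurable_annulus; [exact: mS|exact: measurable_itv].
  have ST : S = truncation S x e `|` N.
    apply/seteqP; split => [y Sy|y [[]|[]]] //.
    by have [h|h] := ltP e (enorm (y - x)); [left|right; split=> //=; rewrite in_itv].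
  have NS : N `<=` S by move=> y [].
  have -> : \int[mu]_(y in S) f y = \int[mu]_(y in truncation S x e) f y + \int[mu]_(y in N) f y.
    rewrite {1}ST; apply: Rintegral_setU.
    - exact: truncation_measurable.
    - exact: mN.
    - by rewrite -ST; exact: fi.
    - apply/disj_set2P; rewrite -subset0 => y [[_ h1] [_ /=]].
      by rewrite in_itv /= leNgt h1.
  rewrite addrC addKr.
  have [|||_] := @weakly_singular_integrable x f (A * e `^ beta) N Sx _ mN NS.
  - by rewrite mulr_ge0 ?powR_ge0.
  - exact: (measurable_funS mS NS mf).
  - move=> y [Sy /=]; rewrite in_itv /= => ye; apply: le_trans (fA y Sy) _.
    rewrite mulrA ler_wpM2r ?weight_ge0 // ler_wpM2l //.
    by apply: ge0_ler_powR; rewrite ?nnegrE ?enorm_ge0 // ltW.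
  - exact.
apply/cvgrPdist_le => /= eta eta0.
have : A * e `^ beta * I @[e --> 0^'+] --> A * 0 * I.
  by apply: cvgMr_tmp; apply: cvgMl_tmp; exact: powR_cvg0.
rewrite mulr0 mul0r => /cvgrPdist_le/(_ eta eta0); apply: filterS2; last exact: nbhs_right_gt.
move=> e e0; rewrite sub0r normrN => h; rewrite (le_trans (key e e0)) //.
by rewrite (le_trans (ler_norm _)).
Qed.

(** With [m = d - 1] and [eps = 1 - beta] the first bound is [A r^(2-d)]. The second is a Hölder
    condition in [x] whose constant may blow up in [y], but stays integrable. *)
Definition weakly_singular_kernel (K : 'rV[R]_d -> 'rV[R]_d -> R) :=
  (forall x, S x -> measurable_fun (S : set (surface_space R d)) (K x)) /\
  exists2 A : R, 0 <= A &
    (forall x y, S x -> S y -> `|K x y| <= A * (enorm (y - x) `^ beta * w x y)) /\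
    (forall x x' y, S x -> S x' -> S y ->
      `|K x y - K x' y| <= A * enorm (x - x') `^ beta * (w x y + w x' y)).

Definition kernel_op (K : 'rV[R]_d -> 'rV[R]_d -> R) (u : 'rV[R]_d -> R) x : R :=
  \int[mu]_(y in S) (K x y * u y).


Lemma kernel_op_bounds K M : 0 <= M ->
  (forall x y, S x -> S y -> enorm (x - y) <= M) ->
  weakly_singular_kernel K ->
  exists2 C : R, 0 <= C & forall (u : 'rV[R]_d -> R) (B : R), 0 <= B ->
    measurable_fun (S : set (surface_space R d)) u ->
    (forall y, S y -> `|u y| <= B) ->
    (forall x, S x ->
      [/\ mu.-integrable (S : set (surface_space R d)) (EFin \o (fun y => K x y * u y)),
          `|kernel_op K u x| <= C * B &
          Rintegral mu (truncation S x e) (fun y => K x y * u y) @[e --> 0^'+]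
            --> kernel_op K u x]) /\
    (forall x x', S x -> S x' ->
      `|kernel_op K u x - kernel_op K u x'| <= C * B * enorm (x - x') `^ beta).
Proof.
move=> M0 SM [mK [A A0 [KA KL]]].
(* The first summand bounds the values, as [r^beta <= M^beta]; the second is the Hölder constant, as
   the two weights together integrate to at most [2 * I]. *)
exists (A * M `^ beta * I + 2 * A * I).
  by rewrite addr_ge0 ?mulr_ge0 ?powR_ge0.
move=> u B B0 mu_ uB.
have mKu x : S x -> measurable_fun (S : set (surface_space R d)) (fun y => K x y * u y).
  by move=> Sx; apply: measurable_funM => //; exact: mK.
have c1 : 0 <= A * M `^ beta * I by rewrite !mulr_ge0 ?powR_ge0.
have c2 : 0 <= 2 * A * I by rewrite !mulr_ge0.
have bnd x : S x -> mu.-integrable (S : set (surface_space R d)) (EFin \o (fun y => K x y * u y))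
     /\ `|kernel_op K u x| <= A * M `^ beta * B * I.
  move=> Sx; apply: (weakly_singular_integrable Sx _ mS).
  - by rewrite !mulr_ge0 ?powR_ge0.
  - exact: subset_refl.
  - exact: mKu.
  - move=> y Sy; rewrite normrM mulrAC ler_pM ?uB //.
    rewrite (le_trans (KA x y Sx Sy)) // mulrA ler_wpM2r ?weight_ge0 // ler_wpM2l //.
    by apply: ge0_ler_powR; rewrite ?nnegrE ?enorm_ge0 ?SM // ltW.
split=> [x Sx|x x' Sx Sx'].
  have [i b] := bnd x Sx; split; first exact: i.
    by rewrite (le_trans b) // mulrAC ler_wpM2r // lerDl.
  apply: (@truncated_Rintegral_cvg x _ (A * B)); last exact: i.
  - exact: Sx.
  - by rewrite mulr_ge0.
  - exact: mKu.
  - by move=> y Sy; rewrite normrM mulrAC ler_pM ?uB // KA.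
have [ix _] := bnd x Sx; have [ix' _] := bnd x' Sx'.
have [iw wI] := integrable_weight Sx mS (@subset_refl _ _).
have [iw' wI'] := integrable_weight Sx' mS (@subset_refl _ _).
pose D := A * enorm (x - x') `^ beta * B.
have D0 : 0 <= D by rewrite !mulr_ge0 ?powR_ge0.
have iww : mu.-integrable (S : set (surface_space R d)) (EFin \o (fun y => w x y + w x' y)).
  exact: (integrableD mS iw iw').
rewrite /kernel_op -(RintegralB mS ix ix').
have [||||_ b] := @Rintegral_dominated (fun y => K x y * u y - K x' y * u y)
    (fun y => D * (w x y + w x' y)) (D * (I + I)) S mS.
- by apply: measurable_funB; exact: mKu.
- exact: (integrableZl mS D iww).
- rewrite (RintegralZl _ mS iww) ler_wpM2l // (RintegralD mS iw iw') lerD //.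
- move=> y Sy; rewrite -mulrBl normrM /D mulrAC ler_pM ?uB // KL //.
apply: le_trans b _; rewrite /D.
rewrite [leRHS](_ : _ = (A * M `^ beta * I) * B * enorm (x - x') `^ beta
  + (2 * A * I) * B * enorm (x - x') `^ beta); last by ring.
rewrite (_ : _ * (I + I) = (2 * A * I) * B * enorm (x - x') `^ beta); last by ring.
by rewrite lerDr !mulr_ge0 ?powR_ge0.
Qed.

End integral_operator.

(** * The normal derivative of a radial function as a weakly singular kernel *)

Section normal_kernel.
Context {R : realType} {d : nat}.

Lemma holder_measurable (D : set (surface_space R d)) (f : 'rV[R]_d -> R) (L alpha : R) :
  measurable D -> 0 < alpha ->
  (forall y z, D y -> D z -> `|f y - f z| <= L * enorm (y - z) `^ alpha) ->
  measurable_fun D f.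
Proof.
move=> mD alpha0 fL; apply: continuous_surface_measurable; first exact: mD.
apply/subspace_continuousP => y Dy; apply/cvgrPdist_lt => e e0.
pose L1 := `|L| + 1; have L10 : 0 < L1 by rewrite ltr_wpDl.
pose r := (e / L1) `^ alpha^-1.
have r0 : 0 < r by rewrite powR_gt0 // divr_gt0.
have := eball_nbhs y r0; rewrite /within /=; apply: filterS => z zy Dz.
apply: le_lt_trans (fL y z Dy Dz) _.
have h : enorm (y - z) `^ alpha < e / L1.
  have -> : e / L1 = r `^ alpha.
    by rewrite /r -powRrM mulVf ?gt_eqF // powRr1 // divr_ge0 // ltW.
  by apply: gt0_ltr_powR; rewrite ?nnegrE ?enorm_ge0 ?(ltW r0) // enorm_distC.
apply: (@le_lt_trans _ _ (L1 * enorm (y - z) `^ alpha)).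
  by rewrite ler_wpM2r ?powR_ge0 // /L1 ler_wpDr // ler_norm.
by rewrite mulrC -ltr_pdivlMr.
Qed.

(* The class of the functions u(r) = r^(d-1) f'(r), f being a radial kernel. *)
Definition lipschitz_near0 (u : R -> R) := forall M : R, 0 < M ->
  exists2 L : R, 0 <= L & forall r s, 0 < r <= M -> 0 < s <= M ->
    `|u r| <= L /\ `|u r - u s| <= L * `|r - s|.

(* At y = x this is 0, as dotp (n x) 0 = 0. *)
Definition normal_kernel (n : 'rV[R]_d -> 'rV[R]_d) (u : R -> R) (x y : 'rV[R]_d) : R :=
  u (enorm (x - y)) / enorm (x - y) ^+ d * dotp (n x) (x - y).

(** Bernoulli's inequality, used with [t = r / s] to compare [r^-d] and [s^-d]. *)
Lemma bernoulli_le (t : R) k : 0 <= t <= 1 -> 1 - t ^+ k <= k%:R * (1 - t).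
Proof.
move=> /andP[t0 t1]; elim: k => [|k IH]; first by rewrite expr0 subrr mul0r.
rewrite exprS -natr1 mulrDl mul1r.
have -> : 1 - t * t ^+ k = t * (1 - t ^+ k) + (1 - t) by ring.
rewrite lerD2r (le_trans _ IH) // ler_piMl // subr_ge0 exprn_ile1 //.
Qed.

(** The trade that turns the Lipschitz gain [|x - x'|] into [|x - x'|^beta] times a power of [r]. *)
Lemma le_powRM (a r b : R) : 0 <= a <= r -> 0 <= b <= 1 -> a <= a `^ b * r `^ (1 - b).
Proof.
move=> /andP[a0 ar] /andP[b0 b1]; have [->|aN0] := eqVneq a 0.
  by rewrite mulr_ge0 ?powR_ge0.
have E : a = a `^ b * a `^ (1 - b).
  by rewrite -powRD ?aN0 ?implybT // addrC subrK powRr1.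
rewrite {1}E; apply: ler_wpM2l; first exact: powR_ge0.
by apply: ge0_ler_powR; rewrite ?nnegrE ?subr_ge0 // (le_trans a0).
Qed.

Section normal_kernel_bounds.
Context (S : set 'rV[R]_d) (n : 'rV[R]_d -> 'rV[R]_d) (C M beta : R) (u : R -> R).
Context (mS : measurable (S : set (surface_space R d))).
Context (d1 : (1 < d)%N).
Context (C0 : 0 < C).
Context (M0 : 0 < M).
Context (SM : forall x y, S x -> S y -> enorm (x - y) <= M).
Context (nC : forall x y, S x -> S y ->
    `|dotp (n x) (x - y)| <= C * enorm (x - y) ^+ 2 /\
    enorm (n x - n y) <= C * enorm (x - y)).
Context (beta01 : 0 < beta < 1).
Context (uL : lipschitz_near0 u).

Let m := d.-1.
Let w (r : R) := r `^ (1 - beta - m%:R).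

Let dm : d = m.+1. Proof. by rewrite /m prednK // ltnW. Qed.

Lemma powR_weight r : 0 < r -> r `^ beta * w r = r / r ^+ m.
Proof.
move=> r0; rewrite /w -powRD ?(gt_eqF r0) ?implybT //.
have -> : beta + (1 - beta - m%:R) = 1 - m%:R :> R by ring.
by rewrite powRB ?(gt_eqF r0) ?implybT // powRr1 ?powR_mulrn // ltW.
Qed.

Lemma weightE (x y : 'rV[R]_d) : weight m (1 - beta) x y = w (enorm (x - y)).
Proof. by rewrite /weight enorm_distC. Qed.

Lemma enorm_gt0 (x y : 'rV[R]_d) : x != y -> 0 < enorm (x - y).
Proof.
move=> xy; rewrite lt0r enorm_ge0 andbT; apply: contra xy => /eqP/enorm_eq0/eqP.
by rewrite subr_eq0.
Qed.

Lemma normal_kernel_le L x y :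
  (forall r, 0 < r <= M -> `|u r| <= L) -> S x -> S y ->
  `|normal_kernel n u x y| <= L * C * (enorm (x - y) `^ beta * w (enorm (x - y))).
Proof.
move=> uB Sx Sy; have [->|xy] := eqVneq x y.
  rewrite /normal_kernel subrr dotp0r mulr0 normr0 enorm0 powR0 ?mul0r ?mulr0 //.
  by case/andP: beta01 => /gt_eqF ->.
have r0 := enorm_gt0 xy; rewrite powR_weight // /normal_kernel.
set r := enorm _ in r0 *; have rM : 0 < r <= M by rewrite r0 SM.
have [h _] := nC Sx Sy; rewrite !normrM normfV [`|r ^+ d|]ger0_norm ?exprn_ge0 ?(ltW r0) //.
have -> : L * C * (r / r ^+ m) = L / r ^+ d * (C * r ^+ 2).
  by rewrite [in r ^+ d]dm exprS; field; rewrite !gt_eqF ?exprn_gt0.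
have i0 : 0 <= (r ^+ d)^-1 by rewrite invr_ge0 exprn_ge0 // ltW.
by apply: ler_pM; rewrite ?mulr_ge0 // ler_wpM2r // uB.
Qed.

(** Far from [y] the distances [r] and [s] satisfy [r <= s <= 3 r / 2]. The difference is split into
    the change [T1] of the radial factor, multiplied by a product of order [s^2], and the change
    [T2] of the product, of order [|x - x'| r]. *)
Lemma normal_kernel_far L x x' y :
  (forall r s, 0 < r <= M -> 0 < s <= M -> `|u r| <= L /\ `|u r - u s| <= L * `|r - s|) ->
  0 <= L -> S x -> S x' -> S y -> x != y ->
  enorm (x - y) <= enorm (x' - y) -> 2 * enorm (x - x') <= enorm (x - y) ->
  `|normal_kernel n u x y - normal_kernel n u x' y| <=
    2 * L * C * (M + d%:R + 1) * (enorm (x - x') / enorm (x - y) ^+ m).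
Proof.
move=> uLM L0 Sx Sx' Sy xy; rewrite /normal_kernel.
have := enorm_gt0 xy; have := enorm_triangle x x' y; rewrite (enorm_distC x' x).
have := SM Sx Sy; have := SM Sx' Sy.
have [N1 _] := nC Sx' Sy; have [N2 _] := nC Sx Sx'; have [_ N3] := nC Sx Sx'.
set p := dotp (n x) _; set p' := dotp (n x') _ in N1 *.
(* The last term is again a normal against a chord, hence quadratic in [dl]; being at most
   [C dl r / 2], it is of the same order as the first. *)
have pE : p - p' = dotp (n x - n x') (x' - y) + dotp (n x) (x - x').
  by rewrite /p /p' dotpBl !dotpBr; ring.
have := le_trans (dotp_le_enorm (n x - n x') (x' - y)) (ler_wpM2r (enorm_ge0 _) N3).
set dl := enorm (x - x') in N2 N3 *; set r := enorm (x - y).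
have dl0 : 0 <= dl by exact: enorm_ge0.
set s := enorm (x' - y) in N1 *.
move=> N4 sM rM srd r0 rs dr.
have s0 : 0 < s := lt_le_trans r0 rs.
have [uB _] := uLM r s (introT andP (conj r0 rM)) (introT andP (conj s0 sM)).
have [uB' _] := uLM s r (introT andP (conj s0 sM)) (introT andP (conj r0 rM)).
have [_ uD] := uLM r s (introT andP (conj r0 rM)) (introT andP (conj s0 sM)).
have rd0 : 0 < r ^+ d by rewrite exprn_gt0.
have sd0 : 0 < s ^+ d by rewrite exprn_gt0.
have T1 : `|u r / r ^+ d - u s / s ^+ d| <= L * dl * (1 + d%:R / s) / r ^+ d.
  have -> : u r / r ^+ d - u s / s ^+ d =
     ((u r - u s) + u s * (1 - (r / s) ^+ d)) / r ^+ d.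
    by rewrite expr_div_n; field; rewrite !gt_eqF.
  rewrite normrM normfV (gtr0_norm rd0) ler_wpM2r ?invr_ge0 ?(ltW rd0) //.
  rewrite (le_trans (ler_normD _ _)) // [leRHS]mulrDr [X in _ <= X + _]mulr1 lerD //.
    rewrite (le_trans uD) // ler_wpM2l // distrC ger0_norm ?subr_ge0 //.
    by rewrite lerBlDl (le_trans srd) // addrC.
  have rs1 : 0 <= r / s <= 1 by rewrite divr_ge0 ?(ltW r0) ?(ltW s0) //= ler_pdivrMr // mul1r.
  rewrite normrM -mulrA ler_pM // ger0_norm; last first.
    by case/andP: rs1 => h1 h2; rewrite subr_ge0 exprn_ile1.
  rewrite (le_trans (bernoulli_le _ rs1)) //.
  rewrite mulrCA ler_wpM2l ?ler0n //.
  have -> : 1 - r / s = (s - r) / s by field; rewrite gt_eqF.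
  by rewrite ler_wpM2r ?invr_ge0 ?(ltW s0) // lerBlDr.
have T2 : `|p - p'| <= 2 * C * dl * r.
  rewrite pE (le_trans (ler_normD _ _)) //.
  have h1 : C * dl * s <= C * dl * (3 / 2 * r).
    by rewrite ler_wpM2l ?mulr_ge0 ?(ltW C0) //; lra.
  have h2 : C * dl ^+ 2 <= C * dl * (r / 2).
    by rewrite expr2 mulrA ler_wpM2l ?mulr_ge0 ?(ltW C0) //; lra.
  by lra.
have -> : u r / r ^+ d * p - u s / s ^+ d * p' =
  (u r / r ^+ d - u s / s ^+ d) * p' + u r / r ^+ d * (p - p') by ring.
rewrite (le_trans (ler_normD _ _)) //.
have B1 : `|(u r / r ^+ d - u s / s ^+ d) * p'| <=
    L * dl * (1 + d%:R / s) / r ^+ d * (C * s ^+ 2).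
  by rewrite normrM ler_pM.
have B2 : `|u r / r ^+ d * (p - p')| <= L / r ^+ d * (2 * C * dl * r).
  by rewrite normrM ler_pM // normrM normfV (gtr0_norm rd0) ler_wpM2r // invr_ge0 ltW.
rewrite (le_trans (lerD B1 B2)) //.
have -> : L * dl * (1 + d%:R / s) / r ^+ d * (C * s ^+ 2) + L / r ^+ d * (2 * C * dl * r)
  = (L * C * dl / r ^+ d) * (s * (s + d%:R) + 2 * r).
  by field; rewrite !gt_eqF.
have -> : 2 * L * C * (M + d%:R + 1) * (dl / r ^+ m) =
   (L * C * dl / r ^+ d) * (2 * r * (M + d%:R) + 2 * r).
  by rewrite [in r ^+ d]dm exprS; field; rewrite !gt_eqF ?exprn_gt0.
rewrite ler_wpM2l //; first by rewrite !mulr_ge0 ?invr_ge0 // ltW.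
rewrite lerD2r ler_pM //; [exact: ltW|by rewrite addr_ge0 // ltW|by lra|by rewrite lerD2r].
Qed.

(** For the difference, let [x] be the point nearer to [y]. If [|x - y| <= 2 |x - x'|], both
    distances to [y] are at most [3 |x - x'|] and the two kernels are bounded separately; otherwise
    [normal_kernel_far] applies. *)
Lemma normal_kernel_weakly_singular :
  weakly_singular_kernel S m beta (1 - beta) (normal_kernel n u).
Proof.
have [b0 b1] := andP beta01.
have [L L0 HL] := uL M0.
have uB r : 0 < r <= M -> `|u r| <= L by move=> rM; have [] := HL r r rM rM.
split.
  move=> x Sx.
  (* [u] is controlled on positive radii, so measurability is proved off [x], and the singleton is
     added afterwards. *)
  pose D := S `&` [set y | `]0, +oo[%classic (enorm (y - x))].
  have mD : measurable (D : set (surface_space R d)).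
    by apply: measurable_annulus; [exact: mS|exact: measurable_itv].
  have mx : measurable ([set x] : set (surface_space R d)).
    rewrite (_ : [set x] = setT `&` [set y | [set 0] (enorm (y - x))]).
      by apply: measurable_annulus; [exact: measurableT|exact: measurable_set1].
    apply/seteqP; split => y /=; first by move=> ->; rewrite subrr enorm0.
    by move=> [_ /enorm_eq0/eqP]; rewrite subr_eq0 => /eqP.
  have DS : D `<=` S by move=> y [].
  have -> : S = D `|` [set x].
    apply/seteqP; split=> [y Sy|y [[]|->]] //.
    have [->|yx] := eqVneq y x; first by right.
    by left; split=> //=; rewrite in_itv /= andbT enorm_gt0.
  apply/(measurable_funU _ mD mx); split; last exact: measurable_fun_set1.
  apply: measurable_funM; first apply: measurable_funM.
  - apply: (@holder_measurable D _ L 1 mD ltr01) => y z [Sy /=] + [Sz /=].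
    rewrite !in_itv /= !andbT -!(enorm_distC x) => ry rz; rewrite powRr1 ?enorm_ge0 //.
    have [|_ h] := HL (enorm (x - y)) (enorm (x - z)) _ (introT andP (conj rz (SM Sx Sz))).
      by rewrite ry SM.
    rewrite (le_trans h) // ler_wpM2l // (le_trans (ler_dist_enorm _ _)) //.
    by rewrite opprB addrC addrA subrK enorm_distC.
  - rewrite (_ : (fun y => (enorm (x - y) ^+ d)^-1) = (fun y => enorm (y - x) `^ (- d%:R))).
      apply: (measurableT_comp (measurable_powR _)).
      by apply: measurable_continuous; [exact: mD|exact: continuous_enormB].
    by apply/funext => y; rewrite powR_invn ?enorm_ge0 // enorm_distC.
  - apply: (@holder_measurable D _ (enorm (n x)) 1 mD ltr01) => y z _ _.
    rewrite powRr1 ?enorm_ge0 // -dotpBr (le_trans (dotp_le_enorm _ _)) //.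
    by rewrite ler_wpM2l ?enorm_ge0 // opprB addrC addrA subrK enorm_distC.
pose A := L * C * 3 + 2 * L * C * (M + d%:R + 1).
have C0' := ltW C0.
have A10 : 0 <= L * C * 3 by rewrite !mulr_ge0.
have A20 : 0 <= 2 * L * C * (M + d%:R + 1).
  by rewrite !mulr_ge0 // !addr_ge0 // ltW.
exists A; first by rewrite addr_ge0.
split=> [x y Sx Sy|x x' y Sx Sx' Sy].
  rewrite weightE enorm_distC (le_trans (normal_kernel_le uB Sx Sy)) //.
  rewrite ler_wpM2r ?mulr_ge0 ?powR_ge0 // /A.
  have : 0 <= L * C by rewrite mulr_ge0.
  lra.
rewrite !weightE.
wlog rs : x x' Sx Sx' / enorm (x - y) <= enorm (x' - y) => [H|].
  have [rs|/ltW sr] := leP (enorm (x - y)) (enorm (x' - y)); first exact: H.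
  by rewrite distrC (enorm_distC x) [w _ + _]addrC; apply: H.
set dl := enorm (x - x').
have dl0 : 0 <= dl by exact: enorm_ge0.
have w0 r : 0 <= w r by exact: powR_ge0.
have tri := enorm_triangle x x' y; rewrite (enorm_distC x' x) -/dl in tri.
have near_case : enorm (x - y) <= 2 * dl -> `|normal_kernel n u x y - normal_kernel n u x' y| <=
    A * dl `^ beta * (w (enorm (x - y)) + w (enorm (x' - y))).
  move=> rdl.
  have P3 r : 0 <= r -> r <= 3 * dl -> r `^ beta <= 3 * dl `^ beta.
    move=> r0 r3; apply: (@le_trans _ _ ((3 * dl) `^ beta)).
      by apply: ge0_ler_powR; rewrite ?nnegrE ?mulr_ge0 // ltW.
    by rewrite powRM // ler_wpM2r ?powR_ge0 // ler1_powR ?ler1n // ltW.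
  rewrite (le_trans (ler_normB _ _)) // mulrDr lerD //.
    apply: le_trans (normal_kernel_le uB Sx Sy) _.
    rewrite mulrA; apply: ler_wpM2r; first exact: w0.
    rewrite (@le_trans _ _ (L * C * (3 * dl `^ beta))) ?ler_wpM2l ?mulr_ge0 ?P3 ?enorm_ge0 //; first by lra.
    by rewrite mulrA ler_wpM2r ?powR_ge0 // /A lerDl.
  apply: le_trans (normal_kernel_le uB Sx' Sy) _.
  rewrite mulrA; apply: ler_wpM2r; first exact: w0.
  rewrite (@le_trans _ _ (L * C * (3 * dl `^ beta))) ?ler_wpM2l ?mulr_ge0 ?P3 ?enorm_ge0 //; first by lra.
  by rewrite mulrA ler_wpM2r ?powR_ge0 // /A lerDl.
have [|far] := leP (enorm (x - y)) (2 * dl); first exact: near_case.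
have xy : x != y.
  by apply: contraTneq far => ->; rewrite subrr enorm0 -leNgt mulr_ge0.
have r0 := enorm_gt0 xy.
rewrite (le_trans (normal_kernel_far HL L0 Sx Sx' Sy xy rs (ltW far))) // -/dl.
set r := enorm (x - y) in r0 far *.
apply: (@le_trans _ _ (2 * L * C * (M + d%:R + 1) * (dl `^ beta * w r))).
  rewrite ler_wpM2l // /w powRB ?(gt_eqF r0) ?implybT // powR_mulrn ?(ltW r0) //.
  rewrite mulrA ler_wpM2r ?invr_ge0 ?exprn_ge0 ?(ltW r0) //.
  by apply: le_powRM; rewrite ?dl0 ?(ltW b0) ?(ltW b1) //; lra.
rewrite [leRHS]mulrDr -[leLHS]addr0 mulrA lerD ?mulr_ge0 ?powR_ge0 ?addr_ge0 //.
by rewrite ler_wpM2r // ler_wpM2r ?powR_ge0 // /A lerDr.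
Qed.

End normal_kernel_bounds.
End normal_kernel.

(** * Radial derivatives of the fundamental solutions *)

Section lipschitz_class.
Context {R : realType}.
Implicit Types (u v g : R -> R).

Lemma lipschitz_near0_cst c : lipschitz_near0 (fun=> c : R).
Proof.
by move=> M M0; exists `|c| => // r s _ _; rewrite lexx subrr normr0 mulr_ge0.
Qed.

Lemma lipschitz_near0_id : lipschitz_near0 (@id R).
Proof.
move=> M M0; exists (1 + M); first by rewrite addr_ge0 // ltW.
move=> r s /andP[r0 rM] _; split; first by rewrite gtr0_norm // ler_wpDl.
by rewrite ler_peMl // lerDl ltW.
Qed.

Lemma lipschitz_near0D u v : lipschitz_near0 u -> lipschitz_near0 v ->
  lipschitz_near0 (fun r => u r + v r).
Proof.
move=> hu hv M M0; have [L L0 HL] := hu M M0; have [K K0 HK] := hv M M0.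
exists (L + K); first exact: addr_ge0.
move=> r s rM sM; have [u1 u2] := HL r s rM sM; have [v1 v2] := HK r s rM sM.
split; first by rewrite (le_trans (ler_normD _ _)) // lerD.
rewrite (_ : _ - _ = (u r - u s) + (v r - v s)); last by ring.
by rewrite (le_trans (ler_normD _ _)) // mulrDl lerD.
Qed.

Lemma lipschitz_near0M u v : lipschitz_near0 u -> lipschitz_near0 v ->
  lipschitz_near0 (fun r => u r * v r).
Proof.
move=> hu hv M M0; have [L L0 HL] := hu M M0; have [K K0 HK] := hv M M0.
exists (L * K + (L * K + L * K)); first by rewrite !addr_ge0 ?mulr_ge0.
move=> r s rM sM; have [u1 u2] := HL r s rM sM; have [v1 v2] := HK r s rM sM.
have [u3 _] := HL s r sM rM; have [v3 _] := HK s r sM rM.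
split.
  rewrite normrM (le_trans (ler_pM _ _ u1 v1)) // lerDl addr_ge0 ?mulr_ge0 //.
rewrite (_ : _ - _ = (u r - u s) * v r + u s * (v r - v s)); last by ring.
rewrite (le_trans (ler_normD _ _)) // !normrM.
have h1 : `|u r - u s| * `|v r| <= L * K * `|r - s| by rewrite mulrAC ler_pM.
have h2 : `|u s| * `|v r - v s| <= L * K * `|r - s| by rewrite -mulrA ler_pM.
rewrite (le_trans (lerD h1 h2)) // -mulrDl ler_wpM2r // lerDr mulr_ge0 //.
Qed.

Lemma lipschitz_near0Z c u : lipschitz_near0 u -> lipschitz_near0 (fun r => c * u r).
Proof. exact: (lipschitz_near0M (lipschitz_near0_cst c)). Qed.

Lemma bounded_derivative_lipschitz_near0 u du :
  (forall r : R, 0 < r -> is_derive r 1 u (du r)) ->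
  (forall M : R, 0 < M -> exists B, forall r, 0 < r <= M -> `|du r| <= B) ->
  lipschitz_near0 u.
Proof.
move=> udu duB M M0; have [B HB] := duB M M0.
have B0 : 0 <= B by rewrite (le_trans (normr_ge0 (du M))) // HB // M0 lexx.
have lip r s : 0 < r <= M -> 0 < s <= M -> `|u r - u s| <= B * `|r - s|.
  move=> /andP[r0 rM] /andP[s0 sM].
  have [||c [/andP[c0 cM] _ ->]] := @mvt_abs R u du (fun x => 0 < x <= M) s r.
  - move=> x; rewrite !ler_norml => /andP[h1 h2] /andP[h3 h4].
    have [rs|sr] := leP s r.
      by move: h1 h2 h3 h4; rewrite !ger0_norm ?subr_ge0 // => *; lra.
    by move: h1 h2 h3 h4; rewrite !ltr0_norm ?subr_lt0 // => *; lra.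
  - by move=> x /andP[x0 _]; exact: udu.
  - by rewrite normrM ler_wpM2r // HB // c0.
(* Values are compared with the one at [M], which is at distance at most [M] from every point of
   []0, M]]. *)
exists (B + (`|u M| + B * M)); first by rewrite !addr_ge0 ?mulr_ge0 // ltW.
move=> r s rM sM; split; last first.
  rewrite (le_trans (lip r s rM sM)) // ler_wpM2r // lerDl addr_ge0 ?mulr_ge0 // ltW //.
have MM : 0 < M <= M by rewrite M0 lexx.
have h := lip r M rM MM; have h2 := lerB_dist (u r) (u M).
have : B * `|r - M| <= B * M.
  rewrite ler_wpM2l // distrC; case/andP: rM => r0 rM.
  by rewrite ger0_norm ?subr_ge0 //; lra.
lra.
Qed.

Lemma C2_lipschitz_near0 g g1 g2 :
  (forall x : R, is_derive x 1 g (g1 x)) -> (forall x : R, is_derive x 1 g1 (g2 x)) ->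
  lipschitz_near0 g.
Proof.
move=> dg dg1; apply: (@bounded_derivative_lipschitz_near0 _ g1) => // M M0.
have cg1 : continuous (fun x => `|g1 x|).
  move=> x; apply: (@continuous_comp _ _ _ g1 Num.norm); last exact: norm_continuous.
  exact: (is_derive_continuous (dg1 x)).
have [c _ Hc] := EVT_max (ltW M0) (continuous_subspaceT (cg1 : continuous (_ : R -> R))).
by exists `|g1 c| => r /andP[r0 rM]; apply: Hc; rewrite in_itv /= (ltW r0).
Qed.

(** The derivative [2 r ln r + r] is bounded on []0, M]], because [ln t < t] at [t = r] and
    [t = 1 / r] yields [-1 <= r ln r <= r^2]. *)
Lemma lipschitz_near0_sqr_ln : lipschitz_near0 (fun r : R => r ^+ 2 * ln r).
Proof.
apply: (@bounded_derivative_lipschitz_near0 _ (fun r => 2 * (r * ln r) + r)).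
  move=> r r0.
  have d1 : is_derive r 1 (fun r : R => r ^+ 2) (2 * r).
    apply: is_derive_eq (is_deriveM (@is_derive_id R R r 1) (@is_derive_id R R r 1)) _.
    by rewrite /GRing.scale /=; ring.
  apply: (is_derive_eq (is_deriveM d1 (is_derive1_ln r0))).
  by rewrite /= /GRing.scale /=; field; rewrite gt_eqF.
move=> M M0; exists (2 * (1 + M ^+ 2) + M) => r /andP[r0 rM].
have h1 : r * ln r <= r * r.
  by rewrite ler_wpM2l ?(ltW r0) // (ltW (ln_sublinear r0)).
have h2 : -1 <= r * ln r.
  have ri : 0 < r^-1 by rewrite invr_gt0.
  have := ln_sublinear ri; rewrite lnV ?posrE // => /ltW h.
  have := ler_wpM2l (ltW r0) h; rewrite mulfV ?gt_eqF // mulrN; lra.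
have h3 : r * r <= M ^+ 2 by rewrite expr2 ler_pM // ltW.
rewrite (le_trans (ler_normD _ _)) // normrM (gtr0_norm r0) [`|2|]ger0_norm // lerD // ler_wpM2l //.
have M2 : 0 <= M ^+ 2 by exact: sqr_ge0.
by rewrite ler_norml; apply/andP; split; lra.
Qed.

End lipschitz_class.

Local Open Scope complex_scope.

(** * Entire power series *)

Section entire_series.
Context {R : realType}.
Implicit Types (alpha : nat -> R).

(** Domination by an exponential series: it forces convergence everywhere and is inherited by the
    differentiated series. *)
Definition entire_coef alpha := exists M c : R, [/\ 0 <= M, 0 <= c &
  forall j, `|alpha j| <= M * (c ^+ j / j`!%:R)].

Definition entire_sum alpha (x : R) : R := limn (pseries alpha x).

Lemma entire_diffs alpha : entire_coef alpha -> entire_coef (pseries_diffs alpha).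
Proof.
move=> [M [c [M0 c0 H]]]; exists (M * c), c; split=> // [|j]; first exact: mulr_ge0.
rewrite /pseries_diffs normrM [`|_.+1%:R|]ger0_norm ?ler0n //.
rewrite (le_trans (ler_wpM2l _ (H j.+1))) // factS natrM exprS.
rewrite le_eqVlt; apply/orP; left; apply/eqP; field.
by rewrite pnatr_eq0 -lt0n fact_gt0 /= addrC natr1 pnatr_eq0.
Qed.

Lemma entire_cvg alpha (x : R) : entire_coef alpha -> cvgn (pseries alpha x).
Proof.
move=> [M [c [M0 c0 H]]]; apply: normed_cvg.
have := is_cvg_series_exp_coeff (c * `|x|) => /(@is_cvg_seriesZ _ _ M).
apply: series_le_cvg => [n|n|n] //=.
  by rewrite mulr_ge0 // /exp_coeff /= divr_ge0 // exprn_ge0 // mulr_ge0.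
apply: (@le_trans _ _ (M * ((c * `|x|) ^+ n / n`!%:R))); last exact: lexx.
rewrite normrM normrX exprMn mulrAC mulrA.
by rewrite ler_wpM2r ?exprn_ge0 // H.
Qed.

Lemma entire_is_derive alpha (x : R) : entire_coef alpha ->
  is_derive x 1 (entire_sum alpha) (entire_sum (pseries_diffs alpha) x).
Proof.
move=> ea; apply: (@pseries_snd_diffs R alpha (`|x| + 1) x).
- exact: entire_cvg.
- by apply: entire_cvg; exact: entire_diffs.
- by apply: entire_cvg; exact: entire_diffs (entire_diffs ea).
- by rewrite [ltRHS]ger0_norm ?addr_ge0 // ltrDl.
Qed.

Lemma is_derive_sqr (x : R) : is_derive x 1 (fun r : R => r ^+ 2) (2 * x).
Proof.
apply: is_derive_eq (is_deriveM (@is_derive_id R R x 1) (@is_derive_id R R x 1)) _.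
by rewrite /GRing.scale /=; ring.
Qed.

Lemma is_derive_entire_sqr alpha (x : R) : entire_coef alpha ->
  is_derive x 1 (fun r => entire_sum alpha (r ^+ 2))
    (entire_sum (pseries_diffs alpha) (x ^+ 2) * (2 * x)).
Proof.
move=> ea.
exact: (@is_derive1_comp R (entire_sum alpha) (fun r => r ^+ 2) x _ _
  (entire_is_derive (x ^+ 2) ea) (is_derive_sqr x)).
Qed.

Lemma entire_lipschitz_near0 alpha : entire_coef alpha ->
  lipschitz_near0 (fun r => entire_sum alpha (r ^+ 2)).
Proof.
move=> ea.
have d2 (x : R) : is_derive x 1 (fun r : R => 2 * r) 2.
  by apply: is_derive_eq (is_deriveZ 2 (@is_derive_id R R x 1)) _; rewrite /GRing.scale /= mulr1.
apply: (C2_lipschitz_near0 (fun x => is_derive_entire_sqr x ea)) => x.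
exact: (is_deriveM (is_derive_entire_sqr x (entire_diffs ea)) (d2 x)).
Qed.

End entire_series.

(** * Radial kernels in dimensions two and three *)

Section radial_kernels.
Context {R : realType}.
Implicit Types (f g : R -> R) (G : R -> R[i]).

Definition radial_kernel (d : nat) f :=
  exists2 u, lipschitz_near0 u &
    forall r : R, 0 < r -> is_derive r 1 f (u r / r ^+ d.-1).

Lemma radial_kernel_ext d f g : (forall r, 0 < r -> f r = g r) ->
  radial_kernel d f -> radial_kernel d g.
Proof.
move=> fg [u uL fu]; exists u => // r r0; apply: near_eq_is_derive (fu r r0).
near=> s; apply: fg; near: s; exact: lt_nbhsr.
Unshelve. all: by end_near. Qed.

Lemma radial_kernelD d f g : radial_kernel d f -> radial_kernel d g ->
  radial_kernel d (fun r => f r + g r).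
Proof.
move=> [u uL fu] [v vL gv]; exists (fun r => u r + v r); first exact: lipschitz_near0D.
by move=> r r0; rewrite mulrDl; exact: (is_deriveD (fu r r0) (gv r r0)).
Qed.

Lemma radial_kernelZ d c f : radial_kernel d f -> radial_kernel d (fun r => c * f r).
Proof.
move=> [u uL fu]; exists (fun r => c * u r); first exact: lipschitz_near0Z.
by move=> r r0; rewrite -mulrA; exact: (is_deriveZ c (fu r r0)).
Qed.

Lemma radial_kernel_entire alpha : entire_coef alpha ->
  radial_kernel 2 (fun r => entire_sum alpha (r ^+ 2)).
Proof.
move=> ea; exists (fun r => 2 * (r * (r * entire_sum (pseries_diffs alpha) (r ^+ 2)))).
  apply: lipschitz_near0Z; apply: (lipschitz_near0M lipschitz_near0_id).
  apply: (lipschitz_near0M lipschitz_near0_id).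
  by apply: entire_lipschitz_near0; exact: entire_diffs.
move=> r r0; apply: is_derive_eq (is_derive_entire_sqr r ea) _.
by rewrite expr1; field; rewrite gt_eqF.
Qed.

Lemma radial_kernel_ln_entire alpha : entire_coef alpha ->
  radial_kernel 2 (fun r => ln r * entire_sum alpha (r ^+ 2)).
Proof.
move=> ea; exists (fun r => entire_sum alpha (r ^+ 2) +
    2 * ((r ^+ 2 * ln r) * entire_sum (pseries_diffs alpha) (r ^+ 2))).
  apply: lipschitz_near0D; first exact: entire_lipschitz_near0.
  apply: lipschitz_near0Z; apply: (lipschitz_near0M lipschitz_near0_sqr_ln).
  by apply: entire_lipschitz_near0; exact: entire_diffs.
move=> r r0; apply: is_derive_eq (is_deriveM (is_derive1_ln r0) (is_derive_entire_sqr r ea)) _.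
by rewrite expr1 /GRing.scale /=; field; rewrite gt_eqF.
Qed.

(* (p, q) = (1, 0) and (0, 1) give the real and imaginary parts of
   exp ((b + i a) r). *)
Definition damped_wave (a b p q r : R) : R :=
  expR (b * r) * (p * cos (a * r) + q * sin (a * r)).

Lemma is_derive_damped_wave (a b p q r : R) : is_derive r 1 (damped_wave a b p q)
  (damped_wave a b (b * p + a * q) (b * q - a * p) r).
Proof.
have lin c : is_derive r 1 (fun x : R => c * x) c.
  by apply: is_derive_eq (is_deriveZ c (@is_derive_id R R r 1)) _; rewrite /GRing.scale /= mulr1.
have de := is_derive1_comp (is_derive_expR (b * r)) (lin b).
have dc := is_derive1_comp (is_derive_cos (a * r)) (lin a).
have ds := is_derive1_comp (is_derive_sin (a * r)) (lin a).
apply: is_derive_eq (is_deriveM de (is_deriveD (is_deriveZ p dc) (is_deriveZ q ds))) _.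
rewrite /damped_wave /GRing.scale /=.
rewrite (_ : (_ + _) r = p * cos (a * r) + q * sin (a * r)) //; ring.
Qed.

Lemma lipschitz_near0_damped_wave a b p q : lipschitz_near0 (damped_wave a b p q).
Proof. exact: C2_lipschitz_near0 (is_derive_damped_wave _ _ _ _) (is_derive_damped_wave _ _ _ _). Qed.

Lemma radial_kernel_damped_wave a b p q :
  radial_kernel 3 (fun r => damped_wave a b p q r / r).
Proof.
exists (fun r => r * damped_wave a b (b * p + a * q) (b * q - a * p) r + (-1) * damped_wave a b p q r).
  apply: lipschitz_near0D.
    by apply: (lipschitz_near0M lipschitz_near0_id); exact: lipschitz_near0_damped_wave.
  by apply: lipschitz_near0Z; exact: lipschitz_near0_damped_wave.
move=> r r0; have r0' : r != 0 by rewrite gt_eqF.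
have dV : is_derive r 1 (fun x : R => x^-1) (- r ^- 2).
  have di : derivable (@id R) r 1 by exact: derivable_id.
  apply: DeriveDef; first exact: derivableV r0' di.
  by rewrite (deriveV r0' di) derive_id /GRing.scale /= mulr1.
apply: is_derive_eq (is_deriveM (is_derive_damped_wave a b p q r) dV) _.
by rewrite /GRing.scale /=; field.
Qed.

End radial_kernels.

Section complex_modulus.
Context {R : realType}.
Implicit Types z : R[i].

Lemma cmodE z : (cmod z)%:C = `|z|.
Proof. by case: z. Qed.

Lemma cmod_ge0 z : 0 <= cmod z.
Proof. by case: z => a b; exact: sqrtr_ge0. Qed.

Lemma cmodM z1 z2 : cmod (z1 * z2) = cmod z1 * cmod z2.
Proof. exact: Normc.normcM. Qed.

Lemma cmodN z : cmod (- z) = cmod z.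
Proof. by case: z => a b; rewrite /cmod /= !sqrrN. Qed.

Lemma cmodD z1 z2 : cmod (z1 + z2) <= cmod z1 + cmod z2.
Proof. by rewrite -lecR rmorphD /= !cmodE ler_normD. Qed.

Lemma cmodR (a : R) : cmod a%:C = `|a|.
Proof. by rewrite /cmod /= expr0n addr0 sqrtr_sqr. Qed.

Lemma cmodX z n : cmod (z ^+ n) = cmod z ^+ n.
Proof.
elim: n => [|n IH]; first by rewrite !expr0 /cmod Normc.normc1.
by rewrite !exprS cmodM IH.
Qed.

Lemma Re_le_cmod z : `|complex.Re z| <= cmod z.
Proof.
case: z => a b; rewrite /cmod /= -sqrtr_sqr ler_wsqrtr // lerDl sqr_ge0 //.
Qed.

Lemma Im_le_cmod z : `|complex.Im z| <= cmod z.
Proof.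
case: z => a b; rewrite /cmod /= -sqrtr_sqr ler_wsqrtr // lerDr sqr_ge0 //.
Qed.

Lemma cmod_le_ReIm z : cmod z <= `|complex.Re z| + `|complex.Im z|.
Proof.
case: z => a b; rewrite /cmod /= -(ler_pXn2r (n := 2)) ?nnegrE ?sqrtr_ge0 ?addr_ge0 //.
rewrite sqr_sqrtr ?addr_ge0 ?sqr_ge0 // sqrrD !real_normK ?num_real //.
by rewrite -[leRHS]addrA lerD2l lerDr mulrn_wge0 // mulr_ge0.
Qed.

Lemma ReM z1 z2 : complex.Re (z1 * z2) =
  complex.Re z1 * complex.Re z2 - complex.Im z1 * complex.Im z2.
Proof. by case: z1 => a b; case: z2. Qed.

Lemma ImM z1 z2 : complex.Im (z1 * z2) =
  complex.Re z1 * complex.Im z2 + complex.Im z1 * complex.Re z2.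
Proof. by case: z1 => a b; case: z2. Qed.

Lemma ReD z1 z2 : complex.Re (z1 + z2) = complex.Re z1 + complex.Re z2.
Proof. by case: z1 => a b; case: z2. Qed.

Lemma ImD z1 z2 : complex.Im (z1 + z2) = complex.Im z1 + complex.Im z2.
Proof. by case: z1 => a b; case: z2. Qed.

Lemma eq_ReIm z1 z2 : complex.Re z1 = complex.Re z2 ->
  complex.Im z1 = complex.Im z2 -> z1 = z2.
Proof. by case: z1 => a b; case: z2 => a' b' /= -> ->. Qed.

End complex_modulus.

(** * Hankel functions as radial kernels *)

Section green_radial.
Context {R : realType}.
Implicit Types (k c : R[i]) (G : R -> R[i]).

Definition complex_radial_kernel d G :=
  radial_kernel d (fun r => complex.Re (G r)) /\
  radial_kernel d (fun r => complex.Im (G r)).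

Lemma complex_radial_kernelD d G1 G2 : complex_radial_kernel d G1 ->
  complex_radial_kernel d G2 -> complex_radial_kernel d (fun r => G1 r + G2 r).
Proof.
move=> [r1 i1] [r2 i2]; split.
  by apply: radial_kernel_ext (radial_kernelD r1 r2) => r _; rewrite ReD.
by apply: radial_kernel_ext (radial_kernelD i1 i2) => r _; rewrite ImD.
Qed.

(** Besides the prefactors of the fundamental solutions, this covers the [P] components, which are
    constant multiples of the [T] components. *)
Lemma complex_radial_kernelZ d c G : complex_radial_kernel d G ->
  complex_radial_kernel d (fun r => c * G r).
Proof.
move=> [r1 i1]; split.
  apply: radial_kernel_ext (radial_kernelD (radial_kernelZ (complex.Re c) r1)
    (radial_kernelZ (- complex.Im c) i1)) => r _.
  by rewrite ReM mulNr.
apply: radial_kernel_ext (radial_kernelD (radial_kernelZ (complex.Re c) i1)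
  (radial_kernelZ (complex.Im c) r1)) => r _.
by rewrite ImM.
Qed.

Lemma complex_radial_kernel_ext d G1 G2 : (forall r, 0 < r -> G1 r = G2 r) ->
  complex_radial_kernel d G1 -> complex_radial_kernel d G2.
Proof.
by move=> e [h1 h2]; split; [move: h1|move: h2]; apply: radial_kernel_ext => r r0; rewrite e.
Qed.

(* h = 1 gives J_0(k r), h = series harmonic the series in Y_0(k r). *)
Definition bessel_series (h : nat -> R) k (r : R) : R[i] :=
  cseries (fun j => (-1) ^+ j * (h j)%:C / (j`!%:R ^+ 2) * (k * r%:C / 2) ^+ (2 * j)).

Definition bessel_coef (h : nat -> R) k (j : nat) : R[i] :=
  (-1) ^+ j * (h j)%:C / (j`!%:R ^+ 2) * (k / 2) ^+ (2 * j).

Lemma bessel_coefE h k (r : R) j :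
  (-1) ^+ j * (h j)%:C / (j`!%:R ^+ 2) * (k * r%:C / 2) ^+ (2 * j) =
  bessel_coef h k j * ((r ^+ 2) ^+ j)%:C.
Proof.
rewrite /bessel_coef -[RHS]mulrA; congr (_ * _).
by rewrite mulrAC exprMn -exprM -rmorphXn.
Qed.

(** One of the two factorials in the denominator absorbs [h j]; the other one leaves an exponential
    series. *)
Lemma bessel_coef_le h k j : 0 <= h j <= j`!%:R ->
  cmod (bessel_coef h k j) <= 1 * ((cmod (k / 2) ^+ 2) ^+ j / j`!%:R).
Proof.
move=> /andP[h0 hj]; have f0 : 0 < j`!%:R :> R by rewrite ltr0n fact_gt0.
have eV : (j`!%:R ^+ 2)^-1 = ((j`!%:R ^+ 2)^-1)%:C :> R[i].
  by rewrite fmorphV rmorphXn rmorph_nat.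
have eN : cmod (-1 : R[i]) = 1.
  by have /(congr1 (@complex.Re R)) := cmodE (-1 : R[i]); rewrite normrN1.
rewrite /bessel_coef eV; set c := cmod (k / 2).
rewrite !cmodM !cmodX eN !cmodR -/c expr1n !mul1r.
rewrite (ger0_norm h0) ger0_norm ?invr_ge0 ?exprn_ge0 ?(ltW f0) // exprM mulrC.
rewrite ler_wpM2l //.
  by rewrite !exprn_ge0 // /c cmod_ge0.
by rewrite ler_pdivrMr ?exprn_gt0 // expr2 mulrA mulVf ?gt_eqF // mul1r.
Qed.

Lemma complex_radial_kernel_bessel h k : (forall j, 0 <= h j <= j`!%:R) ->
  complex_radial_kernel 2 (bessel_series h k) /\
  complex_radial_kernel 2 (fun r => (ln r)%:C * bessel_series h k r).
Proof.
move=> hj.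
have er : entire_coef (fun j => complex.Re (bessel_coef h k j)).
  exists 1, (cmod (k / 2) ^+ 2); split=> // [|j]; first by rewrite exprn_ge0 // cmod_ge0.
  by rewrite (le_trans (Re_le_cmod _)) // bessel_coef_le.
have ei : entire_coef (fun j => complex.Im (bessel_coef h k j)).
  exists 1, (cmod (k / 2) ^+ 2); split=> // [|j]; first by rewrite exprn_ge0 // cmod_ge0.
  by rewrite (le_trans (Im_le_cmod _)) // bessel_coef_le.
have bE r : bessel_series h k r =
    entire_sum (fun j => complex.Re (bessel_coef h k j)) (r ^+ 2) +i*
    entire_sum (fun j => complex.Im (bessel_coef h k j)) (r ^+ 2).
  rewrite /bessel_series /cseries /entire_sum /pseries.
  congr (limn (series _) +i* limn (series _)); apply/funext => j; rewrite bessel_coefE.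
    by rewrite ReM /= mulr0 subr0.
  by rewrite ImM /= mulr0 add0r.
split; split.
- by apply: radial_kernel_ext (radial_kernel_entire er) => r _; rewrite bE.
- by apply: radial_kernel_ext (radial_kernel_entire ei) => r _; rewrite bE.
- apply: radial_kernel_ext (radial_kernel_ln_entire er) => r _; rewrite bE ReM /=.
  by rewrite mul0r subr0.
- apply: radial_kernel_ext (radial_kernel_ln_entire ei) => r _; rewrite bE ImM /=.
  by rewrite mul0r addr0.
Qed.

(** A positive factor does not change the argument, so [clog (k r / 2)] is [clog (k / 2) + ln r]
    without any jump of the branch. Thus [H_0] is a combination of [J_0], [ln r] times [J_0] and the
    harmonic series. *)
Lemma complex_radial_kernel_hankel0 k : k != 0 ->
  complex_radial_kernel 2 (fun r => hankel0 (k * r%:C)).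
Proof.
move=> k0.
have [|J1 J2] := @complex_radial_kernel_bessel (fun=> 1) k.
  by move=> j; rewrite ler01 ler1n fact_gt0.
have [|W1 _] := @complex_radial_kernel_bessel (series harmonic) k.
  move=> j; apply/andP; split; first by apply: sumr_ge0 => i _; exact: harmonic_ge0.
  apply: (@le_trans _ _ j%:R); last by rewrite ler_nat fact_geq.
  rewrite /series /= big_mkord -[j in leRHS]card_ord -sumr_const; apply: ler_sum => i _.
  by rewrite /harmonic /= invf_le1 ?ler1n.
pose cg : R[i] := ln (cmod (k / 2)) +i* carg (k / 2) + euler_gamma%:C.
pose tp : R[i] := (2 / pi)%:C.
apply: complex_radial_kernel_ext (complex_radial_kernelD
  (complex_radial_kernelZ (1 + 'i%C * tp * cg) J1)
  (complex_radial_kernelD (complex_radial_kernelZ ('i%C * tp) J2)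
     (complex_radial_kernelZ (- ('i%C * tp)) W1))) => r r0.
have JE : bessel_J0 (k * r%:C) = bessel_series (fun=> 1) k r.
  rewrite /bessel_J0 /bessel_series; congr cseries; apply/funext => j.
  by rewrite mulr1.
have cl : clog (k * r%:C / 2) = ln (cmod (k / 2)) +i* carg (k / 2) + (ln r)%:C.
  have k20 : 0 < cmod (k / 2).
    rewrite lt0r cmod_ge0 andbT; apply: contra k0 => /eqP/Normc.eq0_normc/eqP.
    by rewrite mulf_eq0 invr_eq0 pnatr_eq0 orbF.
  have -> : k * r%:C / 2 = (k / 2) * r%:C by rewrite mulrAC.
  rewrite /clog /carg cmodM cmodR gtr0_norm //.
  have [-> ->] : complex.Re (k / 2 * r%:C) = complex.Re (k / 2) * r /\
           complex.Im (k / 2 * r%:C) = complex.Im (k / 2) * r.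
    by rewrite ReM ImM /= !mulr0 subr0 add0r.
  rewrite pmulr_lge0 // lnM ?posrE // -mulf_div divff ?gt_eqF // mulr1.
  by apply: eq_ReIm => /=; rewrite ?addr0.
rewrite /hankel0 /bessel_Y0 JE cl -/tp.
rewrite -/(bessel_series (series harmonic) k r) /cg.
ring.
Qed.

Lemma complex_radial_kernel_spherical_hankel0 k : k != 0 ->
  complex_radial_kernel 3 (fun r => spherical_hankel0 (k * r%:C)).
Proof.
(* [exp (i k r)] has modulus [exp (b r)] and phase [a r]. *)
move=> k0; pose a := complex.Re k; pose b := - complex.Im k.
have E : complex_radial_kernel 3 (fun r => (damped_wave a b 1 0 r / r) +i* (damped_wave a b 0 1 r / r)).
  by split; exact: radial_kernel_damped_wave.
apply: complex_radial_kernel_ext (complex_radial_kernelZ (- 'i%C / k) E) => r r0.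
rewrite /spherical_hankel0 /cexp.
have -> : complex.Re ('i%C * (k * r%:C)) = b * r.
  by rewrite !(ReM, ImM) /= /b; ring.
have -> : complex.Im ('i%C * (k * r%:C)) = a * r.
  by rewrite !(ReM, ImM) /= /a; ring.
have -> : damped_wave a b 1 0 r / r +i* (damped_wave a b 0 1 r / r) =
   (r%:C)^-1 * ((expR (b * r))%:C * (cos (a * r) +i* sin (a * r))).
  rewrite -fmorphV; apply: eq_ReIm; rewrite !(ReM, ImM) /= /damped_wave; ring.
by rewrite invfM !mulrA.
Qed.

Lemma complex_radial_kernel_green d k : d = 2%N \/ d = 3%N -> k != 0 ->
  complex_radial_kernel d (green d k).
Proof.
move=> dE k0; case: dE => ->; rewrite /green /=.
  by apply: complex_radial_kernelZ; exact: complex_radial_kernel_hankel0.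
by apply: complex_radial_kernelZ; exact: complex_radial_kernel_spherical_hankel0.
Qed.

End green_radial.

(** * Layer potentials *)

Section directional_derivative.
Context {R : realType} {d : nat}.

Lemma derive_line (V : normedModType R) (F : V -> R) (x v : V) (df : R) :
  is_derive (0 : R) 1 (fun t => F (x + t *: v)) df -> 'D_v F x = df.
Proof.
move=> [_ <-].
have e : (fun h => h^-1 *: (((fun t => F (x + t *: v)) \o shift 0) (h *: 1) - F (x + 0 *: v))) =
         (fun h => h^-1 *: ((F \o shift x) (h *: v) - F x)).
  apply/funext => h /=.
  by rewrite /shift /= scale0r !addr0 [h *: 1]mulr1 [h *: v + x]addrC.
by rewrite /derive e.
Qed.

Lemma derive_radial (f : R -> R) (x y v : 'rV[R]_d) (df : R) :
  x != y -> is_derive (enorm (x - y)) 1 f df ->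
  'D_v (fun z => f (enorm (z - y))) x = df * (dotp v (x - y) / enorm (x - y)).
Proof.
move=> xy fd; have r0 := enorm_gt0 xy; apply: derive_line.
pose a := dotp (x - y) (x - y); pose b := dotp v (x - y); pose c := dotp v v.
pose q (t : R) := a + (2 * b * t + c * (t * t)).
have qE t : enorm (x + t *: v - y) = Num.sqrt (q t).
  rewrite /enorm /q; congr Num.sqrt; rewrite addrAC /a /b /c; move: (x - y) => z.
  by rewrite !(dotpDl, dotpDr, dotpZl, dotpZr) (dotpC z v); ring.
have a0 : 0 < q 0 by rewrite /q !mulr0 !addr0 /a -sqr_enorm exprn_gt0.
have rE : Num.sqrt (q 0) = enorm (x - y) by rewrite -qE scale0r addr0.
have dq : is_derive (0 : R) 1 q (2 * b).
  have di := @is_derive_id R R 0 1.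
  apply: is_derive_eq (is_deriveD (is_derive_cst a (0 : R) (1 : R))
    (is_deriveD (is_deriveZ (2 * b) di) (is_deriveZ c (is_deriveM di di)))) _.
  by rewrite /GRing.scale /=; ring.
have ds := is_derive1_comp (is_derive1_sqrt a0) dq.
have fd' : is_derive ((Num.sqrt \o q) 0) 1 f df by rewrite /= rE.
have := is_derive1_comp fd' ds.
rewrite (_ : f \o (Num.sqrt \o q) = (fun t => f (enorm (x + t *: v - y)))); last first.
  by apply/funext => t /=; rewrite qE.
rewrite rE => h; apply: is_derive_eq h _; rewrite -/b; field.
by rewrite gt_eqF.
Qed.

Lemma dn_kernel_radial (G : R -> R[i]) : (0 < d)%N -> complex_radial_kernel d G ->
  exists ur ui : R -> R, [/\ lipschitz_near0 ur, lipschitz_near0 ui &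
    forall (n : 'rV[R]_d -> 'rV[R]_d) x y, x != y ->
      dn_kernel G n x y = normal_kernel n ur x y +i* normal_kernel n ui x y].
Proof.
move=> d0 [[ur urL Hr] [ui uiL Hi]]; exists ur, ui; split=> // n x y xy.
have r0 := enorm_gt0 xy; rewrite /dn_kernel.
rewrite (derive_radial _ xy (Hr _ r0)) (derive_radial _ xy (Hi _ r0)) /normal_kernel.
have e (u : R) (r p : R) : 0 < r -> u / r ^+ d.-1 * (p / r) = u / r ^+ d * p.
  move=> r1; rewrite -[in RHS](prednK d0) exprS; field.
  by rewrite expf_neq0 ?gt_eqF.
by rewrite !e.
Qed.

End directional_derivative.

(** * The boundary operator as four real integral operators *)

Section layer_operator.
Context {R : realType} {d : nat} (S : set 'rV[R]_d) (m : nat) (beta eps I M : R).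
Let mu := surface_measure R d.
Context (mS : measurable (S : set (surface_space R d))).
Context (beta0 : 0 < beta).
Context (I0 : 0 <= I).
Context (M0 : 0 < M).
Context (SM : forall x y, S x -> S y -> enorm (x - y) <= M).
Context (weight_le : forall x, S x ->
  (\int[mu]_(y in S) (weight m eps x y)%:E <= I%:E)%E).
Context (n : 'rV[R]_d -> 'rV[R]_d) (G : R -> R[i]) (Kr Ki : 'rV[R]_d -> 'rV[R]_d -> R).
Context (Krw : weakly_singular_kernel S m beta eps Kr).
Context (Kiw : weakly_singular_kernel S m beta eps Ki).
Context (GK : forall x y, x != y -> dn_kernel G n x y = Kr x y +i* Ki x y).
Context (alpha : R).
Context (alpha0 : 0 < alpha).
Implicit Types rho : S -> R[i].

Let uR rho (y : 'rV[R]_d) : R := complex.Re ('valL_ 0 rho y).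
Let uI rho (y : 'rV[R]_d) : R := complex.Im ('valL_ 0 rho y).

Lemma valL_val rho y (Sy : S y) : 'valL_ 0 rho y = rho (SigSub (mem_set Sy)).
Proof.
exact: (congr1 (fun g => g (SigSub (mem_set Sy))) (valLK (0 : R[i]) rho)).
Qed.

Lemma holder_density rho : is_holder alpha rho ->
  [/\ measurable_fun (S : set (surface_space R d)) (uR rho),
      measurable_fun (S : set (surface_space R d)) (uI rho) &
      forall B, (forall x, cmod (rho x) <= B) -> forall y, S y ->
        `|uR rho y| <= B /\ `|uI rho y| <= B].
Proof.
move=> [_ [C rhoC]].
have cR y z : S y -> S z -> `|uR rho y - uR rho z| <= C * enorm (y - z) `^ alpha.
  move=> Sy Sz; rewrite /uR (valL_val rho Sy) (valL_val rho Sz).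
  apply: le_trans (rhoC (SigSub (mem_set Sy)) (SigSub (mem_set Sz))).
  by rewrite (le_trans _ (Re_le_cmod _)) //; case: (rho _) => ? ?; case: (rho _).
have cI y z : S y -> S z -> `|uI rho y - uI rho z| <= C * enorm (y - z) `^ alpha.
  move=> Sy Sz; rewrite /uI (valL_val rho Sy) (valL_val rho Sz).
  apply: le_trans (rhoC (SigSub (mem_set Sy)) (SigSub (mem_set Sz))).
  by rewrite (le_trans _ (Im_le_cmod _)) //; case: (rho _) => ? ?; case: (rho _).
split.
- exact: holder_measurable mS alpha0 cR.
- exact: holder_measurable mS alpha0 cI.
- move=> B rhoB y Sy; rewrite /uR /uI (valL_val rho Sy).
  by rewrite (le_trans (Re_le_cmod _)) ?(le_trans (Im_le_cmod _)).
Qed.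

(** The complex product of kernel and density, written out in real and imaginary parts. *)
Definition layer_op rho (x : 'rV[R]_d) : R[i] :=
  (kernel_op S Kr (uR rho) x - kernel_op S Ki (uI rho) x) +i*
  (kernel_op S Kr (uI rho) x + kernel_op S Ki (uR rho) x).

Lemma dnS_integrandE rho (x : S) (e : R) : 0 < e ->
  forall y, truncation S (\val x) e y ->
    complex.Re (dnS_integrand n G rho (\val x) y) =
      Kr (\val x) y * uR rho y - Ki (\val x) y * uI rho y /\
    complex.Im (dnS_integrand n G rho (\val x) y) =
      Kr (\val x) y * uI rho y + Ki (\val x) y * uR rho y.
Proof.
move=> e0 y [Sy ey].
have xy : \val x != y.
  by apply/eqP => xy; move: ey; rewrite xy subrr enorm0 ltNge ltW.
rewrite /dnS_integrand (GK xy) /uR /uI.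
by case: ('valL_ 0 rho y) => a b.
Qed.

(** Kernel and derivative agree off the diagonal, which every truncation avoids. The last clause,
    integrability over all of [S], is recorded for the proof of linearity. *)
Lemma dnS_layer_op : exists2 C : R, 0 <= C & forall rho, is_holder alpha rho ->
  [/\ dnS_exists n G rho,
      forall x : S, dnS n G rho x = layer_op rho (\val x),
      forall B, 0 <= B -> (forall x, cmod (rho x) <= B) ->
        (forall x, cmod (dnS n G rho x) <= C * B) /\
        (forall x x', cmod (dnS n G rho x - dnS n G rho x') <=
           C * B * enorm (\val x - \val x') `^ beta) &
      forall x : S, [/\
        mu.-integrable S (EFin \o (fun y => Kr (\val x) y * uR rho y)),
        mu.-integrable S (EFin \o (fun y => Ki (\val x) y * uI rho y)),
        mu.-integrable S (EFin \o (fun y => Kr (\val x) y * uI rho y)) &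
        mu.-integrable S (EFin \o (fun y => Ki (\val x) y * uR rho y))]].
Proof.
have [C1 C10 H1] := kernel_op_bounds mS beta0 I0 weight_le (ltW M0) SM Krw.
have [C2 C20 H2] := kernel_op_bounds mS beta0 I0 weight_le (ltW M0) SM Kiw.
(* Each real kernel acts twice, once in the real and once in the imaginary part. *)
exists (2 * (C1 + C2)) => [|rho hrho]; first by rewrite mulr_ge0 // addr_ge0.
have [mR mI uB] := holder_density hrho.
have [B0 [B00 rhoB0]] : exists B, 0 <= B /\ forall x, cmod (rho x) <= B.
  have [[B rhoB] _] := hrho; exists `|B|; split=> // x.
  by rewrite (le_trans (rhoB x)) // ler_norm.
have Sval (x : S) : S (\val x) by exact: set_valP.
have [r1 _] := H1 (uR rho) B0 B00 mR (fun y Sy => proj1 (uB B0 rhoB0 y Sy)).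
have [r2 _] := H1 (uI rho) B0 B00 mI (fun y Sy => proj2 (uB B0 rhoB0 y Sy)).
have [r3 _] := H2 (uR rho) B0 B00 mR (fun y Sy => proj1 (uB B0 rhoB0 y Sy)).
have [r4 _] := H2 (uI rho) B0 B00 mI (fun y Sy => proj2 (uB B0 rhoB0 y Sy)).
have mT (x : S) e : measurable (truncation S (\val x) e) by exact: truncation_measurable.
have TS (x : S) e : truncation S (\val x) e `<=` S by move=> y [].
have iT (x : S) e (h : 'rV[R]_d -> R) : mu.-integrable S (EFin \o h) ->
    mu.-integrable (truncation S (\val x) e) (EFin \o h).
  exact: (integrableS mS (mT x e) (TS x e)).
have cvR (x : S) : truncated_Re S (dnS_integrand n G rho (\val x)) (\val x) e @[e --> 0^'+]
    --> kernel_op S Kr (uR rho) (\val x) - kernel_op S Ki (uI rho) (\val x).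
  have [i1 _ c1] := r1 _ (Sval x); have [i4 _ c4] := r4 _ (Sval x).
  apply: cvg_trans (cvgB c1 c4); apply: near_eq_cvg.
  apply: filterS (nbhs_right_gt (0 : R)) => e e0.
  apply: etrans (esym (RintegralB (mT x e) (iT x e _ i1) (iT x e _ i4))) _.
  by apply: eq_Rintegral => y /set_mem Ty; rewrite (dnS_integrandE rho e0 Ty).1.
have cvI (x : S) : truncated_Im S (dnS_integrand n G rho (\val x)) (\val x) e @[e --> 0^'+]
    --> kernel_op S Kr (uI rho) (\val x) + kernel_op S Ki (uR rho) (\val x).
  have [i2 _ c2] := r2 _ (Sval x); have [i3 _ c3] := r3 _ (Sval x).
  apply: cvg_trans (cvgD c2 c3); apply: near_eq_cvg.
  apply: filterS (nbhs_right_gt (0 : R)) => e e0.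
  apply: etrans (esym (RintegralD (mT x e) (iT x e _ i2) (iT x e _ i3))) _.
  by apply: eq_Rintegral => y /set_mem Ty; rewrite (dnS_integrandE rho e0 Ty).2.
have dE (x : S) : dnS n G rho x = layer_op rho (\val x).
  rewrite /dnS /pv_integral /layer_op; congr (_ +i* _).
    exact: cvg_lim (cvR x).
  exact: cvg_lim (cvI x).
split.
- move=> x; have [i1 _ _] := r1 _ (Sval x); have [i4 _ _] := r4 _ (Sval x).
  have [i2 _ _] := r2 _ (Sval x); have [i3 _ _] := r3 _ (Sval x).
  split; [move=> e e0; split| |].
  + apply: eq_integrable (integrableB (mT x e) (iT x e _ i1) (iT x e _ i4)) => [|y /set_mem Ty].
      exact: mT.
    by rewrite (dnS_integrandE rho e0 Ty).1.
  + apply: eq_integrable (integrableD (mT x e) (iT x e _ i2) (iT x e _ i3)) => [|y /set_mem Ty].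
      exact: mT.
    by rewrite (dnS_integrandE rho e0 Ty).2.
  + exact: cvgP (cvR x).
  + exact: cvgP (cvI x).
- exact: dE.
- move=> B B00' rhoB.
  have [b1 l1] := H1 (uR rho) B B00' mR (fun y Sy => proj1 (uB B rhoB y Sy)).
  have [b2 l2] := H1 (uI rho) B B00' mI (fun y Sy => proj2 (uB B rhoB y Sy)).
  have [b3 l3] := H2 (uR rho) B B00' mR (fun y Sy => proj1 (uB B rhoB y Sy)).
  have [b4 l4] := H2 (uI rho) B B00' mI (fun y Sy => proj2 (uB B rhoB y Sy)).
  split=> [x|x x']; rewrite !dE /layer_op (le_trans (cmod_le_ReIm _)) //=.
    have [_ k1 _] := b1 _ (Sval x); have [_ k2 _] := b2 _ (Sval x).
    have [_ k3 _] := b3 _ (Sval x); have [_ k4 _] := b4 _ (Sval x).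
    have := lerD (le_trans (ler_normB _ _) (lerD k1 k4)) (le_trans (ler_normD _ _) (lerD k2 k3)).
    by move=> /le_trans; apply; rewrite le_eqVlt; apply/orP; left; apply/eqP; ring.
  have k1 := l1 _ _ (Sval x) (Sval x'); have k2 := l2 _ _ (Sval x) (Sval x').
  have k3 := l3 _ _ (Sval x) (Sval x'); have k4 := l4 _ _ (Sval x) (Sval x').
  have := lerD (le_trans (ler_normB _ _) (lerD k1 k4)) (le_trans (ler_normD _ _) (lerD k2 k3)).
  set w := _ `^ _ => /= h; rewrite [leRHS](_ : _ = C1 * B * w + C2 * B * w + (C1 * B * w + C2 * B * w)); last by ring.
  apply: le_trans h; rewrite le_eqVlt; apply/orP; left; apply/eqP.
  by apply: (congr2 +%R); apply: (congr1 Num.norm) => /=; ring.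
- move=> x; have [i1 _ _] := r1 _ (Sval x); have [i4 _ _] := r4 _ (Sval x).
  by have [i2 _ _] := r2 _ (Sval x); have [i3 _ _] := r3 _ (Sval x).
Qed.

Lemma dnS_linear a rho1 rho2 : is_holder alpha rho1 -> is_holder alpha rho2 ->
  is_holder alpha (fun x => a * rho1 x + rho2 x) ->
  forall x, dnS n G (fun x => a * rho1 x + rho2 x) x = a * dnS n G rho1 x + dnS n G rho2 x.
Proof.
move=> h1 h2 h12 x; have [C _ H] := dnS_layer_op.
have [_ E1 _ /(_ x)[i1 i2 i3 i4]] := H _ h1.
have [_ E2 _ /(_ x)[j1 j2 j3 j4]] := H _ h2.
have [_ E12 _ _] := H _ h12; rewrite E1 E2 E12 /layer_op.
have Sx : S (\val x) by exact: set_valP.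
have uRE y : S y -> uR (fun x => a * rho1 x + rho2 x) y =
    complex.Re a * uR rho1 y - complex.Im a * uI rho1 y + uR rho2 y.
  by move=> Sy; rewrite /uR /uI !(valL_val _ Sy); case: (rho1 _) (rho2 _) (a) => ? ? [? ?] [].
have uIE y : S y -> uI (fun x => a * rho1 x + rho2 x) y =
    complex.Re a * uI rho1 y + complex.Im a * uR rho1 y + uI rho2 y.
  by move=> Sy; rewrite /uR /uI !(valL_val _ Sy); case: (rho1 _) (rho2 _) (a) => ? ? [? ?] [].
have comb (K : 'rV[R]_d -> 'rV[R]_d -> R) (p q : R) (u v w z : 'rV[R]_d -> R) :
    (forall y, S y -> z y = p * u y + q * v y + w y) ->
    mu.-integrable S (EFin \o (fun y => K (\val x) y * u y)) ->
    mu.-integrable S (EFin \o (fun y => K (\val x) y * v y)) ->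
    mu.-integrable S (EFin \o (fun y => K (\val x) y * w y)) ->
    kernel_op S K z (\val x) = p * kernel_op S K u (\val x) +
      q * kernel_op S K v (\val x) + kernel_op S K w (\val x).
  move=> zE iu iv iw; rewrite /kernel_op.
  have iu' := integrableZl mS p iu; have iv' := integrableZl mS q iv.
  have iuv := integrableD mS iu' iv'.
  rewrite -(RintegralZl p mS iu) -(RintegralZl q mS iv) -(RintegralD mS iu' iv').
  rewrite -(RintegralD mS iuv iw); apply: eq_Rintegral => y /set_mem Sy.
  by rewrite zE //; ring.
rewrite (comb Kr (complex.Re a) (- complex.Im a) (uR rho1) (uI rho1) (uR rho2) (uR (fun x => a * rho1 x + rho2 x))) //; last first.
  by move=> y /uRE ->; ring.
rewrite (comb Ki (complex.Re a) (complex.Im a) (uI rho1) (uR rho1) (uI rho2) (uI (fun x => a * rho1 x + rho2 x))) //.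
rewrite (comb Kr (complex.Re a) (complex.Im a) (uI rho1) (uR rho1) (uI rho2) (uI (fun x => a * rho1 x + rho2 x))) //.
rewrite (comb Ki (complex.Re a) (- complex.Im a) (uR rho1) (uI rho1) (uR rho2) (uR (fun x => a * rho1 x + rho2 x))) //; last first.
  by move=> y /uRE ->; ring.
by case: (a) => ? ?; apply: eq_ReIm => /=; ring.
Qed.

End layer_operator.

(** * Compactness in Hölder spaces *)

Section holder_compactness.
Context {R : realType} {d : nat} (S : set 'rV[R]_d) (alpha : R).
Local Notation H := (holder S alpha).

(** A closed segment is compact, which gives a cluster point; along an ultrafilter a cluster point
    is a limit. *)
Lemma ultra_bounded_cvg (T : Type) (F : set_system T) (phi : T -> R) (M : R) :
  UltraFilter F -> F [set t | `|phi t| <= M] -> exists l : R, phi @ F --> l.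
Proof.
move=> FU FM; have PF : ProperFilter F by exact: ultra_proper.
have : `[- M, M]%classic `&` cluster (phi @ F) !=set0.
  apply: (@segment_compact R (- M) M (phi @ F)).
  suff : F [set t | `[- M, M]%classic (phi t)] by [].
  by apply: filterS FM => t /=; rewrite in_itv /= -ler_norml.
move=> [l [_ cl]]; exists l => U Ul.
have [//|nU] := in_ultra_setVsetC (phi @^-1` U) FU.
by have [x [nUx Ux]] := cl (~` U) U nU Ul.
Qed.

Lemma sup_range_le (I : Type) (g : I -> R) (C : R) : 0 <= C -> (forall i, g i <= C) ->
  sup (range g) <= C.
Proof.
move=> C0 gC; have [->|/set0P ne] := eqVneq (range g) set0; first by rewrite sup0.
by apply: ge_sup => // _ [i _ <-].
Qed.

Lemma holder_norm_le (f : H) (A B : R) : 0 <= A -> 0 <= B ->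
  (forall x, cmod (f x) <= A) ->
  (forall x y, cmod (f x - f y) <= B * enorm (\val x - \val y) `^ alpha) ->
  `|f| <= (A + B)%:C.
Proof.
move=> A0 B0 fA fB; rewrite [`|f|](_ : _ = (holder_norm alpha f)%:C) // lecR.
rewrite /holder_norm lerD //; apply: sup_range_le => // p.
have := fB p.1 p.2; set e := _ `^ _ => h.
have : 0 <= e by exact: powR_ge0.
rewrite le_eqVlt => /orP[/eqP <-|e0]; first by rewrite invr0 mulr0.
by rewrite ler_pdivrMr.
Qed.

Lemma cmod_le_norm (f : H) (N : R) x : `|f| <= N%:C -> cmod (f x) <= N.
Proof.
rewrite [`|f|](_ : _ = (holder_norm alpha f)%:C) // lecR => fN.
have [[C fC] _] : is_holder alpha f by case: (f) => g /= /asboolP.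
apply: le_trans fN; rewrite /holder_norm -[leLHS]addr0 lerD //; last first.
  exact: holder_seminorm_ge0.
by rewrite /sup_norm; apply: ub_le_sup; [exists C => _ [j _ <-]|exists x].
Qed.

Lemma is_holder_le_exponent (f : S -> R[i]) (M D beta : R) :
  0 < alpha -> alpha <= beta -> 0 < D -> 0 <= M ->
  (forall x y, S x -> S y -> enorm (x - y) <= D) ->
  (forall x, cmod (f x) <= M) ->
  (forall x y, cmod (f x - f y) <= M * enorm (\val x - \val y) `^ beta) ->
  is_holder alpha f.
Proof.
move=> a0 ab D0 M0 SD fM fL; split; first by exists M.
exists (M * D `^ (beta - alpha)) => x y; rewrite (le_trans (fL x y)) // -mulrA ler_wpM2l //.
have [|r0] := eqVneq (enorm (\val x - \val y)) 0.
  by move=> r0; rewrite r0 !powR0 ?mulr0 // gt_eqF // (lt_le_trans a0).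
rewrite [leLHS](_ : _ = enorm (\val x - \val y) `^ (beta - alpha) *
  enorm (\val x - \val y) `^ alpha); last by rewrite -powRD ?subrK // r0 implybT.
rewrite ler_wpM2r ?powR_ge0 //.
apply: ge0_ler_powR; rewrite ?nnegrE ?subr_ge0 ?enorm_ge0 ?(ltW D0) //.
by apply: SD; exact: set_valP.
Qed.

(* An ultrafilter on the ball converges pointwise; equi-Hölder continuity makes
   the convergence uniform, and small differences |x - y| <= tau are controlled
   by the larger exponent beta. *)
Lemma holder_ball_compact (M D beta : R) : compact S -> 0 < alpha -> alpha < beta ->
  0 <= M -> 0 < D -> (forall x y, S x -> S y -> enorm (x - y) <= D) ->
  compact [set f : H | (forall x, cmod (f x) <= M) /\
    forall x y, cmod (f x - f y) <= M * enorm (\val x - \val y) `^ beta].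
Proof.
move=> cS a0 ab M0 D0 SD; rewrite compact_ultra => F FU FE.
have PF : ProperFilter F by exact: ultra_proper.
set E := [set f : H | _] in FE *.
have lim x : exists l : R[i], forall e : R, 0 < e -> \forall g \near F, cmod (l - (g : H) x) <= e.
  have [lr hr] : exists l : R, (fun g : H => complex.Re (g x)) @ F --> l.
    apply: (ultra_bounded_cvg (M := M)) => //; apply: filterS FE => g [gM _] /=.
    by rewrite (le_trans (Re_le_cmod _)).
  have [li hi] : exists l : R, (fun g : H => complex.Im (g x)) @ F --> l.
    apply: (ultra_bounded_cvg (M := M)) => //; apply: filterS FE => g [gM _] /=.
    by rewrite (le_trans (Im_le_cmod _)).
  exists (lr +i* li) => e e0.
  have e2 : 0 < e / 2 by rewrite divr_gt0.
  have /cvgrPdist_le/(_ _ e2) h1 := hr; have /cvgrPdist_le/(_ _ e2) h2 := hi.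
  apply: filterS2 h1 h2 => g k1 k2; rewrite (le_trans (cmod_le_ReIm _)) //.
  rewrite [leRHS]splitr lerD //.
    by move: k1; case: (g x).
  by move: k2; case: (g x).
have [f fP] := choice lim.
have fM x : cmod (f x) <= M.
  apply/ler_addgt0Pr => e e0; have [g [[gM _] fg]] := filter_ex (filterI FE (fP x e e0)).
  by rewrite -[f x](subrK (g x)) addrC (le_trans (cmodD _ _)) // lerD.
have fL x y : cmod (f x - f y) <= M * enorm (\val x - \val y) `^ beta.
  apply/ler_addgt0Pr => e e0; have e2 : 0 < e / 2 by rewrite divr_gt0.
  have [g [[[_ gL] fx] fy]] := filter_ex (filterI (filterI FE (fP x _ e2)) (fP y _ e2)).
  rewrite (_ : f x - f y = (g x - g y) + ((f x - g x) - (f y - g y))); last by ring.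
  rewrite (le_trans (cmodD _ _)) // lerD // (le_trans (cmodD _ _)) // [leRHS]splitr lerD //.
  by rewrite cmodN.
have fH : is_holder alpha f by apply: (is_holder_le_exponent a0 (ltW ab) D0 M0 SD).
pose fh : H := Holder (asboolT fH).
exists fh; split; first by split.
have unif e : 0 < e -> \forall g \near F, forall x : S, cmod (f x - (g : H) x) <= e.
  move=> e0.
  have : \forall g \near F, S `<=` (fun y => forall Sy : S y,
      cmod (f (SigSub (mem_set Sy)) - (g : H) (SigSub (mem_set Sy))) <= e).
    move/compact_near_coveringP/near_covering_withinP : cS; apply => x0 Sx0.
    pose X0 : S := SigSub (mem_set Sx0).
    have e3 : 0 < e / 3 by rewrite divr_gt0.
    (* Chosen so that members of [E], and [f], vary by at most [e / 3] over the ball; [M + 1] is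
       positive even if [M] is 0. *)
    pose r := (e / 3 / (M + 1)) `^ beta^-1.
    have b0 : 0 < beta by exact: lt_trans ab.
    have q0 : 0 < e / 3 / (M + 1) by rewrite divr_gt0 // ltr_wpDl.
    have r0 : 0 < r by rewrite powR_gt0.
    exists (eball x0 r, E `&` [set g : H | cmod (f X0 - g X0) <= e / 3]).
      by split; [exact: eball_nbhs|apply: filterI => //; exact: fP].
    move=> [y g] /= [yx [[gM gL] fg]] _ Sy; set Y : S := SigSub _.
    have small : M * enorm (\val Y - \val X0) `^ beta <= e / 3.
      have h : enorm (y - x0) `^ beta <= e / 3 / (M + 1).
        have -> : e / 3 / (M + 1) = r `^ beta.
          by rewrite /r -powRrM mulVf ?gt_eqF // powRr1 // ltW.
        by apply: ge0_ler_powR; rewrite ?nnegrE ?enorm_ge0 ?(ltW b0) ?(ltW r0) // ltW.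
      apply: (@le_trans _ _ ((M + 1) * enorm (y - x0) `^ beta)).
        by rewrite ler_wpM2r ?powR_ge0 // lerDl.
      by rewrite mulrC -ler_pdivlMr // ltr_wpDl.
    rewrite (_ : f Y - g Y = (f Y - f X0) + ((f X0 - g X0) - (g Y - g X0))); last by ring.
    rewrite (le_trans (cmodD _ _)) // (@le_trans _ _ (e / 3 + (e / 3 + e / 3))) //; last by lra.
    rewrite lerD //; first by rewrite (le_trans (fL _ _)).
    rewrite (le_trans (cmodD _ _)) // lerD //.
    by rewrite cmodN (le_trans (gL _ _)).
  apply: filterS => g h [y Sy]; have := h y (set_mem Sy) (set_mem Sy).
  by rewrite (_ : SigSub _ = exist _ y Sy) //; exact: val_inj.
have : (id : H -> H) @ F --> fh; last exact.
(* The norm takes values in [R[i]], where a positive element has imaginary part 0. *)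
apply/cvgrPdist_le => -[e ei]; rewrite ltcE /= => /andP[/eqP -> e0].
have ba0 : 0 < beta - alpha by rewrite subr_gt0.
have e4 : 0 < e / 4 by rewrite divr_gt0.
have M21 : 0 < 2 * M + 1 by rewrite ltr_wpDl // mulr_ge0.
(* At distance [r <= tau] both functions are Hölder of exponent [beta], so their difference varies
   by at most [2 M r^beta <= (e / 4) r^alpha]. *)
pose tau := (e / 4 / (2 * M + 1)) `^ (beta - alpha)^-1.
have tau0 : 0 < tau by rewrite powR_gt0 // divr_gt0.
have tauE : 2 * M * tau `^ (beta - alpha) <= e / 4.
  rewrite /tau -powRrM mulVf ?gt_eqF // powRr1; last by rewrite divr_ge0 // ltW.
  rewrite mulrA ler_pdivrMr // mulrC ler_wpM2l ?(ltW e4) // lerDl //.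
(* The first entry controls the sup norm; the second controls pairs at distance [r > tau], for which
   [2 eta <= (e / 4) tau^alpha <= (e / 4) r^alpha]. *)
pose eta := Num.min (e / 4) (e / 4 * tau `^ alpha / 2).
have eta0 : 0 < eta by rewrite /eta lt_min e4 divr_gt0 // mulr_gt0 // powR_gt0.
apply: filterS2 FE (unif _ eta0) => g [gM gL] fg.
apply: (@le_trans _ _ (e / 4 + e / 4)%:C); last by rewrite lecR; lra.
apply: holder_norm_le; [exact: ltW|exact: ltW| |].
  by move=> x; rewrite (le_trans (fg x)) // /eta ge_min lexx.
have hE z : (fh - g) z = f z - g z by [].
move=> x y; set r := enorm _.
have r0 : 0 <= r by exact: enorm_ge0.
have [rt|tr] := leP r tau.
  have h : cmod ((fh - g) x - (fh - g) y) <= 2 * M * r `^ beta.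
    rewrite (_ : _ - _ = (f x - f y) - (g x - g y)); last by rewrite !hE; ring.
    rewrite (le_trans (cmodD _ _)) // cmodN -mulrA mulr2n mulrDl mul1r lerD //.
  rewrite (le_trans h) //; have [r1|r1] := eqVneq r 0.
    by rewrite r1 !powR0 ?mulr0 // gt_eqF // (lt_trans a0).
  rewrite (_ : r `^ beta = r `^ (beta - alpha) * r `^ alpha); last first.
    by rewrite -powRD ?subrK // r1 implybT.
  rewrite mulrA ler_wpM2r ?powR_ge0 // (le_trans _ tauE) // ler_wpM2l ?mulr_ge0 //.
  by apply: ge0_ler_powR; rewrite ?nnegrE // ltW.
have h : cmod ((fh - g) x - (fh - g) y) <= eta + eta.
  by rewrite (le_trans (cmodD _ _)) // cmodN lerD //; exact: fg.
rewrite (le_trans h) // (@le_trans _ _ (e / 4 * tau `^ alpha)) //.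
  by rewrite [leRHS]splitr lerD // /eta ge_min lexx orbT.
rewrite ler_wpM2l ?(ltW e4) //; apply: ge0_ler_powR; rewrite ?nnegrE // ltW //.
Qed.

End holder_compactness.

(** * The operator matrix *)

Section assembly.
Context {R : realType}.

Lemma linear_map_exists (K : nzRingType) (U V : lmodType K) (f : U -> V) :
  linear f -> exists L : {linear U -> V}, forall x, L x = f x.
Proof.
move=> lf; pose mx := GRing.isLinear.Build K U V *:%R f lf.
by pose L : {linear U -> V} := HB.pack f mx; exists L.
Qed.

Context {d : nat} (D : set 'rV[R]_d) (n : 'rV[R]_d -> 'rV[R]_d) (alpha beta : R).
Context (d1 : (1 < d)%N).
Context (oD : open D).
Context (bD : bounded_set D).
Context (C2D : C2_boundary D).
Context (nf : unit_normal_field (boundary D) n).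
Context (alpha0 : 0 < alpha).
Context (alpha_beta : alpha < beta).
Context (beta1 : beta < 1).
Local Notation S := (boundary D).
Local Notation H := (holder S alpha).
Implicit Types G : R -> R[i].

Lemma boundary_diam : exists2 M : R, 0 < M & forall x y, S x -> S y -> enorm (x - y) <= M.
Proof.
apply: bounded_enorm; apply: compact_bounded; exact: boundary_compact.
Qed.

Lemma dnS_radial G : complex_radial_kernel d G ->
  exists2 C : R, 0 <= C &
    (forall rho : H, dnS_exists n G rho /\
      forall B, 0 <= B -> (forall x, cmod (rho x) <= B) ->
        (forall x, cmod (dnS n G rho x) <= C * B) /\
        (forall x x', cmod (dnS n G rho x - dnS n G rho x') <=
           C * B * enorm (\val x - \val x') `^ beta)) /\
    (forall a (rho1 rho2 : H) x,
       dnS n G (a *: rho1 + rho2) x = a * dnS n G rho1 x + dnS n G rho2 x).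
Proof.
move=> Grad; have [M M0 SM] := boundary_diam.
have mS := surface_measurable_boundary D.
have [C1 C10 nC] := unit_normal_bounds oD bD C2D nf.
have [C0 C00 ballS] := surface_measure_ball_le oD bD C2D.
have m1 : (0 < d.-1)%N by rewrite -subn1 subn_gt0.
have beta0 : 0 < beta by exact: lt_trans alpha_beta.
have beta01 : 0 < beta < 1 by rewrite beta0.
have eps0 : 0 < 1 - beta by rewrite subr_gt0.
(* The weight has a negative exponent because [d >= 2] and [beta > 0]. *)
have epsm : 1 - beta < d.-1%:R.
  by rewrite (@lt_le_trans _ _ 1) ?ler1n // gtrDl oppr_lt0.
have [I I0 HI] := weight_integral mS M0 SM C00 ballS eps0 epsm.
have [ur [ui [urL uiL GK]]] := dn_kernel_radial (ltnW d1) Grad.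
have Krw := normal_kernel_weakly_singular mS d1 C10 M0 SM nC beta01 urL.
have Kiw := normal_kernel_weakly_singular mS d1 C10 M0 SM nC beta01 uiL.
have hH (rho : H) : is_holder alpha rho by case: rho => g /= /asboolP.
have [C C_ge0 HC] := dnS_layer_op mS beta0 I0 M0 SM HI Krw Kiw (GK n) alpha0.
exists C => //; split=> [rho|a rho1 rho2 x].
  by have [h1 _ h2 _] := HC rho (hH rho); split.
apply: (dnS_linear mS beta0 I0 M0 SM HI Krw Kiw (GK n) alpha0 (hH rho1) (hH rho2)).
exact: (hH (a *: rho1 + rho2)).
Qed.

(** One row of the matrix. The bound in the exponent [beta] places the image of a ball inside one of
    the sets of [holder_ball_compact]. *)
Lemma dnS_pair G1 G2 : complex_radial_kernel d G1 -> complex_radial_kernel d G2 ->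
  exists op : H * H -> H,
    [/\ forall s, op s = dnS n G1 s.1 + dnS n G2 s.2 :> (S -> R[i]),
        forall a s t, op (a *: s + t) = a *: op s + op t &
        exists2 C : R, 0 <= C & forall (N : R) s, 0 <= N ->
          `|s.1| <= N%:C -> `|s.2| <= N%:C ->
          (forall x, cmod (op s x) <= C * N) /\
          forall x y, cmod (op s x - op s y) <= C * N * enorm (\val x - \val y) `^ beta].
Proof.
move=> r1 r2; have [C1 C10 [b1 l1]] := dnS_radial r1; have [C2 C20 [b2 l2]] := dnS_radial r2.
have [M M0 SM] := boundary_diam.
pose f (s : H * H) : S -> R[i] := dnS n G1 s.1 + dnS n G2 s.2.
have fb (N : R) s : 0 <= N -> `|s.1| <= N%:C -> `|s.2| <= N%:C ->
   (forall x, cmod (f s x) <= (C1 + C2) * N) /\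
   forall x y, cmod (f s x - f s y) <= (C1 + C2) * N * enorm (\val x - \val y) `^ beta.
  move=> N0 s1N s2N.
  have [_ /(_ N N0 (fun x => cmod_le_norm x s1N))[k1 k1']] := b1 s.1.
  have [_ /(_ N N0 (fun x => cmod_le_norm x s2N))[k2 k2']] := b2 s.2.
  split=> [x|x y]; first by rewrite /f mulrDl (le_trans (cmodD _ _)) // lerD.
  have fE z : f s z = dnS n G1 s.1 z + dnS n G2 s.2 z by [].
  rewrite !fE opprD addrACA (le_trans (cmodD _ _)) // !mulrDl lerD //.
have normE (g : H) : exists2 N : R, 0 <= N & `|g| = N%:C.
  exists (holder_norm alpha g) => //.
  by rewrite addr_ge0 ?sup_norm_ge0 ?holder_seminorm_ge0.
have fH s : is_holder alpha (f s).
  have [N1 N10 e1] := normE s.1; have [N2 N20 e2] := normE s.2.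
  have [|||k1 k2] := fb (N1 + N2) s.
  - exact: addr_ge0.
  - by rewrite e1 lecR lerDl.
  - by rewrite e2 lecR lerDr.
  apply: (is_holder_le_exponent alpha0 (ltW alpha_beta) M0 _ SM k1 k2).
  by rewrite mulr_ge0 // addr_ge0.
exists (fun s => Holder (asboolT (fH s))); split=> //.
- move=> a s t; apply: val_inj; apply/funext => x.
  have -> : \val (Holder (asboolT (fH (a *: s + t)))) x =
      dnS n G1 (a *: s.1 + t.1) x + dnS n G2 (a *: s.2 + t.2) x by [].
  rewrite l1 l2.
  have -> : \val (a *: Holder (asboolT (fH s)) + Holder (asboolT (fH t))) x =
    a * (dnS n G1 s.1 x + dnS n G2 s.2 x) + (dnS n G1 t.1 x + dnS n G2 t.2 x) by [].
  by rewrite mulrDr addrACA.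
- by exists (C1 + C2); [exact: addr_ge0|exact: fb].
Qed.

(** The order of [R[i]] is partial, but both norms are embedded reals, so their maximum is decided
    by a comparison in [R]. *)
Lemma pair_norm_le (s : H * H) (N : R) : `|s| <= N%:C -> `|s.1| <= N%:C /\ `|s.2| <= N%:C.
Proof.
rewrite prod_normE; case: s => f g /=.
rewrite [`|f|](_ : _ = (holder_norm alpha f)%:C) // [`|g|](_ : _ = (holder_norm alpha g)%:C) //.
rewrite /Order.max ltcR; case: ltP => h; rewrite !lecR => fN.
  by split=> //; rewrite (le_trans (ltW h)).
by split=> //; rewrite (le_trans h).
Qed.

Lemma layer_matrix_compact G1T G2T G1P G2P :
  complex_radial_kernel d G1T -> complex_radial_kernel d G2T ->
  complex_radial_kernel d G1P -> complex_radial_kernel d G2P ->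
  exists L : {linear (H * H)%type -> (H * H)%type},
    (forall sigma : H * H,
       (L sigma).1 = dnS n G1T sigma.1 + dnS n G2T sigma.2 :> (S -> R[i]) /\
       (L sigma).2 = dnS n G1P sigma.1 + dnS n G2P sigma.2 :> (S -> R[i])) /\
    compact_operator L.
Proof.
move=> r1 r2 r3 r4.
have [op1 [E1 l1 [C1 C10 b1]]] := dnS_pair r1 r2.
have [op2 [E2 l2 [C2 C20 b2]]] := dnS_pair r3 r4.
have [M M0 SM] := boundary_diam.
have lin : linear (fun s : H * H => (op1 s, op2 s)).
  by move=> a s t; rewrite l1 l2.
have [L LE] := linear_map_exists lin.
exists L; split=> [s|B bB]; first by rewrite !LE; split; [exact: E1|exact: E2].
have [N N0 BN] : exists2 N : R, 0 <= N & forall s, B s -> `|s| <= N%:C.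
  have [K [Kr KB]] := bB.
  (* Boundedness over [R[i]] provides an element [K] of [R[i]] that is real. *)
  have K0 : complex.Im K = 0.
    have /complex_realP[k kE] : (K : R[i]) \is Num.real by exact: Kr.
    by rewrite kE.
  exists (Num.max 0 (complex.Re K) + 1); first by rewrite addr_ge0 // le_max lexx.
  move=> s Bs; apply: KB => //; rewrite ltcE /= K0 eqxx /=.
  by rewrite (@le_lt_trans _ _ (Num.max 0 (complex.Re K))) ?le_max ?lexx ?orbT // ltrDl.
pose E (C : R) := [set f : H | (forall x, cmod (f x) <= C) /\
    forall x y, cmod (f x - f y) <= C * enorm (\val x - \val y) `^ beta].
have cE C : 0 <= C -> compact (E C).
  move=> C0; apply: (holder_ball_compact (boundary_compact bD) alpha0 alpha_beta C0 M0 SM).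
exists (E (C1 * N) `*` E (C2 * N)).
  move=> _ [s Bs <-]; rewrite LE; have [s1 s2] := pair_norm_le (BN s Bs).
  by split; [exact: b1|exact: b2].
have cEE : compact (E (C1 * N) `*` E (C2 * N)).
  by apply: compact_setX; apply: cE; exact: mulr_ge0.
split=> //; apply: compact_closed cEE; exact: norm_hausdorff.
Qed.

End assembly.
Theorem proposition2 (R : realType)
  (Om La ga : R) (hOm : 0 < Om) (hLa : 0 < La) (hga : 0 < ga) (hga1 : ga != 1)
  (Q : R[i])
  (hQ2 : Q ^+ 2 = 4 * ('i%C * Om%:C + ga%:C * Om%:C * La%:C)
                  + (1 - 'i%C * ga%:C * Om%:C - 'i%C * La%:C) ^+ 2)
  (hQ0 : Q != 0)
  (kt kp : R[i])
  (hkt : kt ^+ 2 = 'i%C / (2 * Om%:C)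
                   * ((1 - 'i%C * ga%:C * Om%:C - 'i%C * La%:C + Q)
                      / (1 - 'i%C * ga%:C * La%:C)))
  (hkp : kp ^+ 2 = 'i%C / (2 * Om%:C)
                   * ((1 - 'i%C * ga%:C * Om%:C - 'i%C * La%:C - Q)
                      / (1 - 'i%C * ga%:C * La%:C)))
  (hkt0 : 0 < complex.Im kt) (hkp0 : 0 < complex.Im kp)
  (d : nat) (hd : d = 2%N \/ d = 3%N)
  (D : set 'rV[R]_d) (hD : is_domain D) (hDb : bounded_set D)
  (hDC2 : C2_boundary D)
  (n : 'rV[R]_d -> 'rV[R]_d) (hn : unit_normal_field (boundary D) n)
  (alpha : R) (halpha0 : 0 < alpha) (halpha1 : alpha < 1) :
  let H := holder (boundary D) alpha in
  let dS1T := dnS n (kernelT d kt) in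
  let dS2T := dnS n (kernelT d kp) in
  let dS1P := dnS n (kernelP d Om ga kt) in
  let dS2P := dnS n (kernelP d Om ga kp) in
  (forall rho : H,
     [/\ dnS_exists n (kernelT d kt) rho,
         dnS_exists n (kernelT d kp) rho,
         dnS_exists n (kernelP d Om ga kt) rho &
         dnS_exists n (kernelP d Om ga kp) rho]) /\
  exists L : {linear (H * H)%type -> (H * H)%type},
    (forall sigma : H * H,
       (L sigma).1 = dS1T sigma.1 + dS2T sigma.2 :> (boundary D -> R[i]) /\
       (L sigma).2 = dS1P sigma.1 + dS2P sigma.2 :> (boundary D -> R[i])) /\
    compact_operator L.
Proof.
move=> H dS1T dS2T dS1P dS2P.
have [_ oD _] := hD.
have d1 : (1 < d)%N by case: hd => ->.
have kneq0 (k : R[i]) : 0 < complex.Im k -> k != 0.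
  by move=> k0; apply: contraTneq k0 => ->; rewrite ltxx.
have rT := complex_radial_kernel_green hd (kneq0 _ hkt0).
have rP := complex_radial_kernel_green hd (kneq0 _ hkp0).
have rT' := complex_radial_kernelZ (m_factor Om ga kt) rT.
have rP' := complex_radial_kernelZ (m_factor Om ga kp) rP.
(* Any exponent strictly between [alpha] and 1 would serve. *)
pose beta : R := (alpha + 1) / 2.
have ab : alpha < beta by rewrite /beta; lra.
have b1 : beta < 1 by rewrite /beta; lra.
split; last exact: (layer_matrix_compact d1 oD hDb hDC2 hn halpha0 ab b1 rT rP rT' rP').
move=> rho.
have ex G : complex_radial_kernel d G -> dnS_exists n G rho.
  move=> Gr; have [C _ [h _]] := dnS_radial d1 oD hDb hDC2 hn halpha0 ab b1 Gr.
  by have [] := h rho.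
by split; apply: ex.
Qed.
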